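(* Let $N>2$ and let $a,c:\mathbb{R}^N\to\mathbb{R}$ satisfy: (AC1) $a,c\in C^{0,\alpha}_{loc}(\mathbb{R}^N)$ for some $\alpha\in(0,1)$; (AC2) $a(x)>0$ and $c(x)>0$ for all $x\in\mathbb{R}^N$; (A3) with $\varphi(r):=\max_{|x|=r}a(x)$ for $r\ge 0$, one has $\int_0^\infty r\varphi(r)\,dr<\infty$. Then the problem $$-\Delta u+c(x)\,u^{-1}|\nabla u|^{2}=a(x)\ \text{ in }\mathbb{R}^N,\qquad u>0\ \text{ in }\mathbb{R}^N,\qquad u(x)\to 0\ \text{ as }|x|\to\infty,$$ has a positive solution $u\in C^{2,\alpha}_{loc}(\mathbb{R}^N)$. If, in addition, $\lim_{|x|\to\infty}|x|^{\mu}\varphi(|x|)$ exists and is finite for some $\mu\in(2,N)$, then this solution satisfies $u(x)=O(|x|^{2-\mu})$ as $|x|\to\infty$. *)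

(* Defs.v *)
From Stdlib Require Import Reals Lra Lia Arith.
Open Scope R_scope.

Definition RN (N : nat) : Type :=
  {x : nat -> R | forall i, (N <= i)%nat -> x i = 0}.

Definition coord {N} (x : RN N) (i : nat) : R := proj1_sig x i.

Fixpoint sumN (n : nat) (f : nat -> R) : R :=
  match n with O => 0 | S m => sumN m f + f m end.

Definition nrm {N} (x : RN N) : R := sqrt (sumN N (fun i => (coord x i)^2)).
Definition dist {N} (x y : RN N) : R :=
  sqrt (sumN N (fun i => (coord x i - coord y i)^2)).

Definition shift_fun (N : nat) (x : nat -> R) (i : nat) (t : R) : nat -> R :=
  fun j => if andb (Nat.eqb j i) (Nat.ltb i N) then x j + t else x j.

Lemma shift_ok N (x : RN N) i t :
  forall j, (N <= j)%nat -> shift_fun N (proj1_sig x) i t j = 0.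
Proof.
  intros j Hj; unfold shift_fun.
  destruct (Nat.eqb_spec j i); destruct (Nat.ltb_spec i N); simpl;
    try (exfalso; lia); apply (proj2_sig x); auto.
Qed.

Definition shift {N} (x : RN N) (i : nat) (t : R) : RN N :=
  exist _ (shift_fun N (proj1_sig x) i t) (shift_ok N x i t).

Definition has_partial {N} (f : RN N -> R) (x : RN N) (i : nat) (l : R) : Prop :=
  derivable_pt_lim (fun t => f (shift x i t)) 0 l.

(* Local alpha-Hoelder continuity: Hoelder on every closed ball centered at 0
   (hence on every compact set). *)
Definition holder_loc {N} (f : RN N -> R) (alpha : R) : Prop :=
  forall R0, 0 < R0 -> exists C, forall x y : RN N,
    nrm x <= R0 -> nrm y <= R0 -> 0 < dist x y ->
    Rabs (f x - f y) <= C * Rpower (dist x y) alpha.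

Definition C0alpha_loc {N} (f : RN N -> R) (alpha : R) : Prop := holder_loc f alpha.

Definition C2alpha_loc_with {N} (u : RN N -> R) (alpha : R)
  (Du : nat -> RN N -> R) (D2u : nat -> nat -> RN N -> R) : Prop :=
  (forall i x, (i < N)%nat -> has_partial u x i (Du i x)) /\
  (forall i j x, (i < N)%nat -> (j < N)%nat -> has_partial (Du i) x j (D2u i j x)) /\
  holder_loc u alpha /\
  (forall i, (i < N)%nat -> holder_loc (Du i) alpha) /\
  (forall i j, (i < N)%nat -> (j < N)%nat -> holder_loc (D2u i j) alpha).

Definition is_sphere_max {N} (a : RN N -> R) (r m : R) : Prop :=
  (forall x : RN N, nrm x = r -> a x <= m) /\ (exists x : RN N, nrm x = r /\ a x = m).

Definition improper_int_finite (f : R -> R) : Prop :=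
  (forall b, 0 <= b -> inhabited (Riemann_integrable f 0 b)) /\
  exists L, forall eps, 0 < eps -> exists B, forall b (pr : Riemann_integrable f 0 b),
    B <= b -> Rabs (RiemannInt pr - L) < eps.

(* Main.v *)
(** The approximate solutions are polynomials, for which the classical facts needed are elementary.
    Poisson's equation with zero data on a sphere is solved exactly by a Fischer decomposition, and
    (K - Lap) has dense range on the ball, by Weierstrass for K = 0 and by perturbation in K.

    On the ball of radius r, |grad u|^2 / u is replaced by an upwind difference quotient of step h. It is
    positively 1-homogeneous, and for K large [w |-> K w - c upwind w] is monotone, so the iteration
    (K - Lap) w' = K w - c upwind w + a contracts the ratio of two iterates. This gives polynomials w
    solving the discretized equation up to an arbitrarily small error.

    Bounds uniform in r and h: from above by 2 U, with U the decaying radial solution of - Lap U = phi(|x|),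
    which (A3) makes finite; from below by a small bump; and, by doubling of variables with a logarithmic
    penalty and directions paired by a Householder reflection, a local Lipschitz bound. Hence Lap w is
    locally bounded, w is near harmonic polynomials on small balls, and a pointwise Campanato argument
    yields C^(1,alpha) bounds uniform along the sequence. Let u be its limit along an ultrafilter; the upwind
    quotients converge to |grad u|^2 / u, which is Hoelder, and the same argument one order higher makes u a
    C^(2,alpha) solution with 0 < u <= 2 U. *)

From mathcomp Require filter.
From Stdlib Require Import Reals Lra Lia Arith FunctionalExtensionality ProofIrrelevance ClassicalEpsilon.
From Coquelicot Require Import Coquelicot.
Require Import Defs.
Open Scope R_scope.

Set Bullet Behavior "Strict Subproofs".

Arguments coord : simpl never.

(** For constant c a power or a logarithm of u would absorb the gradient term; for variable c no
    change of unknown does, and the term is quadratic in the gradient and singular at u = 0. What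
    survives is invariance under u -> l u, apart from the source a. A quotient argument also
    tolerates errors proportional to a, which is why dense range is enough. The discretized equation
    cannot be differentiated, so the gradient bound has to come from comparing values at two points.
    The size of K, the contraction rate and the tolerance may all degenerate as h tends to 0,
    because the later bounds use only the equation and not its construction. The residual is also
    kept below a/2, so that - Lap w <= (3/2) a < 2 phi: this is the factor in 2 U. A single
    ultrafilter gives limits to the values and derivatives at all points at once, with no
    subsequence to extract. *)

(** * Finite sums *)

Lemma sumN_ext n f g : (forall i, (i < n)%nat -> f i = g i) -> sumN n f = sumN n g.
Proof.
  induction n as [|n IH]; simpl; intros H; [reflexivity|].
  rewrite IH by (intros; apply H; lia). rewrite H by lia. reflexivity.
Qed.

Lemma sumN_plus n f g : sumN n (fun i => f i + g i) = sumN n f + sumN n g.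
Proof. induction n as [|n IH]; simpl; [ring|]. rewrite IH; ring. Qed.

Lemma sumN_scal n k f : sumN n (fun i => k * f i) = k * sumN n f.
Proof. induction n as [|n IH]; simpl; [ring|]. rewrite IH; ring. Qed.

Lemma sumN_minus n f g : sumN n (fun i => f i - g i) = sumN n f - sumN n g.
Proof. induction n as [|n IH]; simpl; [ring|]. rewrite IH; ring. Qed.

Lemma sumN_const n k : sumN n (fun _ => k) = INR n * k.
Proof. induction n as [|n IH]; [simpl; ring|]. rewrite S_INR. simpl sumN. rewrite IH; ring. Qed.

Lemma sumN_le n f g : (forall i, (i < n)%nat -> f i <= g i) -> sumN n f <= sumN n g.
Proof.
  induction n as [|n IH]; simpl; intros H; [lra|].
  apply Rplus_le_compat; [apply IH; intros; apply H|apply H]; lia.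
Qed.

Lemma sumN_nonneg n f : (forall i, (i < n)%nat -> 0 <= f i) -> 0 <= sumN n f.
Proof.
  intros H. replace 0 with (sumN n (fun _ => 0)) by (rewrite sumN_const; ring).
  apply sumN_le; auto.
Qed.

Lemma sumN_term_le n f i :
  (forall j, (j < n)%nat -> 0 <= f j) -> (i < n)%nat -> f i <= sumN n f.
Proof.
  induction n as [|n IH]; simpl; intros H Hi; [lia|].
  destruct (Nat.eq_dec i n) as [->|].
  - assert (0 <= sumN n f) by (apply sumN_nonneg; intros; apply H; lia). lra.
  - assert (f i <= sumN n f) by (apply IH; [intros; apply H; lia|lia]).
    pose proof (H n ltac:(lia)). lra.
Qed.

Lemma sumN_abs n f : Rabs (sumN n f) <= sumN n (fun i => Rabs (f i)).
Proof.
  induction n as [|n IH]; simpl; [rewrite Rabs_R0; lra|].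
  eapply Rle_trans; [apply Rabs_triang|lra].
Qed.

Lemma sumN_abs_le n f k :
  (forall i, (i < n)%nat -> Rabs (f i) <= k) -> Rabs (sumN n f) <= INR n * k.
Proof.
  intros H. rewrite <- sumN_const. eapply Rle_trans; [apply sumN_abs|].
  apply sumN_le; auto.
Qed.

Lemma sumN_delta n i f :
  (i < n)%nat -> sumN n (fun j => f j * (if Nat.eqb j i then 1 else 0)) = f i.
Proof.
  assert (Z : forall m, (m <= i)%nat ->
     sumN m (fun j => f j * (if Nat.eqb j i then 1 else 0)) = 0).
  { induction m as [|m IH]; simpl; intros; [reflexivity|].
    rewrite IH by lia. destruct (Nat.eqb_spec m i); [lia|ring]. }
  induction n as [|n IH]; simpl; intros Hi; [lia|].
  destruct (Nat.eqb_spec n i) as [->|].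
  - rewrite Z by lia. ring.
  - rewrite IH by lia. ring.
Qed.

Lemma sumN_swap n m (f : nat -> nat -> R) :
  sumN n (fun i => sumN m (fun j => f i j)) = sumN m (fun j => sumN n (fun i => f i j)).
Proof.
  induction n as [|n IH]; simpl.
  - rewrite sumN_const; ring.
  - rewrite IH, <- sumN_plus. reflexivity.
Qed.

Lemma sumN_cauchy_schwarz n f g :
  (sumN n (fun i => f i * g i)) ^ 2 <= sumN n (fun i => f i ^ 2) * sumN n (fun i => g i ^ 2).
Proof.
  set (a := sumN n (fun i => f i ^ 2)). set (b := sumN n (fun i => f i * g i)).
  set (c := sumN n (fun i => g i ^ 2)).
  assert (Q : forall s t, 0 <= s ^ 2 * a + 2 * s * t * b + t ^ 2 * c).
  { intros s t. unfold a, b, c. rewrite <- !sumN_scal, <- !sumN_plus.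
    apply sumN_nonneg; intros. replace (_ + _) with ((s * f i + t * g i) ^ 2) by ring.
    apply pow2_ge_0. }
  assert (0 <= a) by (apply sumN_nonneg; intros; apply pow2_ge_0).
  assert (0 <= c) by (apply sumN_nonneg; intros; apply pow2_ge_0).
  destruct (Req_dec a 0) as [Ha|Ha].
  - assert (b = 0) as ->; [|rewrite Ha; lra].
    destruct (Req_dec b 0); auto. exfalso.
    (* With a = 0 the form is affine in s, and this s gives it the value - c - 2. *)
    pose proof (Q (- (c + 1) / b) 1) as HQ. rewrite Ha in HQ.
    replace (_ + _) with (- c - 2) in HQ by (field; auto). lra.
  - pose proof (Q b (- a)) as H1.
    replace (_ + _) with (a * (a * c - b ^ 2)) in H1 by ring.
    assert (0 <= a * c - b ^ 2); [|lra].
    destruct (Rle_or_lt 0 (a * c - b ^ 2)); auto.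
    assert (a * (a * c - b ^ 2) < 0) by nra. lra.
Qed.

(** * Vectors, Euclidean norm and distance *)

Section Points.
Context {N : nat}.
Implicit Types x y z v w : RN N.

Lemma RN_ext x y : (forall i, (i < N)%nat -> coord x i = coord y i) -> x = y.
Proof.
  intros H. assert (proj1_sig x = proj1_sig y) as E.
  { apply functional_extensionality. intros i. destruct (Nat.lt_ge_cases i N).
    - apply H; auto.
    - rewrite (proj2_sig x), (proj2_sig y); auto. }
  destruct x, y; simpl in *. subst. f_equal. apply proof_irrelevance.
Qed.

Lemma coord_out x i : (N <= i)%nat -> coord x i = 0.
Proof. apply (proj2_sig x). Qed.

Lemma mkpt_ok (f : nat -> R) i : (N <= i)%nat -> (if Nat.ltb i N then f i else 0) = 0.
Proof. intros H. destruct (Nat.ltb_spec i N); [lia|reflexivity]. Qed.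

Definition mkpt (f : nat -> R) : RN N := exist _ _ (mkpt_ok f).

Lemma coord_mkpt f i : (i < N)%nat -> coord (mkpt f) i = f i.
Proof. intros H. unfold coord; simpl. destruct (Nat.ltb_spec i N); [reflexivity|lia]. Qed.

Definition vadd x y : RN N := mkpt (fun i => coord x i + coord y i).
Definition vscal (t : R) x : RN N := mkpt (fun i => t * coord x i).
Definition vsub x y : RN N := mkpt (fun i => coord x i - coord y i).
Definition vzero : RN N := mkpt (fun _ => 0).
Definition basis (i : nat) : RN N := mkpt (fun j => if Nat.eqb j i then 1 else 0).

Lemma coord_vadd x y i : coord (vadd x y) i = coord x i + coord y i.
Proof.
  destruct (Nat.lt_ge_cases i N); [apply coord_mkpt; auto|].
  rewrite !coord_out by auto. ring.
Qed.
Lemma coord_vscal t x i : coord (vscal t x) i = t * coord x i.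
Proof.
  destruct (Nat.lt_ge_cases i N); [apply coord_mkpt; auto|].
  rewrite !coord_out by auto. ring.
Qed.
Lemma coord_vsub x y i : coord (vsub x y) i = coord x i - coord y i.
Proof.
  destruct (Nat.lt_ge_cases i N); [apply coord_mkpt; auto|].
  rewrite !coord_out by auto. ring.
Qed.
Lemma coord_vzero i : coord vzero i = 0.
Proof.
  destruct (Nat.lt_ge_cases i N); [apply (coord_mkpt (fun _ => 0)); auto|].
  apply coord_out; auto.
Qed.
Lemma coord_basis i j : (j < N)%nat -> coord (basis i) j = if Nat.eqb j i then 1 else 0.
Proof. intros. apply coord_mkpt; auto. Qed.

Definition dot x y : R := sumN N (fun i => coord x i * coord y i).

Definition nsq x : R := sumN N (fun i => coord x i ^ 2).

Lemma nsq_nonneg x : 0 <= nsq x.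
Proof. apply sumN_nonneg; intros; apply pow2_ge_0. Qed.

Lemma nrm_nonneg x : 0 <= nrm x.
Proof. apply sqrt_pos. Qed.

Lemma nrm_sqr x : nrm x ^ 2 = nsq x.
Proof. unfold nrm. apply pow2_sqrt, nsq_nonneg. Qed.

Lemma nrm_le_iff x r : 0 <= r -> (nrm x <= r <-> nsq x <= r ^ 2).
Proof.
  intros Hr. rewrite <- nrm_sqr. pose proof (nrm_nonneg x).
  split; intros; [apply pow_incr; lra|].
  destruct (Rle_or_lt (nrm x) r); auto. nra.
Qed.

Lemma nrm_lt_iff x r : 0 <= r -> (nrm x < r <-> nsq x < r ^ 2).
Proof.
  intros Hr. rewrite <- nrm_sqr. pose proof (nrm_nonneg x).
  split; intros; nra.
Qed.

Lemma nrm_eq_iff x r : 0 <= r -> (nrm x = r <-> nsq x = r ^ 2).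
Proof.
  intros Hr. rewrite <- nrm_sqr. pose proof (nrm_nonneg x).
  split; intros; nra.
Qed.

Lemma dist_nrm x y : dist x y = nrm (vsub x y).
Proof.
  unfold dist, nrm. f_equal. apply sumN_ext; intros. rewrite coord_vsub. reflexivity.
Qed.

Lemma dot_le x y : Rabs (dot x y) <= nrm x * nrm y.
Proof.
  pose proof (nrm_nonneg x). pose proof (nrm_nonneg y).
  pose proof (sumN_cauchy_schwarz N (coord x) (coord y)) as H1.
  fold (dot x y) (nsq x) (nsq y) in H1. rewrite <- !nrm_sqr in H1.
  assert (0 <= nrm x * nrm y) by nra.
  destruct (Rle_or_lt (Rabs (dot x y)) (nrm x * nrm y)) as [|Hlt]; auto.
  rewrite <- pow2_abs in H1. nra.
Qed.

Lemma nsq_vadd x y : nsq (vadd x y) = nsq x + 2 * dot x y + nsq y.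
Proof.
  unfold nsq, dot. rewrite <- sumN_scal, <- !sumN_plus. apply sumN_ext; intros.
  rewrite coord_vadd. ring.
Qed.

Lemma nrm_vadd x y : nrm (vadd x y) <= nrm x + nrm y.
Proof.
  pose proof (nrm_nonneg x). pose proof (nrm_nonneg y).
  apply nrm_le_iff; [lra|]. rewrite nsq_vadd, <- !nrm_sqr.
  pose proof (dot_le x y). pose proof (Rle_abs (dot x y)). nra.
Qed.

Lemma nsq_vscal t x : nsq (vscal t x) = t ^ 2 * nsq x.
Proof.
  unfold nsq. rewrite <- sumN_scal. apply sumN_ext; intros. rewrite coord_vscal. ring.
Qed.

Lemma nrm_vscal t x : nrm (vscal t x) = Rabs t * nrm x.
Proof.
  pose proof (nrm_nonneg x). pose proof (Rabs_pos t).
  apply nrm_eq_iff; [nra|]. rewrite nsq_vscal, <- nrm_sqr, <- (pow2_abs t). ring.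
Qed.

Lemma nsq_vzero : nsq vzero = 0.
Proof.
  unfold nsq. rewrite (sumN_ext _ _ (fun _ => 0)), sumN_const; [ring|].
  intros. rewrite coord_vzero. ring.
Qed.

Lemma nrm_vzero : nrm vzero = 0.
Proof. apply nrm_eq_iff; [lra|]. rewrite nsq_vzero. ring. Qed.

Lemma dot_basis x i : (i < N)%nat -> dot x (basis i) = coord x i.
Proof.
  intros Hi. unfold dot. rewrite <- (sumN_delta N i (coord x)) by auto.
  apply sumN_ext; intros. rewrite coord_basis by auto. reflexivity.
Qed.

Lemma nsq_basis i : (i < N)%nat -> nsq (basis i) = 1.
Proof.
  intros Hi. unfold nsq.
  rewrite (sumN_ext _ _ (fun j => 1 * (if Nat.eqb j i then 1 else 0))).
  - apply (sumN_delta N i (fun _ => 1)); auto.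
  - intros j Hj. rewrite coord_basis by auto. destruct (Nat.eqb j i); ring.
Qed.

Lemma nrm_basis i : (i < N)%nat -> nrm (basis i) = 1.
Proof. intros. apply nrm_eq_iff; [lra|]. rewrite nsq_basis by auto. ring. Qed.

Lemma coord_le_nrm x i : Rabs (coord x i) <= nrm x.
Proof.
  destruct (Nat.lt_ge_cases i N).
  - rewrite <- (dot_basis x i) by auto.
    pose proof (dot_le x (basis i)). rewrite nrm_basis in H0 by auto. lra.
  - rewrite coord_out, Rabs_R0 by auto. apply nrm_nonneg.
Qed.

Lemma dist_nonneg x y : 0 <= dist x y.
Proof. apply sqrt_pos. Qed.

Lemma dist_self x : dist x x = 0.
Proof.
  rewrite dist_nrm. replace (vsub x x) with vzero; [apply nrm_vzero|].
  apply RN_ext; intros. rewrite coord_vsub, coord_vzero. ring.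
Qed.

Lemma dist_sym x y : dist x y = dist y x.
Proof. unfold dist. f_equal. apply sumN_ext; intros. ring. Qed.

Lemma dist_tri x y z : dist x z <= dist x y + dist y z.
Proof.
  rewrite !dist_nrm. replace (vsub x z) with (vadd (vsub x y) (vsub y z)).
  - apply nrm_vadd.
  - apply RN_ext; intros. rewrite coord_vadd, !coord_vsub. ring.
Qed.

Lemma dist_eq0 x y : dist x y = 0 -> x = y.
Proof.
  rewrite dist_nrm. intros H. apply RN_ext; intros.
  pose proof (coord_le_nrm (vsub x y) i) as H1. rewrite H, coord_vsub in H1.
  pose proof (Rabs_pos (coord x i - coord y i)).
  assert (Rabs (coord x i - coord y i) = 0) as H3 by lra.
  apply Rabs_eq_0 in H3. lra.
Qed.

Lemma coord_dist x y i : Rabs (coord x i - coord y i) <= dist x y.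
Proof. rewrite dist_nrm, <- coord_vsub. apply coord_le_nrm. Qed.

Lemma dist_zero x : dist x vzero = nrm x.
Proof.
  rewrite dist_nrm. f_equal. apply RN_ext; intros. rewrite coord_vsub, coord_vzero. ring.
Qed.

Lemma nrm_dist x y : nrm x <= nrm y + dist x y.
Proof. rewrite <- !dist_zero, Rplus_comm. apply dist_tri. Qed.

Lemma dist_vadd x v : dist (vadd x v) x = nrm v.
Proof.
  rewrite dist_nrm. f_equal. apply RN_ext; intros. rewrite coord_vsub, coord_vadd. ring.
Qed.

Lemma dist_vadd_r x y v : dist (vadd x v) (vadd y v) = dist x y.
Proof.
  rewrite !dist_nrm. f_equal. apply RN_ext; intros. rewrite !coord_vsub, !coord_vadd. ring.
Qed.

Lemma vadd_vsub x y : vadd x (vsub y x) = y.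
Proof. apply RN_ext; intros. rewrite coord_vadd, coord_vsub. ring. Qed.

Lemma vadd_vzero x : vadd x vzero = x.
Proof. apply RN_ext; intros. rewrite coord_vadd, coord_vzero. ring. Qed.

Lemma vscal_0 x : vscal 0 x = vzero.
Proof. apply RN_ext; intros. rewrite coord_vscal, coord_vzero. ring. Qed.

Lemma shift_vadd x i t : (i < N)%nat -> shift x i t = vadd x (vscal t (basis i)).
Proof.
  intros Hi. apply RN_ext; intros j Hj.
  rewrite coord_vadd, coord_vscal, coord_basis by auto.
  unfold coord at 1; simpl; unfold shift_fun.
  destruct (Nat.ltb_spec i N); [|lia]. destruct (Nat.eqb j i); simpl; unfold coord; ring.
Qed.

Lemma nrm_vadd_basis x i t : (i < N)%nat -> nrm (vadd x (vscal t (basis i))) <= nrm x + Rabs t.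
Proof.
  intros. eapply Rle_trans; [apply nrm_vadd|]. rewrite nrm_vscal, nrm_basis by auto. lra.
Qed.
End Points.

(** * Polynomials and their formal derivatives *)

(** Syntax trees make differentiation a structural recursion. Different trees may define the same
    function, and [pderiv_ext] bridges that gap. A variable [PX i] with i >= N evaluates to 0. *)
Inductive poly : Type :=
| PC (c : R)
| PX (i : nat)
| PA (p q : poly)
| PM (p q : poly).

Fixpoint pderiv (i : nat) (p : poly) : poly :=
  match p with
  | PC _ => PC 0
  | PX j => PC (if Nat.eqb j i then 1 else 0)
  | PA p q => PA (pderiv i p) (pderiv i q)
  | PM p q => PA (PM (pderiv i p) q) (PM p (pderiv i q))
  end.

Fixpoint psum (n : nat) (f : nat -> poly) : poly :=
  match n with O => PC 0 | S m => PA (psum m f) (f m) end.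

Section PolyEval.
Context {N : nat}.
Implicit Types x y z v w : RN N.

Fixpoint peval (p : poly) x : R :=
  match p with
  | PC c => c
  | PX i => coord x i
  | PA p q => peval p x + peval q x
  | PM p q => peval p x * peval q x
  end.

Definition lap (p : poly) x : R := sumN N (fun i => peval (pderiv i (pderiv i p)) x).
Definition gradsq (p : poly) x : R := sumN N (fun i => peval (pderiv i p) x ^ 2).

Lemma peval_psum n f x : peval (psum n f) x = sumN n (fun i => peval (f i) x).
Proof. induction n as [|n IH]; simpl; [reflexivity|]. rewrite IH. reflexivity. Qed.

Lemma peval_bounded p r : exists M, 0 <= M /\ forall x, nrm x <= r -> Rabs (peval p x) <= M.
Proof.
  induction p as [c|i|p [A [HA IHp]] q [B [HB IHq]]|p [A [HA IHp]] q [B [HB IHq]]].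
  - exists (Rabs c). split; [apply Rabs_pos|]. intros; simpl; lra.
  - exists (Rabs r). split; [apply Rabs_pos|]. intros; simpl.
    eapply Rle_trans; [apply coord_le_nrm|]. eapply Rle_trans; [apply H|apply Rle_abs].
  - exists (A + B). split; [lra|]. intros; simpl.
    eapply Rle_trans; [apply Rabs_triang|]. specialize (IHp x H). specialize (IHq x H). lra.
  - exists (A * B). split; [nra|]. intros; simpl. rewrite Rabs_mult.
    apply Rmult_le_compat; auto using Rabs_pos.
Qed.

Lemma peval_lipschitz p r : exists L, 0 <= L /\
  forall x y, nrm x <= r -> nrm y <= r -> Rabs (peval p x - peval p y) <= L * dist x y.
Proof.
  induction p as [c|i|p [A [HA IHp]] q [B [HB IHq]]|p [A [HA IHp]] q [B [HB IHq]]].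
  - exists 0. split; [lra|]. intros; simpl. rewrite Rminus_diag, Rabs_R0. lra.
  - exists 1. split; [lra|]. intros; simpl. rewrite Rmult_1_l. apply coord_dist.
  - exists (A + B). split; [lra|]. intros x y Hx Hy; simpl.
    replace (_ - _) with ((peval p x - peval p y) + (peval q x - peval q y)) by ring.
    eapply Rle_trans; [apply Rabs_triang|].
    specialize (IHp x y Hx Hy). specialize (IHq x y Hx Hy). lra.
  - destruct (peval_bounded p r) as [P [HP BP]]. destruct (peval_bounded q r) as [Q [HQ BQ]].
    exists (A * Q + P * B). split; [nra|]. intros x y Hx Hy; simpl.
    replace (_ - _) with ((peval p x - peval p y) * peval q x + peval p y * (peval q x - peval q y)) by ring.
    eapply Rle_trans; [apply Rabs_triang|]. rewrite !Rabs_mult.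
    specialize (IHp x y Hx Hy). specialize (IHq x y Hx Hy).
    specialize (BP y Hy). specialize (BQ x Hx). pose proof (dist_nonneg x y).
    rewrite Rmult_plus_distr_r. apply Rplus_le_compat.
    + replace (A * Q * dist x y) with ((A * dist x y) * Q) by ring.
      apply Rmult_le_compat; auto using Rabs_pos.
    + rewrite Rmult_assoc. apply Rmult_le_compat; auto using Rabs_pos.
Qed.

Lemma peval_line_deriv p x v t :
  is_derive (fun t => peval p (vadd x (vscal t v))) t
    (sumN N (fun i => coord v i * peval (pderiv i p) (vadd x (vscal t v)))).
Proof.
  induction p as [c|i|p IHp q IHq|p IHp q IHq]; simpl.
  - rewrite (sumN_ext _ _ (fun _ => 0)) by (intros; ring).
    rewrite sumN_const, Rmult_0_r. auto_derive; auto.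
  - apply (is_derive_ext (fun t => coord x i + t * coord v i)).
    { intros s. rewrite coord_vadd, coord_vscal. reflexivity. }
    destruct (Nat.lt_ge_cases i N).
    + rewrite (sumN_ext _ _ (fun j => coord v j * (if Nat.eqb j i then 1 else 0))).
      * rewrite sumN_delta by auto. auto_derive; auto. ring.
      * intros j _. rewrite Nat.eqb_sym. reflexivity.
    + rewrite (sumN_ext _ _ (fun _ => 0)).
      * rewrite sumN_const, Rmult_0_r, !coord_out by auto. auto_derive; auto; ring.
      * intros j Hj. destruct (Nat.eqb_spec i j); [lia|ring].
  - rewrite (sumN_ext _ _ (fun i => coord v i * peval (pderiv i p) (vadd x (vscal t v))
       + coord v i * peval (pderiv i q) (vadd x (vscal t v)))) by (intros; ring).
    rewrite sumN_plus. apply (is_derive_plus (V := R_NormedModule)); auto.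
  - set (P := peval p (vadd x (vscal t v))). set (Q := peval q (vadd x (vscal t v))).
    rewrite (sumN_ext _ _ (fun i => Q * (coord v i * peval (pderiv i p) (vadd x (vscal t v)))
       + P * (coord v i * peval (pderiv i q) (vadd x (vscal t v))))) by (intros; ring).
    rewrite sumN_plus, !sumN_scal.
    rewrite (Rmult_comm Q).
    apply (is_derive_mult (K := R_AbsRing) _ _ t _ _ IHp IHq). intros; apply Rmult_comm.
Qed.

Lemma peval_basis_deriv p x i t : (i < N)%nat ->
  is_derive (fun t => peval p (vadd x (vscal t (basis i)))) t
    (peval (pderiv i p) (vadd x (vscal t (basis i)))).
Proof.
  intros Hi. pose proof (peval_line_deriv p x (basis i) t) as H.
  rewrite (sumN_ext _ _ (fun j => peval (pderiv j p) (vadd x (vscal t (basis i)))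
    * (if Nat.eqb j i then 1 else 0))) in H.
  - rewrite (sumN_delta N i (fun j => peval (pderiv j p) (vadd x (vscal t (basis i))))) in H by auto. exact H.
  - intros j Hj. rewrite coord_basis by auto. ring.
Qed.

(** The formal derivative is the analytic derivative along a basis vector, which depends on the
    function alone. This allows a tree under [pderiv] or [lap] to be replaced by a more convenient
    one with the same values. *)
Lemma pderiv_ext p q i : (i < N)%nat -> (forall x, peval p x = peval q x) ->
  forall x, peval (pderiv i p) x = peval (pderiv i q) x.
Proof.
  intros Hi E x. pose proof (peval_basis_deriv p x i 0 Hi) as H1.
  pose proof (peval_basis_deriv q x i 0 Hi) as H2.
  rewrite vscal_0, vadd_vzero in H1, H2.
  apply (is_derive_ext _ (fun t => peval q (vadd x (vscal t (basis i))))) in H1; [|intros; apply E].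
  apply is_derive_unique in H1. apply is_derive_unique in H2. congruence.
Qed.

Lemma lap_ext p q : (forall x, peval p x = peval q x) -> forall x, lap p x = lap q x.
Proof.
  intros E x. apply sumN_ext; intros. apply pderiv_ext; auto. apply pderiv_ext; auto.
Qed.

Lemma lap_PC c x : lap (PC c) x = 0.
Proof. unfold lap; simpl. rewrite sumN_const; ring. Qed.

Lemma lap_PA p q x : lap (PA p q) x = lap p x + lap q x.
Proof. unfold lap. rewrite <- sumN_plus. reflexivity. Qed.

Lemma lap_PM p q x : lap (PM p q) x = lap p x * peval q x
  + 2 * sumN N (fun i => peval (pderiv i p) x * peval (pderiv i q) x) + peval p x * lap q x.
Proof.
  unfold lap. rewrite (Rmult_comm (sumN _ _)), <- !sumN_scal, <- !sumN_plus.
  apply sumN_ext; intros; simpl. ring.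
Qed.

Lemma lap_scal c p x : lap (PM (PC c) p) x = c * lap p x.
Proof.
  rewrite lap_PM, lap_PC. simpl.
  rewrite (sumN_ext _ _ (fun _ => 0)) by (intros; ring). rewrite sumN_const. ring.
Qed.

Lemma pderiv_comm i j p x : peval (pderiv i (pderiv j p)) x = peval (pderiv j (pderiv i p)) x.
Proof.
  induction p as [c|k|p IHp q IHq|p IHp q IHq]; simpl; auto.
  - rewrite IHp, IHq; ring.
  - rewrite IHp, IHq; ring.
Qed.

(** The Laplacian of p is itself the value of a tree, here the zero function, so [pderiv_ext]
    differentiates the identity; it remains to commute derivatives. *)
Lemma lap_pderiv p i : (i < N)%nat -> (forall x, lap p x = 0) -> forall x, lap (pderiv i p) x = 0.
Proof.
  intros Hi H x.
  set (P := psum N (fun j => pderiv j (pderiv j p))).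
  assert (E : forall x, peval P x = peval (PC 0) x).
  { intros y. unfold P. rewrite peval_psum. apply H. }
  pose proof (pderiv_ext P (PC 0) i Hi E x) as H1. simpl in H1. rewrite <- H1.
  unfold P. unfold lap.
  assert (G : forall n f, peval (pderiv i (psum n f)) x = sumN n (fun j => peval (pderiv i (f j)) x)).
  { induction n; intros; simpl; auto. rewrite IHn; auto. }
  rewrite G. apply sumN_ext; intros j Hj.
  rewrite (pderiv_comm i j). apply pderiv_ext; auto. intros; apply pderiv_comm.
Qed.

Definition psq : poly := psum N (fun i => PM (PX i) (PX i)).

Lemma peval_psq x : peval psq x = nsq x.
Proof. unfold psq. rewrite peval_psum. apply sumN_ext; intros; simpl; ring. Qed.

Lemma pderiv_psum n f i x : peval (pderiv i (psum n f)) x = sumN n (fun j => peval (pderiv i (f j)) x).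
Proof. induction n; simpl; auto. rewrite IHn; auto. Qed.

Lemma pderiv_psq i x : (i < N)%nat -> peval (pderiv i psq) x = 2 * coord x i.
Proof.
  intros Hi. unfold psq. rewrite pderiv_psum. simpl.
  rewrite (sumN_ext _ _ (fun j => (2 * coord x j) * (if Nat.eqb j i then 1 else 0))) by (intros; ring).
  rewrite sumN_delta; auto.
Qed.

Lemma lap_psq x : lap psq x = 2 * INR N.
Proof.
  unfold lap. rewrite (sumN_ext _ _ (fun _ => 2)), sumN_const; [ring|].
  intros i Hi.
  rewrite (pderiv_ext (pderiv i psq) (PM (PC 2) (PX i)) i); auto.
  - simpl. rewrite Nat.eqb_refl. ring.
  - intros y. rewrite pderiv_psq by auto. reflexivity.
Qed.

Fixpoint ptrans (x0 : RN N) (p : poly) : poly :=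
  match p with
  | PC c => PC c
  | PX i => PA (PX i) (PC (coord x0 i))
  | PA p q => PA (ptrans x0 p) (ptrans x0 q)
  | PM p q => PM (ptrans x0 p) (ptrans x0 q)
  end.

Lemma peval_ptrans x0 p x : peval (ptrans x0 p) x = peval p (vadd x x0).
Proof.
  induction p as [c|i|p IHp q IHq|p IHp q IHq]; simpl; auto.
  - rewrite coord_vadd; reflexivity.
  - congruence.
  - congruence.
Qed.

Lemma pderiv_ptrans x0 p i x : peval (pderiv i (ptrans x0 p)) x = peval (pderiv i p) (vadd x x0).
Proof.
  induction p as [c|j|p IHp q IHq|p IHp q IHq]; simpl; auto; try ring.
  - congruence.
  - rewrite IHp, IHq, !peval_ptrans. ring.
Qed.

Lemma lap_ptrans x0 p x : lap (ptrans x0 p) x = lap p (vadd x x0).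
Proof.
  apply sumN_ext; intros i Hi. rewrite <- pderiv_ptrans. apply pderiv_ext; auto.
  intros y. rewrite pderiv_ptrans, peval_ptrans. reflexivity.
Qed.
End PolyEval.
Arguments psq : clear implicits.

(** * Limits along a free ultrafilter, compactness of balls, maximum principle *)

Lemma ultrafilter_exists : exists U : (nat -> Prop) -> Prop,
  (forall P Q : nat -> Prop, (forall n, P n -> Q n) -> U P -> U Q) /\
  (forall P Q, U P -> U Q -> U (fun n => P n /\ Q n)) /\
  (forall P, U P \/ U (fun n => ~ P n)) /\
  ~ U (fun _ => False) /\
  (forall n0, U (fun n => (n0 <= n)%nat)).
Proof.
  destruct (filter.ultraFilterLemma filter.eventually_filter) as [U [HU Hsub]].
  pose proof (@filter.ultra_proper _ _ HU) as HP.
  pose proof (@filter.filter_filter _ _ HP) as HF.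
  exists U. repeat split.
  - intros P Q PQ. apply (@filter.filterS _ _ HF). exact PQ.
  - intros P Q. apply (@filter.filterI _ _ HF).
  - intros P. exact (@filter.in_ultra_setVsetC _ _ P HU).
  - exact (@filter.filter_not_empty _ _ HP).
  - intros n0. apply Hsub. exists n0; [exact I|]. intros n Hn.
    apply (ssrbool.elimT (@ssrnat.leP n0 n)). exact Hn.
Qed.

(** Fixed once and for all, so that limits taken at different points or of different quantities are
    compatible with one another. *)
Definition ufilter : (nat -> Prop) -> Prop :=
  proj1_sig (constructive_indefinite_description _ ultrafilter_exists).

Lemma uf_mono (P Q : nat -> Prop) : (forall n, P n -> Q n) -> ufilter P -> ufilter Q.
Proof. apply (proj2_sig (constructive_indefinite_description _ ultrafilter_exists)). Qed.
Lemma uf_and P Q : ufilter P -> ufilter Q -> ufilter (fun n => P n /\ Q n).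
Proof. apply (proj2_sig (constructive_indefinite_description _ ultrafilter_exists)). Qed.
Lemma uf_or P : ufilter P \/ ufilter (fun n => ~ P n).
Proof. apply (proj2_sig (constructive_indefinite_description _ ultrafilter_exists)). Qed.
Lemma uf_false : ~ ufilter (fun _ => False).
Proof. apply (proj2_sig (constructive_indefinite_description _ ultrafilter_exists)). Qed.
Lemma uf_cofin n0 : ufilter (fun n => (n0 <= n)%nat).
Proof. apply (proj2_sig (constructive_indefinite_description _ ultrafilter_exists)). Qed.

Lemma uf_all (P : nat -> Prop) : (forall n, P n) -> ufilter P.
Proof. intros H. eapply uf_mono; [|apply (uf_cofin 0)]. auto. Qed.

Lemma uf_ex P : ufilter P -> exists n, P n.
Proof.
  intros H. apply NNPP. intros K. apply uf_false. eapply uf_mono; [|apply H].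
  intros n Hn. apply K; eauto.
Qed.

Definition ulim (s : nat -> R) (l : R) : Prop :=
  forall eps, 0 < eps -> ufilter (fun n => Rabs (s n - l) < eps).

Lemma ulim_const k : ulim (fun _ => k) k.
Proof. intros e He. apply uf_all. intros _. rewrite Rminus_diag, Rabs_R0. auto. Qed.

Lemma ulim_le s t l m : ulim s l -> ulim t m -> ufilter (fun n => s n <= t n) -> l <= m.
Proof.
  intros Hs Ht H. destruct (Rle_or_lt l m) as [|K]; auto. exfalso.
  destruct (uf_ex _ (uf_and _ _ H (uf_and _ _ (Hs ((l - m) / 2) ltac:(lra)) (Ht ((l - m) / 2) ltac:(lra)))))
    as [n [H1 [H2 H3]]].
  apply Rabs_lt_between in H2, H3. lra.
Qed.

Lemma ulim_unique s l m : ulim s l -> ulim s m -> l = m.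
Proof.
  intros H1 H2. apply Rle_antisym; eapply ulim_le; eauto; apply uf_all; intros; lra.
Qed.

Lemma ulim_plus s t l m : ulim s l -> ulim t m -> ulim (fun n => s n + t n) (l + m).
Proof.
  intros Hs Ht e He.
  eapply uf_mono; [|apply (uf_and _ _ (Hs (e / 2) ltac:(lra)) (Ht (e / 2) ltac:(lra)))].
  simpl; intros n [H1 H2]. replace (_ - _) with ((s n - l) + (t n - m)) by ring.
  eapply Rle_lt_trans; [apply Rabs_triang|lra].
Qed.

Lemma ulim_scal k s l : ulim s l -> ulim (fun n => k * s n) (k * l).
Proof.
  intros Hs e He. pose proof (Rabs_pos k).
  assert (He' : 0 < e / (Rabs k + 1)) by (apply Rdiv_lt_0_compat; lra).
  eapply uf_mono; [|apply (Hs _ He')].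
  simpl; intros n H1. rewrite <- Rmult_minus_distr_l, Rabs_mult.
  pose proof (Rabs_pos (s n - l)).
  apply Rle_lt_trans with ((Rabs k + 1) * Rabs (s n - l)); [nra|].
  replace e with ((Rabs k + 1) * (e / (Rabs k + 1))) by (field; lra).
  apply Rmult_lt_compat_l; lra.
Qed.

Lemma ulim_minus s t l m : ulim s l -> ulim t m -> ulim (fun n => s n - t n) (l - m).
Proof.
  intros Hs Ht. pose proof (ulim_plus _ _ _ _ Hs (ulim_scal (-1) _ _ Ht)) as H.
  intros e He. eapply uf_mono; [|apply (H e He)]. simpl; intros n.
  replace (_ - (l + -1 * m)) with (s n - t n - (l - m)) by ring. auto.
Qed.

Lemma ulim_cont (f : R -> R) s l : continuity_pt f l -> ulim s l -> ulim (fun n => f (s n)) (f l).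
Proof.
  intros Hf Hs e He. destruct (Hf e He) as [d [Hd Hc]].
  eapply uf_mono; [|apply (Hs d Hd)]. simpl; intros n Hn.
  destruct (Req_dec (s n) l) as [->|Hne].
  - rewrite Rminus_diag, Rabs_R0; auto.
  - apply (Hc (s n)). split; [split; [exact I|congruence]|]. exact Hn.
Qed.

Lemma ulim_sqr s l : ulim s l -> ulim (fun n => s n ^ 2) (l ^ 2).
Proof.
  intros Hs. apply (ulim_cont (fun x => x ^ 2)); auto.
  apply derivable_continuous_pt, derivable_pt_pow.
Qed.

Lemma ulim_mult s t l m : ulim s l -> ulim t m -> ulim (fun n => s n * t n) (l * m).
Proof.
  intros Hs Ht.
  pose proof (ulim_scal (1 / 4) _ _ (ulim_minus _ _ _ _ (ulim_sqr _ _ (ulim_plus _ _ _ _ Hs Ht))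
    (ulim_sqr _ _ (ulim_minus _ _ _ _ Hs Ht)))) as H.
  intros e He. eapply uf_mono; [|apply (H e He)]. simpl; intros n.
  replace (_ - _) with (s n * t n - l * m) by field. auto.
Qed.

Lemma ulim_sumN k (s : nat -> nat -> R) l :
  (forall i, (i < k)%nat -> ulim (s i) (l i)) -> ulim (fun n => sumN k (fun i => s i n)) (sumN k l).
Proof.
  induction k as [|k IH]; simpl; intros H; [apply ulim_const|].
  apply ulim_plus; [apply IH; intros; apply H|apply H]; lia.
Qed.

Lemma ulim_ext s t l : (forall n, s n = t n) -> ulim s l -> ulim t l.
Proof. intros E H e He. eapply uf_mono; [|apply (H e He)]. simpl; intros n. rewrite E; auto. Qed.

Lemma ulim_tends0 s : (forall eps, 0 < eps -> exists n0, forall n, (n0 <= n)%nat -> Rabs (s n) < eps) -> ulim s 0.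
Proof.
  intros H e He. destruct (H e He) as [n0 Hn]. eapply uf_mono; [|apply (uf_cofin n0)].
  simpl; intros. rewrite Rminus_0_r. auto.
Qed.

Lemma inv_succ_small eps : 0 < eps -> exists n0, forall n, (n0 <= n)%nat -> / INR (S n) < eps.
Proof.
  intros He. destruct (archimed_cor1 eps He) as [m [Hm Hpos]].
  exists m. intros n Hn. eapply Rle_lt_trans; [|apply Hm].
  apply Rinv_le_contravar; [apply lt_0_INR; lia|apply le_INR; lia].
Qed.

Lemma ulim_inv_succ : ulim (fun n => / INR (S n)) 0.
Proof.
  apply ulim_tends0. intros e He. destruct (inv_succ_small e He) as [n0 H].
  exists n0. intros n Hn. rewrite Rabs_pos_eq; auto.
  left. apply Rinv_0_lt_compat, lt_0_INR; lia.
Qed.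

Lemma ulim_squeeze s t l : ulim t 0 -> ufilter (fun n => Rabs (s n - l) <= t n) -> ulim s l.
Proof.
  intros Ht H e He. eapply uf_mono; [|apply (uf_and _ _ H (Ht e He))].
  simpl; intros n [H1 H2]. apply Rabs_lt_between in H2. lra.
Qed.

(** The limit is the supremum of the x that lie below s n for ultrafilter-many n; the dichotomy
    [uf_or] turns the failure of a lower bound into an upper bound. *)
Lemma ulim_ex s M : ufilter (fun n => Rabs (s n) <= M) -> exists l, ulim s l.
Proof.
  intros HM.
  destruct (completeness (fun x => ufilter (fun n => x <= s n))) as [l [Hub Hlub]].
  - exists (M + 1). intros x Hx.
    destruct (uf_ex _ (uf_and _ _ HM Hx)) as [n [H1 H2]]. apply Rabs_le_between in H1. lra.
  - exists (- M). eapply uf_mono; [|apply HM]. simpl; intros n H. apply Rabs_le_between in H. lra.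
  - exists l. intros e He.
    assert (A : ufilter (fun n => s n < l + e)).
    { destruct (uf_or (fun n => s n < l + e)) as [|K]; auto. exfalso.
      assert (l + e <= l); [|lra]. apply Hub. eapply uf_mono; [|apply K]. simpl; intros; lra. }
    assert (B : ufilter (fun n => l - e < s n)).
    { apply NNPP. intros K. assert (l <= l - e); [|lra]. apply Hlub. intros x Hx.
      destruct (Rle_or_lt x (l - e)); auto. exfalso. apply K.
      eapply uf_mono; [|apply Hx]. simpl; intros; lra. }
    eapply uf_mono; [|apply (uf_and _ _ A B)]. simpl; intros n [H1 H2].
    apply Rabs_lt_between. lra.
Qed.

Definition ulimit (s : nat -> R) : R := epsilon (inhabits 0) (ulim s).

Lemma ulimit_spec s M : ufilter (fun n => Rabs (s n) <= M) -> ulim s (ulimit s).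
Proof. intros H. unfold ulimit. apply epsilon_spec. eapply ulim_ex; eauto. Qed.

(** Compactness of S and continuity of f enter through a single hypothesis on sequences. The same
    lemma thus serves balls, pairs of points in the doubling argument, and functions of |x| that are
    not polynomial. *)
Lemma evt {T : Type} (S : T -> Prop) (f : T -> R) : (exists t, S t) ->
  (forall xs : nat -> T, (forall n, S (xs n)) ->
     exists x, S x /\ ulim (fun n => f (xs n)) (f x)) ->
  exists x, S x /\ forall y, S y -> f y <= f x.
Proof.
  intros [t0 Ht0] HC.
  assert (Hb : exists M, forall y, S y -> f y <= M).
  { apply NNPP. intros K.
    assert (C : forall n : nat, exists y, S y /\ INR n < f y).
    { intros n. apply NNPP. intros K'. apply K. exists (INR n). intros y Hy.
      destruct (Rle_or_lt (f y) (INR n)); auto. exfalso; eauto. }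
    apply choice in C. destruct C as [xs Hxs].
    destruct (HC xs ltac:(intros; apply Hxs)) as [x [_ Hx]].
    destruct (INR_unbounded (f x + 1)) as [m Hm].
    destruct (uf_ex _ (uf_and _ _ (Hx 1 ltac:(lra)) (uf_cofin m))) as [n [H1 H2]].
    apply Rabs_lt_between in H1. pose proof (proj2 (Hxs n)). apply le_INR in H2. lra. }
  destruct Hb as [M HM].
  destruct (completeness (fun r => exists y, S y /\ r = f y)) as [s [Hub Hlub]].
  { exists M. intros r [y [Hy ->]]. auto. }
  { exists (f t0); eauto. }
  assert (C : forall n : nat, exists y, S y /\ s - / INR (Datatypes.S n) < f y).
  { intros n. apply NNPP. intros K.
    assert (0 < / INR (Datatypes.S n)) by (apply Rinv_0_lt_compat, lt_0_INR; lia).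
    assert (s <= s - / INR (Datatypes.S n)); [|lra]. apply Hlub. intros r [y [Hy ->]].
    destruct (Rle_or_lt (f y) (s - / INR (Datatypes.S n))); auto. exfalso; eauto. }
  apply choice in C. destruct C as [xs Hxs].
  destruct (HC xs ltac:(intros; apply Hxs)) as [x [Sx Hx]].
  exists x. split; auto. intros y Hy.
  apply Rle_trans with s; [apply Hub; eauto|].
  apply (ulim_le (fun n => s - / INR (Datatypes.S n)) (fun n => f (xs n))); auto.
  - pose proof (ulim_minus _ _ _ _ (ulim_const s) ulim_inv_succ) as H. rewrite Rminus_0_r in H. exact H.
  - apply uf_all. intros n. left. apply Hxs.
Qed.

Section Compactness.
Context {N : nat}.
Implicit Types x y : RN N.

Lemma ball_compact (xs : nat -> RN N) r : (forall n, nrm (xs n) <= r) ->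
  exists x, nrm x <= r /\ ulim (fun n => dist (xs n) x) 0.
Proof.
  intros H.
  assert (Hc : forall i, ulim (fun n => coord (xs n) i) (ulimit (fun n => coord (xs n) i))).
  { intros i. apply (ulimit_spec _ r). apply uf_all. intros n.
    eapply Rle_trans; [apply coord_le_nrm|apply H]. }
  set (x := mkpt (N := N) (fun i => ulimit (fun n => coord (xs n) i))).
  assert (Hx : ulim (fun n => dist (xs n) x) 0).
  { rewrite <- sqrt_0. unfold dist.
    apply (ulim_cont sqrt); [apply continuity_pt_sqrt; lra|].
    replace 0 with (sumN N (fun i => 0)) by (rewrite sumN_const; ring).
    apply (ulim_sumN N (fun i n => (coord (xs n) i - coord x i) ^ 2)). intros i Hi.
    replace 0 with ((coord x i - coord x i) ^ 2) by ring.
    apply ulim_sqr, ulim_minus; [|apply ulim_const].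
    unfold x. rewrite coord_mkpt by auto. apply Hc. }
  exists x. split; auto.
  apply (ulim_le (fun n => nrm x - dist (xs n) x) (fun n => r)).
  - pose proof (ulim_minus _ _ _ _ (ulim_const (nrm x)) Hx) as K. rewrite Rminus_0_r in K. exact K.
  - apply ulim_const.
  - apply uf_all. intros n. pose proof (nrm_dist x (xs n)). rewrite dist_sym in H0.
    specialize (H n). lra.
Qed.

Lemma ulim_uniform (f : RN N -> R) (xs : nat -> RN N) x r :
  (forall eps, 0 < eps -> exists d, 0 < d /\ forall y z, nrm y <= r -> nrm z <= r ->
     dist y z < d -> Rabs (f y - f z) < eps) ->
  (forall n, nrm (xs n) <= r) -> nrm x <= r -> ulim (fun n => dist (xs n) x) 0 ->
  ulim (fun n => f (xs n)) (f x).
Proof.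
  intros Hf Hxs Hx Hd e He. destruct (Hf e He) as [d [Hd0 H]].
  eapply uf_mono; [|apply (Hd d Hd0)]. simpl; intros n Hn. apply H; auto.
  rewrite Rminus_0_r in Hn. apply Rabs_lt_between in Hn. lra.
Qed.

Definition unif_cont_on (r : R) (f : RN N -> R) : Prop :=
  forall eps, 0 < eps -> exists d, 0 < d /\ forall y z, nrm y <= r -> nrm z <= r ->
     dist y z < d -> Rabs (f y - f z) < eps.

Lemma lipschitz_unif_cont r (f : RN N -> R) L : 0 <= L ->
  (forall y z, nrm y <= r -> nrm z <= r -> Rabs (f y - f z) <= L * dist y z) -> unif_cont_on r f.
Proof.
  intros HL H e He. exists (e / (L + 1)). split; [apply Rdiv_lt_0_compat; lra|].
  intros y z Hy Hz Hd. eapply Rle_lt_trans; [apply H; auto|].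
  pose proof (dist_nonneg y z).
  apply Rle_lt_trans with ((L + 1) * dist y z); [nra|].
  replace e with ((L + 1) * (e / (L + 1))) by (field; lra).
  apply Rmult_lt_compat_l; lra.
Qed.

Lemma poly_unif_cont p r : unif_cont_on r (peval p).
Proof. destruct (peval_lipschitz (N := N) p r) as [L [HL H]]. apply (lipschitz_unif_cont _ _ L); auto. Qed.

Lemma ball_max (f : RN N -> R) r : 0 <= r -> unif_cont_on r f ->
  exists x, nrm x <= r /\ forall y, nrm y <= r -> f y <= f x.
Proof.
  intros Hr Hf. apply (evt (fun x => nrm x <= r) f).
  - exists vzero. rewrite nrm_vzero; auto.
  - intros xs Hxs. destruct (ball_compact xs r Hxs) as [x [Hx Hd]]. exists x. split; auto.
    eapply ulim_uniform; eauto.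
Qed.

Lemma max_second_deriv (f f' : R -> R) d delta : 0 < delta ->
  (forall t, Rabs t < delta -> is_derive f t (f' t)) -> is_derive f' 0 d ->
  (forall t, Rabs t < delta -> f t <= f 0) -> d <= 0.
Proof.
  intros Hdel Hf Hf' Hmax.
  assert (Z : f' 0 = 0).
  { assert (pr : derivable_pt f 0).
    { exists (f' 0). apply is_derive_Reals, Hf. rewrite Rabs_R0; auto. }
    assert (derive_pt f 0 pr = f' 0).
    { apply derive_pt_eq_0, is_derive_Reals, Hf. rewrite Rabs_R0; auto. }
    rewrite <- H. apply (deriv_maximum f (- delta) delta); try lra.
    intros t H1 H2. apply Hmax. apply Rabs_lt_between. lra. }
  destruct (Rle_or_lt d 0) as [|Hd]; auto. exfalso.
  apply is_derive_Reals in Hf'. destruct (Hf' (d / 2) ltac:(lra)) as [e He].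
  set (t := Rmin (e / 2) (delta / 2)).
  assert (Ht : 0 < t) by (unfold t; apply Rmin_glb_lt; [pose proof (cond_pos e)|]; lra).
  assert (Ht1 : t <= e / 2) by apply Rmin_l. assert (Ht2 : t <= delta / 2) by apply Rmin_r.
  pose proof (cond_pos e).
  assert (P : forall s, 0 < s <= t -> 0 < f' s).
  { intros s Hs. specialize (He s ltac:(lra)). rewrite Rabs_pos_eq in He by lra.
    specialize (He ltac:(lra)). rewrite Rplus_0_l, Z, Rminus_0_r in He.
    apply Rabs_lt_between in He.
    assert (0 < f' s / s) by lra.
    replace (f' s) with (f' s / s * s) by (field; lra). apply Rmult_lt_0_compat; lra. }
  assert (M : forall p q, 0 <= p < q -> q <= t -> exists c, p <= c <= q /\ f q - f p = f' c * (q - p)).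
  { intros p q Hpq Hq. destruct (MVT_gen f p q f') as [c Hc].
    - intros x Hx. rewrite Rmin_left, Rmax_right in Hx by lra. apply Hf, Rabs_lt_between. lra.
    - intros x Hx. rewrite Rmin_left, Rmax_right in Hx by lra.
      apply derivable_continuous_pt. exists (f' x). apply is_derive_Reals, Hf, Rabs_lt_between. lra.
    - rewrite Rmin_left, Rmax_right in Hc by lra. eauto. }
  (* On [0, t] the mean value theorem could return the point 0, where f' vanishes. The first half
     only gives f (t/2) >= f 0; the strict increase comes from the second half. *)
  destruct (M 0 (t / 2) ltac:(lra) ltac:(lra)) as [c1 [Hc1 E1]].
  destruct (M (t / 2) t ltac:(lra) ltac:(lra)) as [c2 [Hc2 E2]].
  assert (0 <= f' c1).
  { destruct (Req_dec c1 0) as [->|]; [lra|]. left. apply P. lra. }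
  assert (0 <= f' c1 * (t / 2 - 0)) by (apply Rmult_le_pos; lra).
  assert (0 < f' c2 * (t - t / 2)) by (apply Rmult_lt_0_compat; [apply P|]; lra).
  assert (f t <= f 0) by (apply Hmax, Rabs_lt_between; lra). lra.
Qed.

Lemma interior_max_lap p x r : nrm x < r ->
  (forall y, nrm y <= r -> peval p y <= peval p x) -> lap p x <= 0.
Proof.
  intros Hx Hmax. unfold lap. rewrite <- (Rmult_0_r (INR N)), <- sumN_const.
  apply sumN_le. intros i Hi.
  apply (max_second_deriv (fun t => peval p (vadd x (vscal t (basis i))))
     (fun t => peval (pderiv i p) (vadd x (vscal t (basis i))))
     (peval (pderiv i (pderiv i p)) x) (r - nrm x)).
  - lra.
  - intros t _. apply peval_basis_deriv; auto.
  - pose proof (peval_basis_deriv (pderiv i p) x i 0 Hi) as H.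
    rewrite vscal_0, vadd_vzero in H. exact H.
  - intros t Ht. rewrite vscal_0, vadd_vzero. apply Hmax.
    eapply Rle_trans; [apply nrm_vadd_basis; auto|lra].
Qed.

Lemma max_principle_strict p r : 0 <= r -> (forall x, nrm x = r -> peval p x <= 0) ->
  (forall x, nrm x < r -> 0 < peval p x -> 0 < lap p x) ->
  forall x, nrm x <= r -> peval p x <= 0.
Proof.
  intros Hr Hb Hi x Hx.
  destruct (ball_max (peval p) r Hr (poly_unif_cont p r)) as [z [Hz Hmax]].
  apply Rle_trans with (peval p z); auto.
  destruct (Rle_or_lt (peval p z) 0) as [|Hp]; auto.
  destruct (Rle_lt_or_eq_dec _ _ Hz) as [Hlt|Heq]; [|apply Hb; auto].
  pose proof (Hi z Hlt Hp). pose proof (interior_max_lap p z r Hlt Hmax). lra.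
Qed.

(** The sign of the Laplacian is required only where p is positive, so that a zero-order term K p
    with K >= 0 is covered as well. Strictness is gained by adding k (|x|^2 - r^2), which is
    nonpositive on the ball and has Laplacian 2 k N. *)
Lemma max_principle p r : (0 < N)%nat -> 0 <= r -> (forall x, nrm x = r -> peval p x <= 0) ->
  (forall x, nrm x < r -> 0 < peval p x -> 0 <= lap p x) ->
  forall x, nrm x <= r -> peval p x <= 0.
Proof.
  intros HN Hr Hb Hi x Hx. apply le_epsilon. intros e He. rewrite Rplus_0_l.
  set (k := e / (r ^ 2 + 1)).
  assert (Hk : 0 < k) by (apply Rdiv_lt_0_compat; nra).
  assert (HN' : 0 < INR N) by (apply lt_0_INR; auto).
  assert (Q : forall y, peval (PA p (PM (PC k) (PA (psq N) (PC (- r ^ 2))))) y = peval p y + k * (nsq y - r ^ 2)).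
  { intros y. simpl. rewrite peval_psq. ring. }
  assert (G : peval (PA p (PM (PC k) (PA (psq N) (PC (- r ^ 2))))) x <= 0).
  { apply (max_principle_strict _ r); auto.
    - intros y Hy. rewrite Q. apply nrm_eq_iff in Hy; auto. rewrite Hy. pose proof (Hb y).
      rewrite nrm_eq_iff in H by auto. specialize (H Hy). nra.
    - intros y Hy. rewrite Q. intros Hp.
      rewrite lap_PA, lap_scal, lap_PA, lap_psq, lap_PC.
      pose proof (proj1 (nrm_lt_iff y r Hr) Hy).
      assert (0 < peval p y) by nra. pose proof (Hi y Hy H0). nra. }
  rewrite Q in G. pose proof (nsq_nonneg x).
  assert (k * r ^ 2 <= e); [|nra].
  replace e with (k * (r ^ 2 + 1)) by (unfold k; field; nra). nra.
Qed.
End Compactness.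

(** * Interior estimates for harmonic polynomials *)

Section Interior.
Context {N : nat}.
Hypothesis HN0 : (0 < N)%nat.
Implicit Types x y v : RN N.

Definition harmonic (h : poly) : Prop := forall x : RN N, lap h x = 0.

Definition pdir v (p : poly) : poly := psum N (fun i => PM (PC (coord v i)) (pderiv i p)).

Lemma peval_pdir v p x : peval (pdir v p) x = sumN N (fun i => coord v i * peval (pderiv i p) x).
Proof. unfold pdir. rewrite peval_psum. reflexivity. Qed.

Lemma lap_psum n f x : lap (psum n f) x = sumN n (fun i => lap (f i) x).
Proof. induction n as [|n IH]; simpl; [apply lap_PC|]. rewrite lap_PA, IH. reflexivity. Qed.

Lemma harmonic_pderiv h i : (i < N)%nat -> harmonic h -> harmonic (pderiv i h).
Proof. intros Hi H x. apply lap_pderiv; auto. Qed.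

Lemma harmonic_pdir v h : harmonic h -> harmonic (pdir v h).
Proof.
  intros H x. unfold pdir. rewrite lap_psum.
  rewrite (sumN_ext _ _ (fun _ => 0)), sumN_const; [ring|].
  intros i Hi. rewrite lap_scal, harmonic_pderiv by auto. ring.
Qed.

Definition pminus p q : poly := PA p (PM (PC (-1)) q).
Lemma peval_pminus p q x : peval (pminus p q) x = peval p x - peval q x.
Proof. simpl. ring. Qed.
Lemma lap_pminus p q x : lap (pminus p q) x = lap p x - lap q x.
Proof. unfold pminus. rewrite lap_PA, lap_scal. ring. Qed.

Lemma harmonic_pminus p q : harmonic p -> harmonic q -> harmonic (pminus p q).
Proof. intros Hp Hq x. rewrite lap_pminus, Hp, Hq. ring. Qed.

Lemma harmonic_ptrans x0 h : harmonic h -> harmonic (ptrans x0 h).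
Proof. intros H x. rewrite lap_ptrans. apply H. Qed.

(** Chosen so that, after the mixed term is estimated, (D_i h)^2 keeps the coefficient 24 (r^2 -
    |x|^2) + 4 N (r^2 - z) in the Laplacian of Bernstein's polynomial, which is nonnegative on the
    ball. *)
Definition gradC : R := 12 + 2 * INR N.

(* Bernstein's trick: with z = r^2 - |x|^2, the polynomial z^2 (D_i h)^2 + gradC r^2 h^2 is subharmonic. *)
Lemma harmonic_deriv_center h r M i : 0 < r -> harmonic h ->
  (forall x, nrm x <= r -> Rabs (peval h x) <= M) -> (i < N)%nat ->
  Rabs (peval (pderiv i h) (@vzero N)) <= gradC * M / r.
Proof.
  intros Hr Hh HM Hi. pose proof (pos_INR N) as HNR.
  set (g := pderiv i h). set (z := pminus (PC (r ^ 2)) (psq N)).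
  set (lam := gradC * r ^ 2).
  assert (HM0 : 0 <= M).
  { eapply Rle_trans; [apply Rabs_pos|apply (HM vzero)]. rewrite nrm_vzero; lra. }
  assert (Hz : forall x, peval z x = r ^ 2 - nsq x).
  { intros x. unfold z. rewrite peval_pminus, peval_psq. reflexivity. }
  assert (Hzl : forall x, lap z x = - 2 * INR N).
  { intros x. unfold z. rewrite lap_pminus, lap_PC, lap_psq. ring. }
  assert (Hzd : forall x j, (j < N)%nat -> peval (pderiv j z) x = - 2 * coord x j).
  { intros x j Hj. unfold z, pminus. simpl. rewrite pderiv_psq by auto. ring. }
  clearbody z.
  set (w := PA (PM (PM z z) (PM g g)) (PA (PM (PC lam) (PM h h)) (PC (- lam * M ^ 2)))).
  assert (Hw : forall x, peval w x = (r ^ 2 - nsq x) ^ 2 * peval g x ^ 2 + lam * (peval h x ^ 2 - M ^ 2)).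
  { intros x. unfold w. simpl. rewrite Hz. ring. }
  assert (Hlam : 0 <= lam) by (unfold lam, gradC; nra).
  assert (HMP : peval w (@vzero N) <= 0).
  { apply (max_principle w r); auto; [lra| | |].
    - intros x Hx. rewrite Hw.
      assert (nsq x = r ^ 2) as -> by (apply nrm_eq_iff; lra).
      specialize (HM x ltac:(lra)). rewrite <- (pow2_abs (peval h x)).
      pose proof (Rabs_pos (peval h x)).
      assert (Rabs (peval h x) ^ 2 <= M ^ 2) by (apply pow_incr; lra). nra.
    - intros x Hx _. unfold w.
      rewrite lap_PA, lap_PA, lap_scal, lap_PC, (lap_PM (PM z z)), !(lap_PM z z), (lap_PM g g), (lap_PM h h).
      rewrite (Hh x), Hzl, ?(harmonic_pderiv h i Hi Hh x : lap g x = 0).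
      cbn [peval pderiv]. rewrite Hz.
      set (G := peval g x). set (Z := r ^ 2 - nsq x).
      assert (HZ : 0 <= Z <= r ^ 2).
      { unfold Z. apply nrm_lt_iff in Hx; [|lra]. pose proof (nsq_nonneg x). lra. }
      assert (S1 : sumN N (fun j => peval (pderiv j z) x * peval (pderiv j z) x) = 4 * nsq x).
      { unfold nsq. rewrite <- sumN_scal. apply sumN_ext; intros j Hj. rewrite Hzd by auto. ring. }
      assert (S3 : G ^ 2 <= sumN N (fun j => peval (pderiv j h) x * peval (pderiv j h) x)).
      { replace (G ^ 2) with (peval (pderiv i h) x * peval (pderiv i h) x) by (unfold G, g; ring).
        apply (sumN_term_le N (fun j => peval (pderiv j h) x * peval (pderiv j h) x)); auto.
        intros; nra. }
      (* The mixed term is absorbed by the second derivatives of h, coordinate by coordinate, from 2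
         (Z d - 4 G c)^2 >= 0. *)
      assert (S2 : - 32 * G ^ 2 * nsq x <=
        2 * sumN N (fun j => (peval (pderiv j z) x * Z + Z * peval (pderiv j z) x) *
            (peval (pderiv j g) x * G + G * peval (pderiv j g) x))
        + Z ^ 2 * (2 * sumN N (fun j => peval (pderiv j g) x * peval (pderiv j g) x))).
      { unfold nsq. rewrite <- (Rmult_assoc (Z ^ 2)), <- !sumN_scal, <- sumN_plus.
        apply sumN_le; intros j Hj. rewrite Hzd by auto.
        set (d := peval (pderiv j g) x). set (c := coord x j).
        pose proof (pow2_ge_0 (Z * d - 4 * G * c)). nra. }
      fold G. rewrite S1.
      assert (HG : 0 <= G ^ 2) by apply pow2_ge_0.
      assert (HX : nsq x <= r ^ 2) by (unfold Z in HZ; lra).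
      pose proof (nsq_nonneg x) as HX0.
      assert (F : 0 <= (2 * (8 * nsq x) / 2 - 4 * INR N * Z) * G ^ 2 - 32 * G ^ 2 * nsq x + lam * (2 * G ^ 2)).
      { unfold lam, gradC.
        replace (_ + _) with (G ^ 2 * (24 * (r ^ 2 - nsq x) + 4 * INR N * (r ^ 2 - Z))) by field.
        apply Rmult_le_pos; auto. nra. }
      assert (F2 : lam * (2 * G ^ 2) <= lam * (2 * sumN N (fun j => peval (pderiv j h) x * peval (pderiv j h) x))) by nra.
      lra.
    - rewrite nrm_vzero; lra. }
  rewrite Hw, nsq_vzero in HMP. fold g.
  assert (K : (r * Rabs (peval g (@vzero N))) ^ 2 <= (gradC * M) ^ 2).
  { rewrite Rpow_mult_distr, pow2_abs.
    assert (gradC * M ^ 2 <= (gradC * M) ^ 2).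
    { rewrite Rpow_mult_distr. apply Rmult_le_compat_r; [apply pow2_ge_0|]. unfold gradC; nra. }
    assert (r ^ 2 * (r ^ 2 * peval g (@vzero N) ^ 2) <= r ^ 2 * (gradC * M ^ 2)).
    { unfold lam in HMP. pose proof (pow2_ge_0 (peval h (@vzero N))).
      assert (0 <= gradC * r ^ 2 * peval h (@vzero N) ^ 2) by (apply Rmult_le_pos; auto). lra. }
    apply Rmult_le_reg_l in H0; [lra|]. nra. }
  apply Rmult_le_reg_l with r; auto.
  replace (r * (gradC * M / r)) with (gradC * M) by (field; lra).
  pose proof (Rabs_pos (peval g (@vzero N))).
  assert (0 <= gradC * M) by (unfold gradC; apply Rmult_le_pos; lra).
  destruct (Rle_or_lt (r * Rabs (peval g (@vzero N))) (gradC * M)); auto. nra.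
Qed.
End Interior.

Section InteriorIter.
Context {N : nat}.
Hypothesis HN0 : (0 < N)%nat.
Implicit Types x y v : RN N.

Lemma gradC_pos : 0 < gradC (N := N).
Proof. unfold gradC. pose proof (pos_INR N). lra. Qed.

Lemma harmonic_pdir_bound h x0 v r M : 0 < r -> harmonic (N := N) h ->
  (forall x, dist x x0 <= r -> Rabs (peval h x) <= M) ->
  Rabs (peval (pdir v h) x0) <= INR N * gradC (N := N) * nrm v * M / r.
Proof.
  intros Hr Hh HM. rewrite peval_pdir.
  replace (INR N * gradC (N := N) * nrm v * M / r) with (INR N * (nrm v * (gradC (N := N) * M / r))) by (field; lra).
  apply sumN_abs_le. intros i Hi. rewrite Rabs_mult.
  apply Rmult_le_compat; auto using Rabs_pos, coord_le_nrm.
  pose proof (harmonic_deriv_center HN0 (ptrans x0 h) r M i Hr (harmonic_ptrans x0 h Hh)) as K.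
  rewrite pderiv_ptrans in K.
  replace (vadd vzero x0) with x0 in K.
  - apply K; auto. intros x Hx. rewrite peval_ptrans. apply HM.
    rewrite dist_nrm. replace (vsub (vadd x x0) x0) with x; auto.
    apply RN_ext; intros. rewrite coord_vsub, coord_vadd. ring.
  - apply RN_ext; intros. rewrite coord_vadd, coord_vzero. ring.
Qed.

Fixpoint pdirn (m : nat) v (p : poly) : poly :=
  match m with O => p | S m => pdir v (pdirn m v p) end.

Lemma harmonic_pdirn m v h : harmonic (N := N) h -> harmonic (N := N) (pdirn m v h).
Proof. induction m; simpl; auto. intros. apply harmonic_pdir; auto. Qed.

Fixpoint dirC (m : nat) : R :=
  match m with O => 1 | S m => dirC m * (INR N * gradC (N := N)) * 2 ^ S m end.

Lemma dirC_nonneg m : 0 <= dirC m.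
Proof.
  induction m; [simpl; lra|]. change (0 <= dirC m * (INR N * gradC (N := N)) * 2 ^ S m).
  pose proof gradC_pos. pose proof (pos_INR N). pose proof (pow_lt 2 (S m) ltac:(lra)).
  apply Rmult_le_pos; [|lra]. apply Rmult_le_pos; auto. apply Rmult_le_pos; lra.
Qed.

(** Each differentiation gives up half of the current radius, to leave room for the ball on which
    the gradient estimate is applied. The powers of 2 in [dirC] come from this halving. *)
Lemma harmonic_pdirn_bound m h x0 v r M : 0 < r -> harmonic (N := N) h ->
  (forall x, dist x x0 <= r -> Rabs (peval h x) <= M) ->
  forall x, dist x x0 <= r / 2 ^ m -> Rabs (peval (pdirn m v h) x) <= dirC m * M * (nrm v / r) ^ m.
Proof.
  intros Hr Hh HM. induction m as [|m IH]; intros x Hx.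
  - simpl in *. rewrite Rdiv_1_r in Hx. specialize (HM x Hx). lra.
  - pose proof (pow_lt 2 m ltac:(lra)) as P2.
    change (pdirn (S m) v h) with (pdir v (pdirn m v h)).
    eapply Rle_trans; [apply (harmonic_pdir_bound _ x v (r / 2 ^ S m) (dirC m * M * (nrm v / r) ^ m))|].
    + apply Rdiv_lt_0_compat; [lra|apply pow_lt; lra].
    + apply harmonic_pdirn; auto.
    + intros y Hy. apply IH. eapply Rle_trans; [apply (dist_tri y x x0)|].
      replace (r / 2 ^ m) with (r / 2 ^ S m + r / 2 ^ S m) by (simpl; field; lra). lra.
    + right. simpl. field. split; lra.
Qed.

Lemma pdirn_line m v p x t : is_derive (fun t => peval (pdirn m v p) (vadd x (vscal t v))) t
  (peval (pdirn (S m) v p) (vadd x (vscal t v))).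
Proof. simpl. rewrite peval_pdir. apply peval_line_deriv. Qed.
End InteriorIter.
Arguments dirC : clear implicits.
Arguments gradC : clear implicits.

(** * Poisson's equation with polynomial data on a ball *)

Section Poisson.
Context {N : nat}.
Hypothesis HN0 : (0 < N)%nat.
Implicit Types x y v : RN N.

(** Subtraction of degrees truncates at 0; since the zero polynomial is given every degree and
    equality of values is built in, a derivative has degree k - 1 even for k = 0, and summands that
    vanish identically can be discarded. *)
Inductive hom : nat -> poly -> Prop :=
| hom_PC c : hom 0 (PC c)
| hom_0 k : hom k (PC 0)
| hom_PX i : hom 1 (PX i)
| hom_PA k p q : hom k p -> hom k q -> hom k (PA p q)
| hom_PM k l p q : hom k p -> hom l q -> hom (k + l) (PM p q)
| hom_eq k p q : hom k p -> (forall x : RN N, peval p x = peval q x) -> hom k q.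

Lemma hom_pderiv k p i : (i < N)%nat -> hom k p ->
  (k = 0%nat -> forall x : RN N, peval (pderiv i p) x = 0) /\ hom (k - 1) (pderiv i p).
Proof.
  intros Hi H. induction H as [c|k|j|k p q Hp [IHp0 IHp] Hq [IHq0 IHq]
    |k l p q Hp [IHp0 IHp] Hq [IHq0 IHq]|k p q Hp [IHp0 IHp] E]; simpl.
  - split; [auto|constructor].
  - split; [auto|constructor].
  - split; [lia|constructor].
  - split; [intros Hk x; rewrite IHp0, IHq0 by auto; ring|constructor; auto].
  - split.
    + intros Hk x. rewrite IHp0, IHq0 by lia. ring.
    + destruct k as [|k].
      * apply hom_eq with (PM p (pderiv i q)).
        { replace (0 + l - 1)%nat with (0 + (l - 1))%nat by lia. constructor; auto. }
        intros x; simpl. rewrite IHp0 by auto. ring.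
      * destruct l as [|l].
        { apply hom_eq with (PM (pderiv i p) q).
          - replace (S k + 0 - 1)%nat with (S k - 1 + 0)%nat by lia. constructor; auto.
          - intros x; simpl. rewrite IHq0 by auto. ring. }
        constructor.
        { replace (S k + S l - 1)%nat with (S k - 1 + S l)%nat by lia. constructor; auto. }
        { replace (S k + S l - 1)%nat with (S k + (S l - 1))%nat by lia. constructor; auto. }
  - split.
    + intros Hk x. rewrite <- (pderiv_ext p q i Hi E). auto.
    + apply hom_eq with (pderiv i p); auto. apply pderiv_ext; auto.
Qed.

Definition plap (p : poly) : poly := psum N (fun i => pderiv i (pderiv i p)).

Lemma peval_plap p x : peval (plap p) x = lap p x.
Proof. unfold plap. rewrite peval_psum. reflexivity. Qed.

Lemma hom_psum n k f : (forall i, (i < n)%nat -> hom k (f i)) -> hom k (psum n f).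
Proof. induction n; simpl; intros; constructor; auto. Qed.

Lemma hom_plap k p : hom k p -> hom (k - 2) (plap p).
Proof.
  intros H. apply hom_psum. intros i Hi.
  replace (k - 2)%nat with (k - 1 - 1)%nat by lia. apply hom_pderiv, hom_pderiv; auto.
Qed.

Lemma lap_hom_small k p x : (k < 2)%nat -> hom k p -> lap p x = 0.
Proof.
  intros Hk H. unfold lap. rewrite (sumN_ext _ _ (fun _ => 0)), sumN_const; [ring|].
  intros i Hi. apply (hom_pderiv (k - 1)); auto; [apply hom_pderiv; auto|lia].
Qed.

Lemma hom_scal k c p : hom k p -> hom k (PM (PC c) p).
Proof. intros H. apply (hom_PM 0 k); auto. constructor. Qed.

Lemma hom_psq : hom 2 (psq N).
Proof. apply hom_psum. intros. apply (hom_PM 1 1); constructor. Qed.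

Lemma euler k p x : hom k p -> sumN N (fun i => coord x i * peval (pderiv i p) x) = INR k * peval p x.
Proof.
  intros H. induction H; simpl peval; simpl pderiv.
  - rewrite (sumN_ext _ _ (fun _ => 0)), sumN_const by (intros; ring). simpl; ring.
  - rewrite (sumN_ext _ _ (fun _ => 0)), sumN_const by (intros; ring). ring.
  - destruct (Nat.lt_ge_cases i N).
    + rewrite (sumN_ext _ _ (fun j => coord x j * (if Nat.eqb j i then 1 else 0))).
      * rewrite sumN_delta by auto. simpl; ring.
      * intros j _. simpl. rewrite Nat.eqb_sym. reflexivity.
    + rewrite coord_out by auto. rewrite (sumN_ext _ _ (fun _ => 0)), sumN_const; [ring|].
      intros j Hj. simpl. destruct (Nat.eqb_spec i j); [lia|ring].
  - rewrite Rmult_plus_distr_l, <- IHhom1, <- IHhom2, <- sumN_plus.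
    apply sumN_ext; intros; simpl; ring.
  - rewrite plus_INR. rewrite Rmult_plus_distr_r.
    replace (INR k * (peval p x * peval q x)) with (peval q x * (INR k * peval p x)) by ring.
    replace (INR l * (peval p x * peval q x)) with (peval p x * (INR l * peval q x)) by ring.
    rewrite <- IHhom1, <- IHhom2, <- !sumN_scal, <- sumN_plus. apply sumN_ext; intros; simpl; ring.
  - rewrite <- H0, <- IHhom. apply sumN_ext; intros. rewrite (pderiv_ext p q); auto.
Qed.

Lemma lap_psq_mult k p x : hom k p ->
  lap (PM (psq N) p) x = (2 * INR N + 4 * INR k) * peval p x + nsq x * lap p x.
Proof.
  intros H. rewrite lap_PM, lap_psq, peval_psq.
  rewrite (sumN_ext _ _ (fun i => 2 * (coord x i * peval (pderiv i p) x))).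
  - rewrite sumN_scal, (euler k) by auto. ring.
  - intros i Hi. rewrite pderiv_psq by auto. ring.
Qed.

(* The operator c + |x|^2 Lap is invertible on homogeneous polynomials because it maps
   |x|^2 s to |x|^2 times an operator of the same kind, of degree two less, applied to s. *)
Lemma fischer n : forall k c p, (k < n)%nat -> 0 < c -> hom k p ->
  exists q, hom k q /\ forall x : RN N, c * peval q x + nsq x * lap q x = peval p x.
Proof.
  induction n as [|n IH]; intros k c p Hk Hc Hp; [lia|].
  destruct (Nat.lt_ge_cases k 2) as [Hk2|Hk2].
  - exists (PM (PC (/ c)) p). split; [apply hom_scal; auto|].
    intros x. rewrite lap_scal, (lap_hom_small k) by auto. simpl. field. lra.
  - pose proof (pos_INR N). pose proof (pos_INR (k - 2)).
    set (mu := 2 * INR N + 4 * INR (k - 2)).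
    (* For q = (p - |x|^2 s) / c the equation says Lap q = s, which is (c + mu) s + |x|^2 Lap s =
       Lap p. *)
    destruct (IH (k - 2)%nat (c + mu) (plap p)) as [s [Hs Es]].
    + lia.
    + unfold mu; lra.
    + apply hom_plap; auto.
    + exists (PM (PC (/ c)) (pminus p (PM (psq N) s))). split.
      * apply hom_scal. unfold pminus. constructor; auto. apply hom_scal.
        replace k with (2 + (k - 2))%nat by lia. constructor; auto. apply hom_psq.
      * intros x. rewrite lap_scal, lap_pminus, (lap_psq_mult (k - 2)) by auto.
        specialize (Es x). rewrite peval_plap in Es. rewrite <- Es. fold mu.
        change (peval (PM (PC (/ c)) (pminus p (PM (psq N) s))) x)
          with (/ c * peval (pminus p (PM (psq N) s)) x).
        rewrite peval_pminus. simpl. rewrite peval_psq. field. lra.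
Qed.

Definition pball (r : R) : poly := pminus (PC (r ^ 2)) (psq N).

Lemma peval_pball r x : peval (pball r) x = r ^ 2 - nsq x.
Proof. unfold pball. rewrite peval_pminus, peval_psq. reflexivity. Qed.

Lemma lap_pball_mult r k p x : hom k p ->
  lap (PM (pball r) p) x = r ^ 2 * lap p x - ((2 * INR N + 4 * INR k) * peval p x + nsq x * lap p x).
Proof.
  intros H. rewrite <- (lap_psq_mult k) by auto.
  rewrite (lap_ext _ (pminus (PM (PC (r ^ 2)) p) (PM (psq N) p))).
  - rewrite lap_pminus, lap_scal. ring.
  - intros y. rewrite peval_pminus. simpl. ring.
Qed.

(** The factor r^2 - |x|^2 is not homogeneous. Fischer's lemma inverts its top-degree part q -> -
    Lap (|x|^2 q); what is left over, r^2 Lap q, has degree k - 2 and is removed by induction. *)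
Lemma poisson_hom r n : forall k p, (k < n)%nat -> hom k p ->
  exists q, forall x, lap (PM (pball r) q) x = peval p x.
Proof.
  induction n as [|n IH]; intros k p Hk Hp; [lia|].
  assert (HNR : 0 < INR N) by (apply lt_0_INR; auto). pose proof (pos_INR k).
  destruct (fischer (S k) k (2 * INR N + 4 * INR k) (PM (PC (-1)) p)) as [q [Hq Eq]];
    [lia|lra|apply hom_scal; auto|].
  destruct (Nat.lt_ge_cases k 2) as [Hk2|Hk2].
  - exists q. intros x. rewrite (lap_pball_mult r k) by auto. rewrite Eq.
    rewrite (lap_hom_small k) by auto. simpl. ring.
  - destruct (IH (k - 2)%nat (PM (PC (r ^ 2)) (plap q))) as [s Es];
      [lia|apply hom_scal, hom_plap; auto|].
    exists (pminus q s). intros x.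
    rewrite (lap_ext _ (pminus (PM (pball r) q) (PM (pball r) s))).
    + rewrite lap_pminus, Es, (lap_pball_mult r k), Eq by auto. simpl. rewrite peval_plap. ring.
    + intros y. rewrite peval_pminus. change (peval (PM (pball r) (pminus q s)) y)
        with (peval (pball r) y * peval (pminus q s) y). rewrite peval_pminus. simpl. ring.
Qed.

Inductive homsum : poly -> Prop :=
| hs_hom k p : hom k p -> homsum p
| hs_add p q : homsum p -> homsum q -> homsum (PA p q)
| hs_eq p q : homsum p -> (forall x : RN N, peval p x = peval q x) -> homsum q.

Lemma homsum_mult p q : homsum p -> homsum q -> homsum (PM p q).
Proof.
  intros Hp Hq. induction Hp as [k p Hp|p1 p2 H1 IH1 H2 IH2|p1 p2 H1 IH1 E].
  - induction Hq as [l q Hq|q1 q2 H1 IH1 H2 IH2|q1 q2 H1 IH1 E].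
    + apply (hs_hom (k + l)). constructor; auto.
    + apply (hs_eq (PA (PM p q1) (PM p q2))); [constructor; auto|]. intros; simpl; ring.
    + apply (hs_eq (PM p q1)); auto. intros; simpl; rewrite E; ring.
  - apply (hs_eq (PA (PM p1 q) (PM p2 q))); [constructor; auto|]. intros; simpl; ring.
  - apply (hs_eq (PM p1 q)); auto. intros; simpl; rewrite E; ring.
Qed.

Lemma homsum_all p : homsum p.
Proof.
  induction p.
  - apply (hs_hom 0); constructor.
  - apply (hs_hom 1); constructor.
  - constructor; auto.
  - apply homsum_mult; auto.
Qed.

Lemma poisson_solvable r p : exists q, forall x, lap (PM (pball r) q) x = peval p x.
Proof.
  induction (homsum_all p) as [k p Hp|p1 p2 H1 [q1 E1] H2 [q2 E2]|p1 p2 H1 [q1 E1] E].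
  - apply (poisson_hom r (S k) k); auto.
  - exists (PA q1 q2). intros x. rewrite (lap_ext _ (PA (PM (pball r) q1) (PM (pball r) q2))).
    + rewrite lap_PA, E1, E2. reflexivity.
    + intros; simpl; ring.
  - exists q1. intros x. rewrite E1. auto.
Qed.

Lemma peval_pball_sphere r x q : nrm x = r -> peval (PM (pball r) q) x = 0.
Proof.
  intros H. assert (Hr : 0 <= r) by (rewrite <- H; apply nrm_nonneg).
  change (peval (pball r) x * peval q x = 0). rewrite peval_pball.
  apply nrm_eq_iff in H; auto. rewrite H. ring.
Qed.

(** Comparison with k (r^2 - |x|^2) / (2 N), whose Laplacian is - k. The bound does not involve K,
    so a perturbation in K may proceed by increments of constant size. *)
Lemma helmholtz_bound_sup K z r k : 0 <= K -> 0 <= k -> 0 <= r ->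
  (forall x, nrm x = r -> peval z x = 0) ->
  (forall x, nrm x < r -> Rabs (- lap z x + K * peval z x) <= k) ->
  forall x, nrm x <= r -> Rabs (peval z x) <= k * r ^ 2 / (2 * INR N).
Proof.
  intros HK Hk Hr Hb Hl.
  assert (HNR : 0 < INR N) by (apply lt_0_INR; auto).
  assert (One : forall w, (forall x, nrm x = r -> peval w x = 0) ->
    (forall x, nrm x < r -> - lap w x + K * peval w x <= k) ->
    forall x, nrm x <= r -> peval w x <= k * r ^ 2 / (2 * INR N)).
  { intros w Hwb Hwl x Hx.
    set (b := pminus w (PM (PC (k / (2 * INR N))) (pball r))).
    assert (Eb : forall y, peval b y = peval w y - k / (2 * INR N) * (r ^ 2 - nsq y)).
    { intros y. unfold b. rewrite <- peval_pball, peval_pminus. reflexivity. }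
    assert (Hk2 : 0 <= k / (2 * INR N)) by (apply Rdiv_le_0_compat; lra).
    assert (H : peval b x <= 0).
    { apply (max_principle b r); auto.
      - intros y Hy. rewrite Eb, Hwb by auto. apply nrm_eq_iff in Hy; auto. rewrite Hy. lra.
      - intros y Hy. rewrite Eb. intros Hp.
        unfold b, pball. rewrite lap_pminus, lap_scal, lap_pminus, lap_PC, lap_psq.
        specialize (Hwl y Hy). replace (_ - _) with (lap w y + k) by (field; lra).
        apply nrm_lt_iff in Hy; auto.
        assert (0 < peval w y) by nra. nra. }
    rewrite Eb in H. pose proof (nsq_nonneg x).
    replace (k * r ^ 2 / (2 * INR N)) with (k / (2 * INR N) * r ^ 2) by (field; lra). nra. }
  intros x Hx. apply Rabs_le. split.
  - assert (peval (PM (PC (-1)) z) x <= k * r ^ 2 / (2 * INR N)).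
    { apply One; auto.
      - intros y Hy. simpl. rewrite Hb by auto. ring.
      - intros y Hy. rewrite lap_scal. specialize (Hl y Hy). apply Rabs_le_between in Hl. simpl. lra. }
    simpl in H. lra.
  - apply One; auto. intros y Hy. specialize (Hl y Hy). apply Rabs_le_between in Hl. lra.
Qed.

(** After subtraction of the quadratic with Laplacian kappa, the zero-data Poisson solution with the
    remaining Laplacian is removed; it is small by the maximum principle. The first-order theory
    uses kappa = 0, the second-order theory the limiting Laplacian at the centre. *)
Lemma harmonic_approx_center p kappa k r : 0 <= k -> 0 <= r ->
  (forall x, nrm x < r -> Rabs (lap p x - kappa) <= k) ->
  exists h, harmonic (N := N) h /\ forall x, nrm x <= r ->
    Rabs (peval p x - kappa / (2 * INR N) * nsq x - peval h x) <= k * r ^ 2 / (2 * INR N).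
Proof.
  intros Hk Hr Hl. assert (HNR : 0 < INR N) by (apply lt_0_INR; auto).
  set (w := pminus p (PM (PC (kappa / (2 * INR N))) (psq N))).
  assert (Ew : forall x, lap w x = lap p x - kappa).
  { intros x. unfold w. rewrite lap_pminus, lap_scal, lap_psq. field. lra. }
  destruct (poisson_solvable r (plap w)) as [q Hq].
  exists (pminus w (PM (pball r) q)). split.
  - intros x. rewrite lap_pminus, Hq, peval_plap. ring.
  - intros x Hx. rewrite peval_pminus. unfold w at 1. rewrite peval_pminus.
    replace (_ - _) with (peval (PM (pball r) q) x); [|simpl; rewrite peval_psq; ring].
    apply (helmholtz_bound_sup 0 (PM (pball r) q) r k); auto; [lra| |].
    + intros y Hy. apply peval_pball_sphere; auto.
    + intros y Hy. rewrite Hq, peval_plap, Ew, Rmult_0_l, Rplus_0_r, Rabs_Ropp. auto.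
Qed.
End Poisson.
Arguments pball : clear implicits.
Arguments plap : clear implicits.

(** * Density of Helmholtz operators among continuous functions *)

Section BUC.
Context {N : nat}.
Implicit Types x y v : RN N.
Implicit Types f g : RN N -> R.

Definition bucont f : Prop :=
  (exists M, forall x, Rabs (f x) <= M) /\
  forall eps, 0 < eps -> exists d, 0 < d /\ forall x y, dist x y < d -> Rabs (f x - f y) < eps.

Lemma bucont_const k : bucont (fun _ => k).
Proof.
  split; [exists (Rabs k); intros; lra|].
  intros e He. exists 1. split; [lra|]. intros. rewrite Rminus_diag, Rabs_R0; auto.
Qed.

Lemma bucont_plus f g : bucont f -> bucont g -> bucont (fun x => f x + g x).
Proof.
  intros [[A HA] Hf] [[B HB] Hg]. split.
  - exists (A + B). intros x. eapply Rle_trans; [apply Rabs_triang|].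
    specialize (HA x). specialize (HB x). lra.
  - intros e He. destruct (Hf (e / 2) ltac:(lra)) as [d1 [P1 Q1]].
    destruct (Hg (e / 2) ltac:(lra)) as [d2 [P2 Q2]].
    exists (Rmin d1 d2). split; [apply Rmin_glb_lt; auto|]. intros x y Hd.
    specialize (Q1 x y (Rlt_le_trans _ _ _ Hd (Rmin_l _ _))).
    specialize (Q2 x y (Rlt_le_trans _ _ _ Hd (Rmin_r _ _))).
    replace (_ - _) with ((f x - f y) + (g x - g y)) by ring.
    eapply Rle_lt_trans; [apply Rabs_triang|]. lra.
Qed.

Lemma bucont_mult f g : bucont f -> bucont g -> bucont (fun x => f x * g x).
Proof.
  intros [[A HA] Hf] [[B HB] Hg].
  assert (A0 : 0 <= A) by (eapply Rle_trans; [apply Rabs_pos|apply (HA vzero)]).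
  assert (B0 : 0 <= B) by (eapply Rle_trans; [apply Rabs_pos|apply (HB vzero)]).
  split.
  - exists (A * B). intros x. rewrite Rabs_mult. apply Rmult_le_compat; auto using Rabs_pos.
  - intros e He. set (k := e / (2 * (A + B + 1))).
    assert (Hk : 0 < k) by (apply Rdiv_lt_0_compat; lra).
    destruct (Hf k Hk) as [d1 [P1 Q1]]. destruct (Hg k Hk) as [d2 [P2 Q2]].
    exists (Rmin d1 d2). split; [apply Rmin_glb_lt; auto|]. intros x y Hd.
    specialize (Q1 x y (Rlt_le_trans _ _ _ Hd (Rmin_l _ _))).
    specialize (Q2 x y (Rlt_le_trans _ _ _ Hd (Rmin_r _ _))).
    replace (_ - _) with ((f x - f y) * g x + f y * (g x - g y)) by ring.
    eapply Rle_lt_trans; [apply Rabs_triang|]. rewrite !Rabs_mult.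
    assert (Rabs (f x - f y) * Rabs (g x) <= k * B) by (apply Rmult_le_compat; auto using Rabs_pos; lra).
    assert (Rabs (f y) * Rabs (g x - g y) <= A * k) by (apply Rmult_le_compat; auto using Rabs_pos; lra).
    assert (k * (A + B + 1) = e / 2) by (unfold k; field; lra). nra.
Qed.

Lemma bucont_scal k f : bucont f -> bucont (fun x => k * f x).
Proof. intros H. apply bucont_mult; auto. apply bucont_const. Qed.

Lemma bucont_max f g : bucont f -> bucont g -> bucont (fun x => Rmax (f x) (g x)).
Proof.
  intros [[A HA] Hf] [[B HB] Hg]. split.
  - exists (Rmax A B). intros x. specialize (HA x). specialize (HB x).
    apply Rabs_le_between in HA, HB. apply Rabs_le.
    pose proof (Rmax_l A B). pose proof (Rmax_r A B). pose proof (Rmax_l (f x) (g x)).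
    split; [lra|apply Rmax_lub; lra].
  - intros e He. destruct (Hf e He) as [d1 [P1 Q1]]. destruct (Hg e He) as [d2 [P2 Q2]].
    exists (Rmin d1 d2). split; [apply Rmin_glb_lt; auto|]. intros x y Hd.
    specialize (Q1 x y (Rlt_le_trans _ _ _ Hd (Rmin_l _ _))).
    specialize (Q2 x y (Rlt_le_trans _ _ _ Hd (Rmin_r _ _))).
    apply Rabs_lt_between in Q1, Q2. apply Rabs_lt_between.
    unfold Rmax. destruct (Rle_dec (f x) (g x)), (Rle_dec (f y) (g y)); lra.
Qed.

Lemma bucont_ext f g : (forall x, f x = g x) -> bucont f -> bucont g.
Proof.
  intros E [[A HA] H]. split.
  - exists A. intros x. rewrite <- E. auto.
  - intros e He. destruct (H e He) as [d [Hd Q]]. exists d. split; auto.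
    intros. rewrite <- !E. auto.
Qed.

Lemma bucont_min f g : bucont f -> bucont g -> bucont (fun x => Rmin (f x) (g x)).
Proof.
  intros Hf Hg.
  apply (bucont_ext (fun x => -1 * Rmax (-1 * f x) (-1 * g x))).
  - intros x. unfold Rmax, Rmin. destruct (Rle_dec (-1 * f x) (-1 * g x)), (Rle_dec (f x) (g x)); lra.
  - apply bucont_scal, bucont_max; apply bucont_scal; auto.
Qed.

Lemma bucont_inv f m : 0 < m -> (forall x, m <= f x) -> bucont f -> bucont (fun x => / f x).
Proof.
  intros Hm Hl [_ Hf]. split.
  - exists (/ m). intros x. specialize (Hl x). rewrite Rabs_pos_eq.
    + apply Rinv_le_contravar; lra.
    + left. apply Rinv_0_lt_compat; lra.
  - intros e He. destruct (Hf (e * m ^ 2)) as [d [Hd Q]]; [apply Rmult_lt_0_compat; auto; apply pow_lt; auto|].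
    exists d. split; auto. intros x y Hxy. specialize (Q x y Hxy).
    pose proof (Hl x). pose proof (Hl y).
    replace (/ f x - / f y) with (- (f x - f y) * / (f x * f y)) by (field; lra).
    assert (m ^ 2 <= f x * f y) by nra. assert (0 < m ^ 2) by nra.
    rewrite Rabs_mult, Rabs_Ropp, (Rabs_pos_eq (/ _)) by (left; apply Rinv_0_lt_compat; lra).
    apply Rmult_lt_reg_r with (f x * f y); [lra|].
    rewrite Rmult_assoc, Rinv_l by lra. nra.
Qed.

Lemma bucont_comp f (h : RN N -> RN N) k : 0 < k ->
  (forall x y, dist (h x) (h y) <= k * dist x y) -> bucont f -> bucont (fun x => f (h x)).
Proof.
  intros Hk Hh [[A HA] H]. split; [exists A; auto|].
  intros e He. destruct (H e He) as [d [Hd Q]]. exists (d / k).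
  split; [apply Rdiv_lt_0_compat; auto|]. intros x y Hxy. apply Q.
  eapply Rle_lt_trans; [apply Hh|]. apply Rmult_lt_reg_r with (/ k); [apply Rinv_0_lt_compat; auto|].
  replace (k * dist x y * / k) with (dist x y) by (field; lra). exact Hxy.
Qed.

Lemma bucont_sumN n (F : nat -> RN N -> R) :
  (forall i, (i < n)%nat -> bucont (F i)) -> bucont (fun x => sumN n (fun i => F i x)).
Proof.
  induction n as [|n IH]; simpl; intros H; [apply bucont_const|].
  apply bucont_plus; [apply IH; intros; apply H|apply H]; lia.
Qed.

(** Radial retraction onto the ball. Composition with it turns data controlled only on the ball into
    bounded uniformly continuous functions on the whole space, which is needed because differences
    of step h reach across the sphere. *)
Definition clip (r : R) x : RN N := vscal (/ Rmax 1 (nrm x / r)) x.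

Lemma clip_scale_pos r x : 1 <= Rmax 1 (nrm x / r).
Proof. apply Rmax_l. Qed.

Lemma clip_nrm r x : 0 < r -> nrm (clip r x) <= r.
Proof.
  intros Hr. unfold clip. rewrite nrm_vscal. pose proof (clip_scale_pos r x).
  rewrite Rabs_pos_eq by (left; apply Rinv_0_lt_compat; lra).
  apply Rmult_le_reg_l with (Rmax 1 (nrm x / r)); [lra|].
  rewrite <- Rmult_assoc, Rinv_r, Rmult_1_l by lra.
  pose proof (Rmax_r 1 (nrm x / r)).
  apply Rle_trans with (nrm x / r * r); [right; field; lra|].
  apply Rmult_le_compat_r; lra.
Qed.

Lemma clip_id r x : 0 < r -> nrm x <= r -> clip r x = x.
Proof.
  intros Hr Hx. unfold clip. rewrite Rmax_left.
  - apply RN_ext; intros. rewrite coord_vscal. lra.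
  - apply Rmult_le_reg_r with r; auto. replace (nrm x / r * r) with (nrm x) by (field; lra). lra.
Qed.

Lemma clip_lip r x y : 0 < r -> dist (clip r x) (clip r y) <= 2 * dist x y.
Proof.
  intros Hr. set (a := Rmax 1 (nrm x / r)). set (b := Rmax 1 (nrm y / r)).
  assert (Ha : 1 <= a) by apply Rmax_l. assert (Hb : 1 <= b) by apply Rmax_l.
  assert (Hyb : nrm y <= r * b).
  { pose proof (Rmax_r 1 (nrm y / r)) as H. fold b in H.
    apply Rle_trans with (nrm y / r * r); [right; field; lra|nra]. }
  pose proof (dist_nonneg x y) as Hd. pose proof (nrm_nonneg y) as Hy.
  assert (Hab : r * Rabs (b - a) <= dist x y).
  { pose proof (nrm_dist x y). pose proof (nrm_dist y x). rewrite (dist_sym y x) in H0.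
    assert (Hq : Rabs (b - a) <= Rabs (nrm y / r - nrm x / r)).
    { unfold a, b, Rmax. generalize (nrm x / r) (nrm y / r). clear. intros p q.
      destruct (Rle_dec 1 p), (Rle_dec 1 q); unfold Rabs; repeat destruct Rcase_abs; lra. }
    apply Rle_trans with (r * Rabs (nrm y / r - nrm x / r)); [nra|].
    replace (nrm y / r - nrm x / r) with ((nrm y - nrm x) * / r) by (field; lra).
    rewrite Rabs_mult, (Rabs_pos_eq (/ r)) by (left; apply Rinv_0_lt_compat; auto).
    replace (r * (Rabs (nrm y - nrm x) * / r)) with (Rabs (nrm y - nrm x)) by (field; lra).
    apply Rabs_le. lra. }
  apply Rle_trans with (dist (vscal (/ a) x) (vscal (/ a) y) + dist (vscal (/ a) y) (vscal (/ b) y)).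
  - apply dist_tri.
  - rewrite !dist_nrm.
    replace (vsub (vscal (/ a) x) (vscal (/ a) y)) with (vscal (/ a) (vsub x y))
      by (apply RN_ext; intros; rewrite !coord_vsub, !coord_vscal, coord_vsub; ring).
    replace (vsub (vscal (/ a) y) (vscal (/ b) y)) with (vscal (/ a - / b) y)
      by (apply RN_ext; intros; rewrite !coord_vsub, !coord_vscal; ring).
    rewrite !nrm_vscal, <- dist_nrm.
    assert (I : 0 < / a <= 1).
    { split; [apply Rinv_0_lt_compat; lra|]. rewrite <- Rinv_1. apply Rinv_le_contravar; lra. }
    rewrite (Rabs_pos_eq (/ a)) by lra.
    assert (Rabs (/ a - / b) * nrm y <= dist x y); [|nra].
    replace (/ a - / b) with ((b - a) * (/ a * / b)) by (field; lra).
    assert (J : 0 < / b) by (apply Rinv_0_lt_compat; lra).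
    rewrite Rabs_mult, (Rabs_pos_eq (/ a * / b)) by nra.
    apply Rle_trans with (Rabs (b - a) * (/ a * / b) * (r * b)).
    + apply Rmult_le_compat_l; auto. apply Rmult_le_pos; [apply Rabs_pos|nra].
    + replace (Rabs (b - a) * (/ a * / b) * (r * b)) with (/ a * (r * Rabs (b - a))) by (field; lra).
      pose proof (Rabs_pos (b - a)). nra.
Qed.

Lemma unif_cont_clip r f : 0 < r -> unif_cont_on r f -> bucont (fun x => f (clip r x)).
Proof.
  intros Hr Hf. split.
  - destruct (ball_max f r ltac:(lra) Hf) as [x1 [_ H1]].
    destruct (ball_max (fun x => - f x) r ltac:(lra)) as [x2 [_ H2]].
    { intros e He. destruct (Hf e He) as [d [Hd Q]]. exists d. split; auto.
      intros. replace (- f y - - f z) with (- (f y - f z)) by ring. rewrite Rabs_Ropp; auto. }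
    exists (Rabs (f x1) + Rabs (f x2)). intros x.
    pose proof (clip_nrm r x Hr) as Hc. specialize (H1 _ Hc). specialize (H2 _ Hc).
    apply Rabs_le. unfold Rabs. destruct (Rcase_abs (f x1)), (Rcase_abs (f x2)); lra.
  - intros e He. destruct (Hf e He) as [d [Hd Q]]. exists (d / 2). split; [lra|].
    intros x y Hxy. apply Q; try (apply clip_nrm; auto).
    pose proof (clip_lip r x y Hr). lra.
Qed.

Lemma bucont_poly_clip r p : 0 < r -> bucont (fun x => peval p (clip r x)).
Proof. intros Hr. apply (unif_cont_clip r (peval p)); auto. apply poly_unif_cont. Qed.
End BUC.

(** * Weierstrass approximation by Bernstein polynomials *)

(** De Casteljau's recursion: the expectation of f under the binomial law with n trials of
    probability t, conditioned on one trial. Binomial coefficients never appear. *)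
Fixpoint bern (n : nat) (f : nat -> R) (t : R) : R :=
  match n with
  | O => f O
  | S n => (1 - t) * bern n f t + t * bern n (fun k => f (S k)) t
  end.

Lemma bern_le n f g t : 0 <= t <= 1 -> (forall k, (k <= n)%nat -> f k <= g k) -> bern n f t <= bern n g t.
Proof.
  intros Ht. revert f g. induction n as [|n IH]; simpl; intros f g H; [auto|].
  apply Rplus_le_compat; apply Rmult_le_compat_l; try lra; apply IH; intros; apply H; lia.
Qed.

Lemma bern_lin n f g a b t : bern n (fun k => a * f k + b * g k) t = a * bern n f t + b * bern n g t.
Proof. revert f g. induction n as [|n IH]; simpl; intros f g; [auto|]. rewrite !IH. ring. Qed.

Lemma bern_const n c t : bern n (fun _ => c) t = c.
Proof. induction n as [|n IH]; simpl; [auto|]. rewrite !IH. ring. Qed.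

Lemma bern_ext n f g t : (forall k, (k <= n)%nat -> f k = g k) -> bern n f t = bern n g t.
Proof.
  revert f g. induction n as [|n IH]; simpl; intros f g H; [auto|].
  rewrite (IH f g), (IH (fun k => f (S k)) (fun k => g (S k))); auto; intros; apply H; lia.
Qed.

(** The variance of the binomial law. The shift c is what makes the induction close: conditioning on
    one trial moves it by - t or by 1 - t. *)
Lemma bern_variance n c t :
  bern n (fun k => (INR k + c - INR n * t) ^ 2) t = INR n * t * (1 - t) + c ^ 2.
Proof.
  revert c. induction n as [|n IH]; intros c.
  - simpl. ring.
  - change (bern (S n) (fun k => (INR k + c - INR (S n) * t) ^ 2) t) with
      ((1 - t) * bern n (fun k => (INR k + c - INR (S n) * t) ^ 2) t
       + t * bern n (fun k => (INR (S k) + c - INR (S n) * t) ^ 2) t).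
    rewrite (bern_ext n _ (fun k => (INR k + (c - t) - INR n * t) ^ 2)), IH.
    2: { intros. rewrite S_INR. ring. }
    rewrite (bern_ext n _ (fun k => (INR k + (c + 1 - t) - INR n * t) ^ 2)), IH.
    2: { intros. rewrite !S_INR. ring. }
    rewrite S_INR. ring.
Qed.

Fixpoint pbern (n : nat) (f : nat -> poly) (t : poly) : poly :=
  match n with
  | O => f O
  | S n => PA (PM (PA (PC 1) (PM (PC (-1)) t)) (pbern n f t)) (PM t (pbern n (fun k => f (S k)) t))
  end.

Section Weierstrass.
Context {N : nat}.
Implicit Types x y v : RN N.

Lemma peval_pbern n f t x : peval (pbern n f t) x = bern n (fun k => peval (f k) x) (peval t x).
Proof. revert f. induction n as [|n IH]; simpl; intros f; auto. rewrite !IH. ring. Qed.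

Definition upd x (n : nat) (s : R) : RN N := mkpt (fun i => if Nat.eqb i n then s else coord x i).

Lemma coord_upd x n s i : (i < N)%nat -> coord (upd x n s) i = if Nat.eqb i n then s else coord x i.
Proof. intros. unfold upd. rewrite coord_mkpt; auto. Qed.

Lemma dist_upd x y n s : dist (upd x n s) (upd y n s) <= dist x y.
Proof.
  apply sqrt_le_1_alt. apply sumN_le. intros i Hi. rewrite !coord_upd by auto.
  destruct (Nat.eqb i n); [|lra]. rewrite Rminus_diag. pose proof (pow2_ge_0 (coord x i - coord y i)). lra.
Qed.

Lemma dist_upd_self x n s : (n < N)%nat -> dist (upd x n s) x = Rabs (s - coord x n).
Proof.
  intros Hn. unfold dist. rewrite <- sqrt_Rsqr_abs. f_equal. unfold Rsqr.
  rewrite (sumN_ext _ _ (fun j => (s - coord x n) * (s - coord x n) * (if Nat.eqb j n then 1 else 0))).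
  - apply (sumN_delta N n (fun _ => (s - coord x n) * (s - coord x n))); auto.
  - intros i Hi. rewrite coord_upd by auto. destruct (Nat.eqb_spec i n) as [->|]; ring.
Qed.

Definition dep_on (n : nat) (g : RN N -> R) : Prop :=
  forall x y, (forall i, (i < n)%nat -> coord x i = coord y i) -> g x = g y.

(** Induction on the number of variables on which g depends: the last one is discretized by
    Bernstein nodes, and the coefficients are polynomials approximating the slices of g at these
    nodes. *)
Lemma weierstrass_aux n : (n <= N)%nat -> forall (g : RN N -> R) r eps, bucont g -> dep_on n g ->
  0 < r -> 0 < eps -> exists p, forall x, (forall i, Rabs (coord x i) <= r) -> Rabs (peval p x - g x) <= eps.
Proof.
  induction n as [|n IH]; intros Hn g r eps Hg Hdep Hr He.
  - exists (PC (g vzero)). intros x _. simpl. rewrite (Hdep x vzero) by (intros; lia).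
    rewrite Rminus_diag, Rabs_R0; lra.
  - destruct Hg as [[M HM] Hg].
    assert (M0 : 0 <= M) by (eapply Rle_trans; [apply Rabs_pos|apply (HM vzero)]).
    destruct (Hg (eps / 4) ltac:(lra)) as [d [Hd Q]].
    destruct (INR_unbounded (8 * M * r ^ 2 / (d ^ 2 * eps) + 1)) as [m Hm].
    assert (Hd2 : 0 < d ^ 2) by (apply pow_lt; auto).
    assert (HB : 0 <= 8 * M * r ^ 2 / (d ^ 2 * eps)).
    { apply Rdiv_le_0_compat; [|nra]. apply Rmult_le_pos; [lra|]. apply pow2_ge_0. }
    assert (Hm0 : 0 < INR m) by lra.
    set (s := fun k : nat => - r + 2 * r * (INR k / INR m)).
    assert (HP : forall k, exists p, forall x, (forall i, Rabs (coord x i) <= r) ->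
       Rabs (peval p x - g (upd x n (s k))) <= eps / 2).
    { intros k. apply (IH ltac:(lia) (fun x => g (upd x n (s k)))); auto; try lra.
      - apply (bucont_comp g _ 1); [lra| |split; eauto].
        intros. rewrite Rmult_1_l. apply dist_upd.
      - intros x y Hxy. apply Hdep. intros i Hi. rewrite !coord_upd by lia.
        destruct (Nat.eqb_spec i n); auto. apply Hxy; lia. }
    apply choice in HP. destruct HP as [P HP].
    set (T := PM (PC (/ (2 * r))) (PA (PX n) (PC r))).
    exists (pbern m P T). intros x Hx. rewrite peval_pbern.
    set (t := peval T x).
    assert (Et : coord x n = 2 * r * t - r) by (unfold t, T; simpl; field; lra).
    assert (Ht : 0 <= t <= 1).
    { pose proof (Hx n) as H. apply Rabs_le_between in H. split; nra. }
    (* Chebyshev's argument: eps/2 for the approximate slice, eps/4 for nodes closer than d to x,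
       and a multiple of the squared distance for the others. The choice of m brings the mean of the
       last term below eps/4. *)
    set (b := fun k => (eps * (3 / 4)) + 8 * M * r ^ 2 / (d ^ 2 * INR m ^ 2) * (INR k + 0 - INR m * t) ^ 2).
    assert (HK : forall k, (k <= m)%nat -> Rabs (peval (P k) x - g x) <= b k).
    { intros k Hk. replace (_ - _) with ((peval (P k) x - g (upd x n (s k))) + (g (upd x n (s k)) - g x)) by ring.
      eapply Rle_trans; [apply Rabs_triang|]. specialize (HP k x Hx).
      assert (Es : s k - coord x n = 2 * r / INR m * (INR k - INR m * t)) by (unfold s; rewrite Et; field; lra).
      assert (G : Rabs (g (upd x n (s k)) - g x) <=
        eps / 4 + 8 * M * r ^ 2 / (d ^ 2 * INR m ^ 2) * (INR k + 0 - INR m * t) ^ 2).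
      { replace (8 * M * r ^ 2 / (d ^ 2 * INR m ^ 2) * (INR k + 0 - INR m * t) ^ 2)
          with (2 * M / d ^ 2 * (s k - coord x n) ^ 2) by (rewrite Es; field; split; lra).
        assert (0 <= 2 * M / d ^ 2) by (apply Rdiv_le_0_compat; lra).
        pose proof (pow2_ge_0 (s k - coord x n)).
        destruct (Rlt_or_le (Rabs (s k - coord x n)) d) as [Hlt|Hge].
        - specialize (Q (upd x n (s k)) x). rewrite dist_upd_self in Q by lia. specialize (Q Hlt). nra.
        - assert (d ^ 2 <= (s k - coord x n) ^ 2).
          { rewrite <- (pow2_abs (s k - coord x n)). apply pow_incr; lra. }
          assert (2 * M <= 2 * M / d ^ 2 * (s k - coord x n) ^ 2).
          { replace (2 * M) with (2 * M / d ^ 2 * d ^ 2) at 1 by (field; lra). nra. }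
          pose proof (HM (upd x n (s k))) as B1. pose proof (HM x) as B2.
          apply Rabs_le_between in B1, B2. apply Rabs_le. lra. }
      unfold b. lra. }
    assert (E : bern m b t <= eps).
    { unfold b.
      rewrite (bern_ext m _ (fun k => eps * (3 / 4) * 1 + 8 * M * r ^ 2 / (d ^ 2 * INR m ^ 2) * (INR k + 0 - INR m * t) ^ 2))
        by (intros; ring).
      rewrite (bern_lin m (fun _ => 1)), bern_const, bern_variance.
      assert (t * (1 - t) <= / 4) by (pose proof (pow2_ge_0 (t - / 2)); lra).
      replace (8 * M * r ^ 2 / (d ^ 2 * INR m ^ 2) * (INR m * t * (1 - t) + 0 ^ 2))
        with (8 * M * r ^ 2 / (d ^ 2 * eps) * / INR m * (t * (1 - t)) * eps) by (field; repeat split; lra).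
      assert (8 * M * r ^ 2 / (d ^ 2 * eps) * / INR m <= 1).
      { apply Rmult_le_reg_r with (INR m); auto. rewrite Rmult_assoc, Rinv_l by lra. lra. }
      assert (0 <= 8 * M * r ^ 2 / (d ^ 2 * eps) * / INR m).
      { apply Rmult_le_pos; auto. left; apply Rinv_0_lt_compat; auto. }
      assert (8 * M * r ^ 2 / (d ^ 2 * eps) * / INR m * (t * (1 - t)) <= / 4) by nra. nra. }
    apply Rabs_le. split.
    + assert (bern m (fun k => 1 * g x + -1 * b k) t <= bern m (fun k => peval (P k) x) t).
      { apply bern_le; auto. intros k Hk. specialize (HK k Hk). apply Rabs_le_between in HK. lra. }
      rewrite (bern_lin m (fun _ => g x) b), bern_const in H. lra.
    + assert (bern m (fun k => peval (P k) x) t <= bern m (fun k => 1 * g x + 1 * b k) t).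
      { apply bern_le; auto. intros k Hk. specialize (HK k Hk). apply Rabs_le_between in HK. lra. }
      rewrite (bern_lin m (fun _ => g x) b), bern_const in H. lra.
Qed.

Lemma weierstrass (g : RN N -> R) r eps : bucont g -> 0 < r -> 0 < eps ->
  exists p, forall x, nrm x <= r -> Rabs (peval p x - g x) <= eps.
Proof.
  intros Hg Hr He. destruct (weierstrass_aux N (le_n N) g r eps Hg) as [p Hp]; auto.
  - intros x y H. f_equal. apply RN_ext; auto.
  - exists p. intros x Hx. apply Hp. intros i. eapply Rle_trans; [apply coord_le_nrm|auto].
Qed.
End Weierstrass.

Section Helmholtz.
Context {N : nat}.
Hypothesis HN0 : (0 < N)%nat.
Implicit Types x y v : RN N.

Definition helmholtz (r K : R) (q : poly) x : R :=
  - lap (PM (pball N r) q) x + K * peval (PM (pball N r) q) x.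

Definition helmholtz_dense (r K : R) : Prop := forall (g : RN N -> R) eps, bucont g -> 0 < eps ->
  exists q, forall x, nrm x <= r -> Rabs (helmholtz r K q x - g x) <= eps.

Lemma helmholtz_dense_0 r : 0 < r -> helmholtz_dense r 0.
Proof.
  intros Hr g eps Hg He. destruct (weierstrass g r eps Hg Hr He) as [p Hp].
  destruct (poisson_solvable HN0 r (PM (PC (-1)) p)) as [q Hq].
  exists q. intros x Hx. unfold helmholtz. rewrite Hq. simpl peval at 1.
  replace (_ - _) with (peval p x - g x) by (simpl; ring). auto.
Qed.

(** Iterate (K - Lap) q' = g - dl q approximately, with dl = N / r^2. By [helmholtz_bound_sup] the
    inverse has norm at most C = r^2 / (2 N), so dl C = 1/2 is the contraction factor whatever K is,
    and finitely many increments reach any size of K. *)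
Lemma helmholtz_dense_step r K : 0 < r -> 0 <= K -> helmholtz_dense r K ->
  helmholtz_dense r (K + INR N / r ^ 2).
Proof.
  intros Hr HK HD g eps Hg He.
  assert (HNR : 0 < INR N) by (apply lt_0_INR; auto).
  set (dl := INR N / r ^ 2). set (C := r ^ 2 / (2 * INR N)).
  assert (Hr2 : 0 < r ^ 2) by (apply pow_lt; auto).
  assert (Hdl : 0 < dl) by (apply Rdiv_lt_0_compat; auto).
  assert (HC : 0 < C) by (apply Rdiv_lt_0_compat; lra).
  assert (HdC : dl * C = / 2) by (unfold dl, C; field; lra).
  set (z := fun q => peval (N := N) (PM (pball N r) q)).
  destruct (HD g (eps / 6) Hg ltac:(lra)) as [q0 Hq0].
  destruct (peval_bounded (N := N) (PM (pball N r) q0) r) as [B [HB0 HB]].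
  (* The term 4 C (eps / 6) is stationary: halving it and adding 2 C (eps / 6), for the residuals of
     two consecutive solves, gives it back. *)
  assert (HJ : forall j, exists q q',
    (forall x, nrm x <= r -> Rabs (helmholtz r K q' x - (g x - dl * z q x)) <= eps / 6) /\
    (forall x, nrm x <= r -> Rabs (z q' x - z q x) <= B / 2 ^ j + 4 * C * (eps / 6))).
  { induction j as [|j [q [q' [H1 H2]]]].
    - exists (PC 0), q0. split; intros x Hx.
      + unfold z. simpl. rewrite Rmult_0_r, Rmult_0_r, Rminus_0_r. apply Hq0; auto.
      + unfold z. replace (peval (PM (pball N r) (PC 0)) x) with 0 by (simpl; ring).
        rewrite Rminus_0_r. specialize (HB x Hx). simpl (2 ^ 0). nra.
    - destruct (HD (fun x => g x + - dl * z q' (clip r x)) (eps / 6)) as [q2 H3]; [|lra|].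
      { apply bucont_plus; auto. apply bucont_scal. apply (bucont_poly_clip r); auto. }
      exists q', q2.
      assert (H3' : forall x, nrm x <= r -> Rabs (helmholtz r K q2 x - (g x - dl * z q' x)) <= eps / 6).
      { intros x Hx. specialize (H3 x Hx). rewrite clip_id in H3 by auto.
        replace (g x - dl * z q' x) with (g x + - dl * z q' x) by ring. auto. }
      split; auto. intros x Hx.
      set (k := dl * (B / 2 ^ j + 4 * C * (eps / 6)) + 2 * (eps / 6)).
      pose proof (pow_lt 2 j ltac:(lra)) as Hp.
      assert (HBj : 0 <= B / 2 ^ j) by (apply Rdiv_le_0_compat; auto).
      assert (Ez : forall y, peval (PM (pball N r) (pminus q2 q')) y = z q2 y - z q' y).
      { intros y. unfold z. simpl. ring. }
      rewrite <- Ez.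
      apply Rle_trans with (k * r ^ 2 / (2 * INR N)).
      + apply (helmholtz_bound_sup HN0 K); auto; [unfold k; nra|lra| |].
        * intros y Hy. apply peval_pball_sphere; auto.
        * intros y Hy.
          replace (- lap (PM (pball N r) (pminus q2 q')) y + K * peval (PM (pball N r) (pminus q2 q')) y)
            with ((helmholtz r K q2 y - (g y - dl * z q' y)) - (helmholtz r K q' y - (g y - dl * z q y))
               + (- dl) * (z q' y - z q y)).
          { specialize (H1 y ltac:(lra)). specialize (H2 y ltac:(lra)). specialize (H3' y ltac:(lra)).
            eapply Rle_trans; [apply Rabs_triang|]. rewrite Rabs_mult, Rabs_Ropp, (Rabs_pos_eq dl) by lra.
            eapply Rle_trans; [apply Rplus_le_compat_r; apply Rabs_triang|]. rewrite Rabs_Ropp. unfold k. nra. }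
          rewrite Ez. rewrite (lap_ext _ (pminus (PM (pball N r) q2) (PM (pball N r) q'))).
          { rewrite lap_pminus. unfold helmholtz. fold (z q2 y) (z q' y). ring. }
          intros w. rewrite peval_pminus. simpl. ring.
      + replace (k * r ^ 2 / (2 * INR N)) with (k * C) by (unfold C; field; lra).
        unfold k. replace (B / 2 ^ S j) with (B / 2 ^ j * / 2) by (simpl; field; lra).
        right. replace ((dl * (B / 2 ^ j + 4 * C * (eps / 6)) + 2 * (eps / 6)) * C)
          with ((dl * C) * (B / 2 ^ j + 4 * C * (eps / 6)) + 2 * (eps / 6) * C) by ring.
        rewrite HdC. field. lra. }
  destruct (INR_unbounded (2 * dl * B / eps + 1)) as [j Hj].
  destruct (HJ j) as [q [q' [H1 H2]]]. exists q'. intros x Hx.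
  specialize (H1 x Hx). specialize (H2 x Hx).
  replace (helmholtz r (K + dl) q' x - g x) with
    ((helmholtz r K q' x - (g x - dl * z q x)) + dl * (z q' x - z q x))
    by (unfold helmholtz, z; ring).
  eapply Rle_trans; [apply Rabs_triang|]. rewrite Rabs_mult, (Rabs_pos_eq dl) by lra.
  assert (Hpow : INR j <= 2 ^ j).
  { clear. induction j as [|j IH]; [simpl; lra|]. rewrite S_INR. simpl.
    assert (1 <= 2 ^ j) by (apply pow_R1_Rle; lra). lra. }
  assert (dl * (B / 2 ^ j) <= eps / 2).
  { apply Rmult_le_reg_r with (2 ^ j); [apply pow_lt; lra|].
    replace (dl * (B / 2 ^ j) * 2 ^ j) with (dl * B) by (field; apply pow_nonzero; lra).
    assert (2 * dl * B / eps <= 2 ^ j) by lra.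
    replace (dl * B) with (eps / 2 * (2 * dl * B / eps)) by (field; lra). nra. }
  assert (dl * Rabs (z q' x - z q x) <= dl * (B / 2 ^ j) + dl * C * (4 * (eps / 6))) by nra.
  rewrite HdC in H0. lra.
Qed.

Lemma helmholtz_dense_large r K0 : 0 < r -> exists K, K0 <= K /\ 0 <= K /\ helmholtz_dense r K.
Proof.
  intros Hr. assert (HNR : 0 < INR N) by (apply lt_0_INR; auto).
  assert (Hdl : 0 < INR N / r ^ 2) by (apply Rdiv_lt_0_compat; auto; apply pow_lt; auto).
  destruct (INR_unbounded (K0 / (INR N / r ^ 2))) as [m Hm].
  exists (INR m * (INR N / r ^ 2)). split; [|split].
  - apply Rmult_lt_compat_r with (r := INR N / r ^ 2) in Hm; auto.
    replace (K0 / (INR N / r ^ 2) * (INR N / r ^ 2)) with K0 in Hm by (field; lra). lra.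
  - pose proof (pos_INR m). nra.
  - clear Hm. induction m as [|m IH].
    + rewrite Rmult_0_l. apply helmholtz_dense_0; auto.
    + rewrite S_INR. replace ((INR m + 1) * (INR N / r ^ 2)) with (INR m * (INR N / r ^ 2) + INR N / r ^ 2) by ring.
      apply helmholtz_dense_step; auto. pose proof (pos_INR m). nra.
Qed.
End Helmholtz.

(** * The monotone scheme *)

Lemma upwind_mono th s s' m m' : 0 <= th <= 1 -> 0 < s <= s' -> 0 <= m <= m' ->
  s - th * (Rmax 0 (s - m) ^ 2 / s) <= s' - th * (Rmax 0 (s' - m') ^ 2 / s').
Proof.
  intros Hth Hs Hm.
  apply Rle_trans with (s' - th * (Rmax 0 (s' - m) ^ 2 / s')).
  (* For s > m the function (s - m)^2 / s has derivative 1 - m^2 / s^2 <= 1, so subtracting it with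
     a weight at most 1 leaves s increasing. *)
  - assert (K : Rmax 0 (s' - m) ^ 2 / s' - Rmax 0 (s - m) ^ 2 / s <= s' - s).
    { destruct (Rle_or_lt s' m).
      - rewrite !Rmax_left by lra. unfold Rdiv. lra.
      - rewrite (Rmax_right 0 (s' - m)) by lra. destruct (Rle_or_lt s m).
        + rewrite Rmax_left by lra.
          assert ((s' - m) ^ 2 / s' <= s' - m); [|unfold Rdiv in *; lra].
          apply Rmult_le_reg_r with s'; [lra|].
          replace ((s' - m) ^ 2 / s' * s') with ((s' - m) ^ 2) by (field; lra). nra.
        + rewrite Rmax_right by lra.
          replace ((s' - m) ^ 2 / s' - (s - m) ^ 2 / s) with (s' - s - m ^ 2 * (/ s - / s')) by (field; lra).
          assert (/ s' <= / s) by (apply Rinv_le_contravar; lra).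
          pose proof (pow2_ge_0 m). nra. }
    set (P := Rmax 0 (s' - m) ^ 2 / s') in *. set (Q := Rmax 0 (s - m) ^ 2 / s) in *. nra.
  - assert (Rmax 0 (s' - m') ^ 2 / s' <= Rmax 0 (s' - m) ^ 2 / s'); [|nra].
    apply Rmult_le_compat_r; [left; apply Rinv_0_lt_compat; lra|].
    apply pow_incr. split; [apply Rmax_l|]. apply Rle_max_compat_l. lra.
Qed.

Section Scheme.
Context {N : nat}.
Hypothesis HN0 : (0 < N)%nat.
Implicit Types x y v : RN N.
Implicit Types w : RN N -> R.

Definition low_nbr h w i x : R :=
  Rmin (w (vadd x (vscal h (basis i)))) (w (vadd x (vscal (- h) (basis i)))).

(* Upwind discretization of |grad w|^2 / w; it is monotone in the values of w. *)
Definition upwind h w x : R :=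
  sumN N (fun i => Rmax 0 (w x - low_nbr h w i x) ^ 2 / w x) / h ^ 2.

Lemma upwind_nonneg h w x : 0 < h -> 0 < w x -> 0 <= upwind h w x.
Proof.
  intros Hh Hw. apply Rdiv_le_0_compat; [|apply pow_lt; auto].
  apply sumN_nonneg. intros. apply Rdiv_le_0_compat; auto. apply pow2_ge_0.
Qed.

Lemma upwind_scal h w l x : 0 < l -> 0 < h -> 0 < w x -> upwind h (fun y => l * w y) x = l * upwind h w x.
Proof.
  intros Hl Hh Hw. unfold upwind. unfold Rdiv at 1 3. rewrite <- Rmult_assoc, <- sumN_scal.
  f_equal. apply sumN_ext. intros i Hi. unfold low_nbr.
  rewrite <- Rmult_min_distr_l by lra.
  replace (l * w x - l * _) with
    (l * (w x - Rmin (w (vadd x (vscal h (basis i)))) (w (vadd x (vscal (- h) (basis i)))))) by ring.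
  rewrite <- (Rmult_0_r l) at 1. rewrite <- Rmult_max_distr_l by lra. field. lra.
Qed.

Lemma upwind_le h w w' x : 0 < h -> 0 < w x -> w x = w' x -> (forall y, w' y <= w y) ->
  upwind h w x <= upwind h w' x.
Proof.
  intros Hh Hw E H. apply Rmult_le_compat_r; [left; apply Rinv_0_lt_compat, pow_lt; auto|].
  apply sumN_le. intros i Hi. rewrite <- E.
  apply Rmult_le_compat_r; [left; apply Rinv_0_lt_compat; auto|].
  apply pow_incr. split; [apply Rmax_l|]. apply Rle_max_compat_l.
  assert (low_nbr h w' i x <= low_nbr h w i x); [|lra].
  unfold low_nbr. apply Rmin_glb; [eapply Rle_trans; [apply Rmin_l|auto]|eapply Rle_trans; [apply Rmin_r|auto]].
Qed.

Variables (r h K : R) (A C : RN N -> R).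
Hypotheses (Hr : 0 < r) (Hh : 0 < h).
Hypothesis HAb : bucont A.
Hypothesis HCb : bucont C.
Hypothesis HC0 : forall x, 0 <= C x.
Hypothesis HK : forall x, C x * INR N / h ^ 2 <= K.
Hypothesis HK0 : 0 < K.
Hypothesis HKd : helmholtz_dense (N := N) r K.

(** A polynomial bounded below on the ball may become negative outside; its clipped extension keeps
    the same bounds everywhere, as the monotonicity of [psi] requires at the neighbouring points. *)
Definition ext (p : poly) x : R := peval p (clip r x).

Definition psi w x : R := K * w x - C x * upwind h w x.

(** K w is shared equally among the N directions, so that each summand is monotone by [upwind_mono].
    The hypothesis [HK] says precisely that the weight there is at most 1. *)
Lemma psi_sum w x : psi w x =
  K / INR N * sumN N (fun i => w x - (C x * INR N / (h ^ 2 * K)) * (Rmax 0 (w x - low_nbr h w i x) ^ 2 / w x)).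
Proof.
  assert (HNR : 0 < INR N) by (apply lt_0_INR; auto).
  rewrite sumN_minus, sumN_const, sumN_scal. unfold psi, upwind. field. lra.
Qed.

Lemma psi_mono w w' x : (forall y, 0 < w y <= w' y) -> psi w x <= psi w' x.
Proof.
  intros H. assert (HNR : 0 < INR N) by (apply lt_0_INR; auto).
  rewrite !psi_sum. apply Rmult_le_compat_l; [apply Rdiv_le_0_compat; lra|].
  apply sumN_le. intros i Hi. assert (Hh2 : 0 < h ^ 2) by (apply pow_lt; auto).
  apply upwind_mono; auto.
  - specialize (HK x). specialize (HC0 x). split; [apply Rdiv_le_0_compat; nra|].
    apply Rmult_le_reg_r with K; auto.
    replace (C x * INR N / (h ^ 2 * K) * K) with (C x * INR N / h ^ 2) by (field; lra). lra.
  - unfold low_nbr. pose proof (H (vadd x (vscal h (basis i)))).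
    pose proof (H (vadd x (vscal (- h) (basis i)))).
    split; [apply Rmin_glb; lra|].
    apply Rle_trans with (Rmin (w (vadd x (vscal h (basis i)))) (w' (vadd x (vscal (- h) (basis i)))));
      [apply Rle_min_compat_l|apply Rle_min_compat_r]; lra.
Qed.

Lemma psi_scal w l x : 0 < l -> 0 < w x -> psi (fun y => l * w y) x = l * psi w x.
Proof. intros. unfold psi. rewrite upwind_scal by auto. ring. Qed.

Lemma psi_le w x : 0 < w x -> psi w x <= K * w x.
Proof.
  intros H. unfold psi. pose proof (upwind_nonneg h w x Hh H). specialize (HC0 x). nra.
Qed.

Lemma psi_const eta x : 0 < eta -> psi (fun _ => eta) x = K * eta.
Proof.
  intros H. unfold psi, upwind, low_nbr.
  rewrite (sumN_ext _ _ (fun _ => 0)), sumN_const.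
  - unfold Rdiv. ring.
  - intros i Hi. rewrite Rmin_left by lra. rewrite Rminus_diag, Rmax_left by lra. field. lra.
Qed.

Lemma psi_bucont w m : 0 < m -> (forall x, m <= w x) -> bucont w -> bucont (psi w).
Proof.
  intros Hm Hl Hw. unfold psi, upwind.
  assert (Hs : forall v, bucont (fun x => w (vadd x v))).
  { intros v. apply (bucont_comp w (fun x => vadd x v) 1); auto; [lra|].
    intros. rewrite dist_vadd_r. lra. }
  apply (bucont_ext (fun x => K * w x + -1 * (C x * (sumN N
    (fun i => (Rmax 0 (w x + -1 * low_nbr h w i x) * Rmax 0 (w x + -1 * low_nbr h w i x)) * / w x) * / h ^ 2)))).
  - intros x. unfold Rdiv.
    rewrite (sumN_ext _ (fun i => Rmax 0 (w x - low_nbr h w i x) ^ 2 * / w x)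
      (fun i => Rmax 0 (w x + -1 * low_nbr h w i x) * Rmax 0 (w x + -1 * low_nbr h w i x) * / w x)); [ring|].
    intros i Hi. replace (w x + -1 * low_nbr h w i x) with (w x - low_nbr h w i x) by ring. ring.
  - apply bucont_plus; [apply bucont_scal; auto|]. apply bucont_scal, bucont_mult; auto.
    apply bucont_mult; [|apply bucont_const]. apply bucont_sumN. intros i Hi.
    assert (bucont (fun x => Rmax 0 (w x + -1 * low_nbr h w i x))).
    { apply bucont_max; [apply bucont_const|]. apply bucont_plus; auto.
      apply bucont_scal. apply bucont_min; apply Hs. }
    apply bucont_mult; [apply bucont_mult; auto|]. apply (bucont_inv w m); auto.
Qed.

Definition lin (p : poly) x : R := - lap p x + K * peval p x.

Lemma lin_compare p q : (forall x, nrm x = r -> peval p x <= peval q x) ->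
  (forall x, nrm x <= r -> lin p x <= lin q x) -> forall x, nrm x <= r -> peval p x <= peval q x.
Proof.
  intros Hb Hi x Hx. assert (peval (pminus p q) x <= 0); [|rewrite peval_pminus in H; lra].
  apply (max_principle (pminus p q) r); auto; [lra| |].
  - intros y Hy. rewrite peval_pminus. specialize (Hb y Hy). lra.
  - intros y Hy. rewrite peval_pminus, lap_pminus. intros Hp.
    specialize (Hi y ltac:(lra)). unfold lin in Hi. nra.
Qed.

Lemma ext_in p x : nrm x <= r -> ext p x = peval p x.
Proof. intros H. unfold ext. rewrite clip_id; auto. Qed.

Variables (a0 eta delta : R).
Hypotheses (Ha0 : 0 < a0) (HA0 : forall x, a0 <= A x) (Heta : 0 < eta) (Hdelta : 0 < delta <= 1).

(** Dense range only gives inexact solutions. The error is taken one-sided and proportional to A, so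
    it neither spoils the lower barrier nor the comparison of quotients. The boundary value eta > 0
    keeps the iterates away from 0. *)
Definition is_step (p p' : poly) : Prop :=
  (forall x, nrm x = r -> peval p' x = eta) /\
  forall x, nrm x <= r -> psi (ext p) x + A x <= lin p' x <= psi (ext p) x + (1 + delta) * A x.

Lemma step_exists p : (forall x, nrm x <= r -> eta <= peval p x) -> exists p', is_step p p'.
Proof.
  intros Hp.
  (* The target is the middle of the admissible band, whose half-width is at least delta/2 a0. The
     term K eta compensates the constant eta, which is added to a solution with zero boundary
     data. *)
  destruct (HKd (fun x => psi (ext p) x + (1 + delta / 2) * A x + - (K * eta)) (delta / 2 * a0)) as [q Hq].
  - apply bucont_plus; [|apply bucont_const]. apply bucont_plus; [|apply bucont_scal; auto].
    apply (psi_bucont _ eta); auto.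
    + intros x. apply Hp, clip_nrm; auto.
    + apply (bucont_poly_clip r); auto.
  - nra.
  - exists (PA (PC eta) (PM (pball N r) q)). split.
    + intros x Hx. change (eta + peval (PM (pball N r) q) x = eta).
      rewrite peval_pball_sphere; auto. ring.
    + intros x Hx. specialize (Hq x Hx). specialize (HA0 x).
      unfold lin. rewrite lap_PA, lap_PC.
      change (peval (PA (PC eta) (PM (pball N r) q)) x) with (eta + peval (PM (pball N r) q) x).
      unfold helmholtz in Hq. apply Rabs_le_between in Hq. nra.
Qed.

Variable A1 : R.
Hypothesis HA1 : forall x, A x <= A1.

(** A supersolution for every step: - Lap cap = 2 A1 dominates (1 + delta) A because delta <= 1, and
    [psi] never exceeds K w. *)
Definition cap : poly := PA (PC eta) (PM (PC (A1 / INR N)) (pball N r)).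
Definition capM : R := eta + A1 / INR N * r ^ 2.

Lemma peval_cap x : peval cap x = eta + A1 / INR N * (r ^ 2 - nsq x).
Proof. rewrite <- peval_pball. reflexivity. Qed.

Lemma lap_cap x : lap cap x = - 2 * A1.
Proof.
  assert (HNR : 0 < INR N) by (apply lt_0_INR; auto).
  unfold cap, pball. rewrite lap_PA, lap_PC, lap_scal, lap_pminus, lap_PC, lap_psq. field. lra.
Qed.

Lemma cap_le x : peval cap x <= capM.
Proof.
  assert (HNR : 0 < INR N) by (apply lt_0_INR; auto).
  rewrite peval_cap. unfold capM. pose proof (nsq_nonneg x).
  pose proof (HA0 vzero). pose proof (HA1 vzero).
  assert (0 <= A1 / INR N) by (apply Rdiv_le_0_compat; lra). nra.
Qed.

Definition sandwiched p : Prop := forall x, nrm x <= r -> eta <= peval p x <= peval cap x.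

Lemma sandwiched_le p x : sandwiched p -> nrm x <= r -> eta <= peval p x <= capM.
Proof. intros H Hx. specialize (H x Hx). pose proof (cap_le x). lra. Qed.

Lemma ext_sandwiched p x : sandwiched p -> eta <= ext p x <= capM.
Proof. intros H. apply sandwiched_le; auto. apply clip_nrm; auto. Qed.

Lemma step_sandwiched p p' : sandwiched p -> is_step p p' -> sandwiched p'.
Proof.
  intros Hp [Hb Hs] x Hx. split.
  - apply (lin_compare (PC eta) p'); auto.
    + intros y Hy. rewrite Hb by auto. simpl. lra.
    + intros y Hy. specialize (Hs y Hy). pose proof (HA0 y). unfold lin at 1. rewrite lap_PC. simpl.
      assert (Hpsi : psi (fun _ => eta) y <= psi (ext p) y).
      { apply psi_mono. intros z. pose proof (ext_sandwiched p z Hp). lra. }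
      rewrite psi_const in Hpsi by auto. lra.
  - apply (lin_compare p' cap); auto.
    + intros y Hy. rewrite Hb, peval_cap by auto. apply nrm_eq_iff in Hy; [|lra]. rewrite Hy. lra.
    + intros y Hy. specialize (Hs y Hy). pose proof (HA1 y). pose proof (HA0 y).
      pose proof (ext_sandwiched p y Hp). pose proof (psi_le (ext p) y ltac:(lra)).
      rewrite ext_in in * by auto. specialize (Hp y Hy).
      unfold lin at 2. rewrite lap_cap. nra.
Qed.

(** Since [psi] is at most K [capM] on sandwiched functions, [kap] times [psi] is at most a0, hence
    at most A. *)
Definition kap : R := a0 / (K * capM).

Lemma capM_pos : 0 < capM.
Proof.
  assert (Hz : nrm (@vzero N) <= r) by (rewrite nrm_vzero; lra).
  pose proof (cap_le vzero). rewrite peval_cap, nsq_vzero in H.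
  assert (HNR : 0 < INR N) by (apply lt_0_INR; auto).
  pose proof (HA0 vzero). pose proof (HA1 vzero).
  assert (0 <= A1 / INR N) by (apply Rdiv_le_0_compat; lra).
  pose proof (pow2_ge_0 r). nra.
Qed.

Lemma kap_pos : 0 < kap.
Proof. pose proof capM_pos. apply Rdiv_lt_0_compat; auto. apply Rmult_lt_0_compat; auto. Qed.

Lemma kap_psi p x : sandwiched p -> kap * psi (ext p) x <= A x.
Proof.
  intros Hp. pose proof capM_pos. pose proof kap_pos.
  pose proof (ext_sandwiched p x Hp). pose proof (psi_le (ext p) x ltac:(lra)).
  apply Rle_trans with a0; auto.
  replace a0 with (kap * (K * capM)) by (unfold kap; field; split; lra).
  apply Rmult_le_compat_l; [lra|]. nra.
Qed.

(* One step contracts the ratio of two iterates: the inhomogeneous term A is a fixed proportion of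
   the right-hand side, and it is not multiplied by the ratio. *)
Lemma step_contract q1 q2 q1' q2' mu : 0 <= mu -> sandwiched q1 -> sandwiched q2 ->
  is_step q1 q1' -> is_step q2 q2' ->
  (forall x, nrm x <= r -> peval q1 x <= (1 + delta + mu) * peval q2 x) ->
  forall x, nrm x <= r -> peval q1' x <= (1 + delta + mu / (1 + kap)) * peval q2' x.
Proof.
  intros Hmu S1 S2 [B1 T1] [B2 T2] Hle x Hx. pose proof kap_pos as Hk.
  set (mu' := mu / (1 + kap)).
  assert (Hmu' : 0 <= mu') by (apply Rdiv_le_0_compat; lra).
  (* The excess (mu - mu') psi equals mu' kap psi, and mu' A pays for it. *)
  assert (Emu : mu = mu' + mu' * kap) by (unfold mu'; field; lra).
  change ((1 + delta + mu') * peval q2' x) with (peval (PM (PC (1 + delta + mu')) q2') x).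
  apply lin_compare; auto.
  - intros y Hy. simpl. rewrite B1, B2 by auto. nra.
  - intros y Hy. specialize (T1 y Hy). specialize (T2 y Hy).
    replace (lin (PM (PC (1 + delta + mu')) q2') y) with ((1 + delta + mu') * lin q2' y)
      by (unfold lin; rewrite lap_scal; simpl; ring).
    assert (P : psi (ext q1) y <= (1 + delta + mu) * psi (ext q2) y).
    { rewrite <- psi_scal; [|lra|pose proof (ext_sandwiched q2 y S2); lra].
      apply psi_mono. intros z. pose proof (ext_sandwiched q1 z S1). split; [lra|].
      apply Hle, clip_nrm; auto. }
    pose proof (kap_psi q2 y S2) as Q.
    apply Rle_trans with ((1 + delta + mu') * (psi (ext q2) y + A y)); [|nra].
    assert (mu' * (kap * psi (ext q2) y) <= mu' * A y) by (apply Rmult_le_compat_l; auto).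
    rewrite Emu in P. lra.
Qed.

Lemma iterates_close n : exists p p', sandwiched p /\ sandwiched p' /\ is_step p p' /\
  (forall x, nrm x <= r -> peval p' x <= (1 + delta + capM / eta / (1 + kap) ^ n) * peval p x) /\
  (forall x, nrm x <= r -> peval p x <= (1 + delta + capM / eta / (1 + kap) ^ n) * peval p' x).
Proof.
  pose proof capM_pos as HM. pose proof kap_pos as Hk.
  induction n as [|n (p & p' & S1 & S2 & St & H1 & H2)].
  - assert (S0 : sandwiched (PC eta)).
    { intros x Hx. simpl peval at 1 2. rewrite peval_cap. apply nrm_le_iff in Hx; [|lra].
      assert (HNR : 0 < INR N) by (apply lt_0_INR; auto).
      pose proof (HA0 vzero). pose proof (HA1 vzero).
      assert (0 <= A1 / INR N) by (apply Rdiv_le_0_compat; lra). nra. }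
    destruct (step_exists (PC eta)) as [p' St]; [simpl; intros; lra|].
    pose proof (step_sandwiched _ _ S0 St) as S1.
    exists (PC eta), p'. do 3 (split; auto).
    assert (0 < capM / eta) by (apply Rdiv_lt_0_compat; auto).
    simpl pow. rewrite Rdiv_1_r. split; intros x Hx; pose proof (sandwiched_le p' x S1 Hx); simpl peval.
    + replace (_ * eta) with ((1 + delta) * eta + capM) by (field; lra). nra.
    + nra.
  - destruct (step_exists p') as [p'' St']; [intros; apply S2; auto|].
    pose proof (step_sandwiched _ _ S2 St') as S3.
    exists p', p''. do 3 (split; auto).
    assert (Hmu : 0 <= capM / eta / (1 + kap) ^ n).
    { apply Rdiv_le_0_compat; [apply Rdiv_le_0_compat; lra|apply pow_lt; lra]. }
    replace (capM / eta / (1 + kap) ^ S n) with (capM / eta / (1 + kap) ^ n / (1 + kap)).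
    2: { simpl. field. repeat split; try lra. apply pow_nonzero; lra. }
    split.
    + exact (step_contract p' p p'' p' _ Hmu S2 S1 St' St H1).
    + exact (step_contract p p' p' p'' _ Hmu S1 S2 St St' H2).
Qed.

(** Two consecutive iterates have quotients within 1 + 2 delta once the geometric term is below
    delta. By homogeneity and monotonicity [psi] may then be evaluated at the new iterate instead of
    the old one, at a cost proportional to delta. *)
Lemma approx_fixed_point : exists p, sandwiched p /\ (forall x, nrm x = r -> peval p x = eta) /\ forall x, nrm x <= r ->
    Rabs (- lap p x + C x * upwind h (ext p) x - A x) <= delta * (2 * K * capM + A1).
Proof.
  pose proof capM_pos as HM. pose proof kap_pos as Hk.
  assert (Hn : exists n, capM / eta / (1 + kap) ^ n <= delta).
  { destruct (INR_unbounded (capM / eta / delta / kap)) as [n Hn]. exists n.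
    assert (Hp : 0 < (1 + kap) ^ n) by (apply pow_lt; lra).
    assert (Hb : INR n * kap <= (1 + kap) ^ n).
    { clear - Hk. assert (1 + INR n * kap <= (1 + kap) ^ n); [|lra].
      induction n as [|n IH]; [simpl; lra|]. rewrite S_INR. simpl. pose proof (pos_INR n). nra. }
    apply Rmult_le_reg_r with ((1 + kap) ^ n); auto.
    replace (capM / eta / (1 + kap) ^ n * (1 + kap) ^ n) with (capM / eta) by (field; lra).
    apply Rmult_lt_compat_r with (r := kap * delta) in Hn; [|nra].
    replace (capM / eta / delta / kap * (kap * delta)) with (capM / eta) in Hn by (field; lra). nra. }
  destruct Hn as [n Hn].
  destruct (iterates_close n) as (p & p' & S1 & S2 & St & H1 & H2).
  set (mu := capM / eta / (1 + kap) ^ n) in *.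
  assert (Hmu : 0 <= mu).
  { apply Rdiv_le_0_compat; [apply Rdiv_le_0_compat; lra|apply pow_lt; lra]. }
  exists p'. split; auto. split; [apply St|]. intros x Hx.
  destruct St as [_ T]. specialize (T x Hx).
  assert (P : forall q1 q2, sandwiched q1 -> sandwiched q2 ->
    (forall y, nrm y <= r -> peval q1 y <= (1 + delta + mu) * peval q2 y) ->
    psi (ext q1) x <= psi (ext q2) x + 2 * delta * (K * capM)).
  { intros q1 q2 Q1 Q2 Hle.
    assert (psi (ext q1) x <= (1 + 2 * delta) * psi (ext q2) x).
    { pose proof (ext_sandwiched q2 x Q2).
      rewrite <- psi_scal by lra.
      apply psi_mono. intros z. pose proof (ext_sandwiched q1 z Q1). pose proof (ext_sandwiched q2 z Q2).
      split; [lra|]. pose proof (Hle (clip r z) (clip_nrm r z Hr)). unfold ext in *. nra. }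
    pose proof (ext_sandwiched q2 x Q2). pose proof (psi_le (ext q2) x ltac:(lra)).
    assert (psi (ext q2) x <= K * capM) by nra. nra. }
  pose proof (P p p' S1 S2 H2). pose proof (P p' p S2 S1 H1).
  pose proof (HA1 x). pose proof (HA0 x).
  unfold lin in T. unfold psi at 1 in H0. unfold psi at 2 in H. rewrite (ext_in p' x Hx) in H, H0.
  apply Rabs_le. split; nra.
Qed.
End Scheme.

Lemma approx_solution {N} (HN0 : (0 < N)%nat) r h eta eps a0 (A C : RN N -> R) :
  0 < r -> 0 < h -> 0 < eta -> 0 < eps -> 0 < a0 -> bucont A -> bucont C ->
  (forall x, a0 <= A x) -> (forall x, 0 <= C x) ->
  exists p, (forall x : RN N, nrm x <= r -> eta <= peval p x) /\
    (forall x : RN N, nrm x = r -> peval p x = eta) /\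
    forall x : RN N, nrm x <= r -> Rabs (- lap p x + C x * upwind h (ext r p) x - A x) <= eps.
Proof.
  intros Hr Hh He Heps Ha0 HA HC HA0 HC0.
  destruct HA as [[A1 HA1] HAu] eqn:EA. destruct HC as [[C1 HC1] HCu] eqn:EC.
  assert (HNR : 0 < INR N) by (apply lt_0_INR; auto).
  assert (Hh2 : 0 < h ^ 2) by (apply pow_lt; auto).
  destruct (helmholtz_dense_large HN0 r (C1 * INR N / h ^ 2 + 1) Hr) as [K [HK [HK0 HKd]]].
  assert (C0 : 0 <= C1) by (eapply Rle_trans; [apply Rabs_pos|apply (HC1 vzero)]).
  assert (0 <= C1 * INR N / h ^ 2) by (apply Rdiv_le_0_compat; nra).
  assert (HA1' : forall x, A x <= A1) by (intros x; eapply Rle_trans; [apply Rle_abs|auto]).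
  assert (HKx : forall x, C x * INR N / h ^ 2 <= K).
  { intros x. apply Rle_trans with (C1 * INR N / h ^ 2); [|lra].
    apply Rmult_le_compat_r; [left; apply Rinv_0_lt_compat; auto|].
    apply Rmult_le_compat_r; [lra|]. eapply Rle_trans; [apply Rle_abs|auto]. }
  set (B := 2 * K * capM (N := N) r eta A1 + A1).
  assert (HB : 0 < B).
  { assert (0 < capM (N := N) r eta A1) by (apply (capM_pos HN0 r A Hr a0 eta Ha0 HA0 He A1 HA1')).
    pose proof (HA0 vzero). pose proof (HA1' vzero). unfold B. nra. }
  (* The tolerance comes last: B involves K, which depends on h, and [capM], which depends on r and
     eta, but not delta. *)
  set (delta := Rmin 1 (eps / B)).
  assert (Hd : 0 < delta <= 1).
  { unfold delta. split; [apply Rmin_glb_lt; [lra|apply Rdiv_lt_0_compat; auto]|apply Rmin_l]. }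
  destruct (approx_fixed_point HN0 r h K A C Hr Hh HA HC HC0 HKx ltac:(lra) HKd a0 eta delta Ha0 HA0 He Hd A1 HA1')
    as [p [S [Hb Hres]]].
  exists p. split; [intros; apply S; auto|]. split; auto.
  intros x Hx. eapply Rle_trans; [apply Hres; auto|]. fold B.
  apply Rle_trans with (eps / B * B); [|right; field; lra].
  apply Rmult_le_compat_r; [lra|apply Rmin_r].
Qed.

(** * Barriers and Lipschitz bounds *)

Section LowerBarrier.
Context {N : nat}.
Hypothesis HN0 : (0 < N)%nat.
Implicit Types x y v : RN N.

Lemma bucont_unif_cont (f : RN N -> R) r : bucont f -> unif_cont_on r f.
Proof. intros [_ H] e He. destruct (H e He) as [d [Hd Q]]. exists d. split; auto. Qed.

Definition bump (rho eps : R) : poly := PM (PC eps) (PM (pball N rho) (pball N rho)).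
(** The positive part is needed because neighbours of a point of the ball may lie outside it, where
    the square in [bump] grows again. *)
Definition bump_plus (rho eps : R) x : R := eps * Rmax 0 (rho ^ 2 - nsq x) ^ 2.

Lemma peval_bump rho eps x : peval (bump rho eps) x = eps * (rho ^ 2 - nsq x) ^ 2.
Proof. rewrite <- peval_pball. simpl. ring. Qed.

Lemma lap_bump rho eps x : lap (bump rho eps) x = eps * (8 * nsq x - 4 * INR N * (rho ^ 2 - nsq x)).
Proof.
  unfold bump. rewrite lap_scal, lap_PM. rewrite (peval_pball rho x).
  assert (E : lap (pball N rho) x = - 2 * INR N) by (unfold pball; rewrite lap_pminus, lap_PC, lap_psq; ring).
  rewrite E.
  rewrite (sumN_ext _ _ (fun i => 4 * coord x i ^ 2)).
  - rewrite sumN_scal. fold (nsq x). ring.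
  - intros i Hi. unfold pball, pminus. simpl. rewrite pderiv_psq by auto. ring.
Qed.

Lemma nsq_vadd_basis x i t : (i < N)%nat ->
  nsq (vadd x (vscal t (basis i))) = nsq x + 2 * t * coord x i + t ^ 2.
Proof.
  intros Hi. rewrite nsq_vadd, nsq_vscal, nsq_basis by auto.
  replace (dot x (vscal t (basis i))) with (t * coord x i); [ring|].
  rewrite <- (dot_basis x i) by auto. unfold dot. rewrite <- sumN_scal.
  apply sumN_ext; intros. rewrite coord_vscal. ring.
Qed.

(** Vanishing to second order at the sphere keeps |grad w|^2 / w bounded up to the boundary. A step
    h <= rho changes rho^2 - |x|^2 by at most 3 h rho, its square drops by at most 6 g h rho, and 36
    is the square of 6. *)
Lemma upwind_bump rho eps h x : 0 < h <= rho -> 0 < eps -> nrm x < rho ->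
  upwind h (bump_plus rho eps) x <= 36 * INR N * eps * rho ^ 2.
Proof.
  intros Hh He Hx. pose proof Hx as Hx'. apply nrm_lt_iff in Hx'; [|lra].
  set (g := rho ^ 2 - nsq x). assert (Hg : 0 < g) by (unfold g; lra).
  assert (EW : bump_plus rho eps x = eps * g ^ 2) by (unfold bump_plus; fold g; rewrite Rmax_right; lra).
  assert (Hh2 : 0 < h ^ 2) by (apply pow_lt; lra).
  unfold upwind. apply Rmult_le_reg_r with (h ^ 2); auto.
  unfold Rdiv at 1. rewrite Rmult_assoc, Rinv_l, Rmult_1_r by lra.
  replace (36 * INR N * eps * rho ^ 2 * h ^ 2) with (INR N * (36 * eps * rho ^ 2 * h ^ 2)) by ring.
  rewrite <- sumN_const. apply sumN_le. intros i Hi.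
  assert (Hci : Rabs (coord x i) <= rho) by (pose proof (coord_le_nrm x i); lra).
  apply Rabs_le_between in Hci.
  assert (Nb : forall t, t = h \/ t = - h ->
    bump_plus rho eps x - bump_plus rho eps (vadd x (vscal t (basis i))) <= 6 * eps * g * (h * rho)).
  { intros t Ht. rewrite EW. unfold bump_plus. rewrite nsq_vadd_basis by auto.
    set (g' := rho ^ 2 - (nsq x + 2 * t * coord x i + t ^ 2)).
    assert (Hg' : g - g' <= 3 * (h * rho)) by (unfold g, g'; destruct Ht; subst t; nra).
    set (k := Rmax 0 g'). assert (Hk0 : 0 <= k) by apply Rmax_l.
    assert (Hk : g' <= k) by apply Rmax_r.
    replace (eps * g ^ 2 - eps * k ^ 2) with (eps * ((g - k) * (g + k))) by ring.
    replace (6 * eps * g * (h * rho)) with (eps * (6 * g * (h * rho))) by ring.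
    apply Rmult_le_compat_l; [lra|]. assert (0 < h * rho) by nra.
    destruct (Rle_or_lt g k).
    - apply Rle_trans with 0; [|apply Rmult_le_pos; nra].
      assert (0 <= (k - g) * (g + k)) by (apply Rmult_le_pos; lra). lra.
    - apply Rle_trans with ((g - k) * (2 * g)); [apply Rmult_le_compat_l; lra|].
      replace (6 * g * (h * rho)) with (3 * (h * rho) * (2 * g)) by ring.
      apply Rmult_le_compat_r; lra. }
  assert (HX : 0 <= Rmax 0 (bump_plus rho eps x - low_nbr h (bump_plus rho eps) i x) <= 6 * eps * g * (h * rho)).
  { split; [apply Rmax_l|]. assert (0 < eps * g) by (apply Rmult_lt_0_compat; auto).
    assert (0 < h * rho) by nra.
    apply Rmax_lub; [nra|].
    unfold low_nbr, Rmin. destruct Rle_dec; apply Nb; auto. }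
  rewrite EW at 2.
  assert (Hw : 0 < eps * g ^ 2) by (apply Rmult_lt_0_compat; auto; apply pow_lt; auto).
  apply Rmult_le_reg_r with (eps * g ^ 2); auto.
  unfold Rdiv. rewrite Rmult_assoc, Rinv_l, Rmult_1_r by lra.
  apply Rle_trans with ((6 * eps * g * (h * rho)) ^ 2); [apply pow_incr; auto|right; ring].
Qed.

(** If the quotient bump / p had a maximum lam > 1, then lam p would touch the bump from above at an
    interior point. There both the Laplacians and, by monotonicity and homogeneity, the upwind terms
    are ordered, which makes lam b no larger than what the bump provides, a quantity below b. *)
Lemma lower_barrier r rho h eta b c1 eps p (C : RN N -> R) :
  0 < h <= rho -> rho <= r -> 0 < eta -> 0 < eps ->
  (forall x, nrm x <= r -> eta <= peval p x) ->
  (forall x, nrm x <= rho -> 0 <= C x <= c1) ->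
  (forall x, nrm x <= rho -> b <= - lap p x + C x * upwind h (ext r p) x) ->
  eps * ((4 * INR N + 36 * c1 * INR N) * rho ^ 2) < b ->
  forall x, nrm x <= rho -> eps * (rho ^ 2 - nsq x) ^ 2 <= peval p x.
Proof.
  intros Hh Hrho Heta Heps Hp HC Hb Hsmall x0 Hx0.
  destruct (Rle_or_lt (eps * (rho ^ 2 - nsq x0) ^ 2) (peval p x0)) as [|Hbad]; auto. exfalso.
  pose proof (pos_INR N) as HNR.
  assert (Hclip : forall x, nrm (clip rho x) <= r).
  { intros x. pose proof (clip_nrm rho x ltac:(lra)). lra. }
  destruct (ball_max (fun x => peval (bump rho eps) (clip rho x) * / peval p (clip rho x)) rho) as [x [Hx Hmax]].
  { lra. }
  { apply bucont_unif_cont, bucont_mult; [apply bucont_poly_clip; lra|].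
    apply (bucont_inv _ eta); auto. apply bucont_poly_clip; lra. }
  set (lam := peval (bump rho eps) (clip rho x) * / peval p (clip rho x)) in *.
  assert (Hpos : forall y, nrm y <= rho -> 0 < peval p y).
  { intros y Hy. specialize (Hp y ltac:(lra)). lra. }
  assert (Hl : 1 < lam).
  { specialize (Hmax x0 Hx0). rewrite clip_id in Hmax by lra. rewrite peval_bump in Hmax.
    pose proof (Hpos x0 Hx0). apply Rlt_le_trans with (2 := Hmax).
    apply Rmult_lt_reg_r with (peval p x0); auto. rewrite Rmult_assoc, Rinv_l by lra. lra. }
  unfold lam in Hl. rewrite clip_id in Hl by lra.
  assert (El : peval (bump rho eps) x = lam * peval p x).
  { unfold lam. rewrite clip_id by lra. field. pose proof (Hpos x Hx). lra. }
  rewrite <- (clip_id rho x) in Hl by lra. fold lam in Hl.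
  assert (Hle : forall y, nrm y <= rho -> peval (bump rho eps) y <= lam * peval p y).
  { intros y Hy. specialize (Hmax y Hy). rewrite clip_id in Hmax by lra. pose proof (Hpos y Hy).
    apply Rmult_le_compat_r with (r := peval p y) in Hmax; [|lra].
    rewrite Rmult_assoc, Rinv_l in Hmax by lra. lra. }
  assert (Hxi : nrm x < rho).
  { destruct (Rle_lt_or_eq_dec _ _ Hx) as [|E]; auto. exfalso.
    apply nrm_eq_iff in E; [|lra]. rewrite peval_bump, E in El.
    pose proof (Hpos x Hx). nra. }
  assert (Hlap : lap (bump rho eps) x <= lam * lap p x).
  { pose proof (interior_max_lap (pminus (bump rho eps) (PM (PC lam) p)) x rho Hxi) as K.
    rewrite lap_pminus, lap_scal in K. apply Rminus_le. apply K.
    intros y Hy. rewrite !peval_pminus. simpl (peval (PM (PC lam) p) _). specialize (Hle y Hy). lra. }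
  assert (Hup : lam * upwind h (ext r p) x <= upwind h (bump_plus rho eps) x).
  { pose proof (Hpos x Hx) as Hpx.
    assert (Hex : ext r p x = peval p x) by (apply ext_in; lra).
    rewrite <- upwind_scal; try lra.
    apply upwind_le; try lra.
    - rewrite Hex. nra.
    - rewrite Hex, <- El, peval_bump. unfold bump_plus. rewrite Rmax_right; auto.
      apply nrm_lt_iff in Hxi; lra.
    - intros y. unfold bump_plus. destruct (Rle_or_lt (nrm y) rho) as [Hy|Hy].
      + rewrite Rmax_right by (apply nrm_le_iff in Hy; lra). rewrite <- peval_bump.
        unfold ext. rewrite clip_id by lra. auto.
      + rewrite Rmax_left.
        * pose proof (Hp (clip r y) ltac:(apply clip_nrm; lra)). unfold ext. nra.
        * destruct (Rle_or_lt (nsq y) (rho ^ 2)) as [K|K]; [|lra].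
          apply nrm_le_iff in K; lra. }
  pose proof (upwind_bump rho eps h x Hh Heps Hxi) as Hub.
  specialize (Hb x Hx). specialize (HC x Hx).
  rewrite lap_bump in Hlap. pose proof (nsq_nonneg x).
  apply nrm_lt_iff in Hxi; [|lra].
  assert (B1 : lam * b <= lam * (- lap p x + C x * upwind h (ext r p) x)) by (apply Rmult_le_compat_l; lra).
  assert (B2 : lam * (C x * upwind h (ext r p) x) <= C x * (36 * INR N * eps * rho ^ 2)).
  { replace (lam * (C x * upwind h (ext r p) x)) with (C x * (lam * upwind h (ext r p) x)) by ring.
    apply Rmult_le_compat_l; lra. }
  assert (B3 : C x * (36 * INR N * eps * rho ^ 2) <= c1 * (36 * INR N * eps * rho ^ 2)).
  { apply Rmult_le_compat_r; [|lra]. apply Rmult_le_pos; [|apply pow2_ge_0]. nra. }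
  assert (B4 : - (eps * (8 * nsq x - 4 * INR N * (rho ^ 2 - nsq x))) <= eps * (4 * INR N * rho ^ 2)).
  { assert (0 <= eps * (8 * nsq x + 4 * INR N * nsq x)) by (apply Rmult_le_pos; nra). lra. }
  assert (0 < b).
  { apply Rle_lt_trans with (2 := Hsmall). apply Rmult_le_pos; [lra|].
    apply Rmult_le_pos; [|apply pow2_ge_0]. assert (0 <= c1) by lra. nra. }
  nra.
Qed.
End LowerBarrier.

(** * Doubling of variables and the local Lipschitz bound *)

Section Doubling.
Context {N : nat}.
Hypothesis HN0 : (0 < N)%nat.
Implicit Types x y v : RN N.

Lemma ln_1p_le t : 0 <= t -> ln (1 + t) <= t.
Proof.
  intros Ht. rewrite <- (ln_exp t) at 2.
  destruct Ht as [Ht|<-].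
  - left. apply ln_increasing; [lra|]. apply exp_ineq1. lra.
  - rewrite Rplus_0_r, exp_0. lra.
Qed.

Definition logw (k B s : R) : R := / k * ln (1 + B * s).

Lemma logw_deriv k B s : 0 < k -> 0 < B -> 0 < 1 + B * s ->
  is_derive (logw k B) s (B / k / (1 + B * s)).
Proof. intros. unfold logw. auto_derive; [auto|field; lra]. Qed.

Lemma logw_incr k B s t : 0 < k -> 0 < B -> 0 <= s <= t -> logw k B s <= logw k B t.
Proof.
  intros Hk HB Hst. unfold logw. apply Rmult_le_compat_l; [left; apply Rinv_0_lt_compat; auto|].
  destruct (proj2 Hst) as [Hlt|<-]; [|lra]. left. apply ln_increasing; nra.
Qed.

Lemma logw_concave k B s t : 0 < k -> 0 < B -> 0 <= s -> 0 <= t ->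
  logw k B (s + t) - logw k B s <= t * (B / k / (1 + B * s)).
Proof.
  intros Hk HB Hs Ht. unfold logw.
  assert (0 < 1 + B * s) by nra.
  replace (1 + B * (s + t)) with ((1 + B * s) * (1 + B * t / (1 + B * s))) by (field; lra).
  assert (Hq : 0 <= B * t / (1 + B * s)) by (apply Rdiv_le_0_compat; nra).
  rewrite ln_mult by lra. pose proof (ln_1p_le _ Hq).
  replace (t * (B / k / (1 + B * s))) with (/ k * (B * t / (1 + B * s))) by (field; lra).
  assert (0 < / k) by (apply Rinv_0_lt_compat; auto). nra.
Qed.

Lemma logw_0 k B : logw k B 0 = 0.
Proof. unfold logw. rewrite Rmult_0_r, Rplus_0_r, ln_1. ring. Qed.

Lemma pdir_twice v p x : peval (pdir v (pdir v p)) x =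
  sumN N (fun k => sumN N (fun j => coord v k * coord v j * peval (pderiv k (pderiv j p)) x)).
Proof.
  rewrite peval_pdir. apply sumN_ext. intros k Hk. unfold pdir. rewrite pderiv_psum, <- sumN_scal.
  apply sumN_ext. intros j Hj. simpl. ring.
Qed.

Definition reflected (e : RN N) (i : nat) : RN N := vsub (basis i) (vscal (2 * coord e i) e).

(** A reflection is orthogonal, and the trace of the Hessian may be computed in any orthonormal
    frame; the inner computation is the orthogonality relation of the reflected basis. *)
Lemma reflect_trace e p y : nsq e = 1 ->
  sumN N (fun i => peval (pdir (reflected e i) (pdir (reflected e i) p)) y) = lap p y.
Proof.
  intros He.
  rewrite (sumN_ext _ _ (fun i => sumN N (fun k => sumN N (fun j =>
    coord (reflected e i) k * coord (reflected e i) j * peval (pderiv k (pderiv j p)) y))))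
    by (intros; apply pdir_twice).
  rewrite sumN_swap. apply sumN_ext. intros k Hk. rewrite sumN_swap.
  rewrite (sumN_ext _ _ (fun j => peval (pderiv k (pderiv j p)) y * (if Nat.eqb j k then 1 else 0))).
  - rewrite (sumN_delta N k (fun j => peval (pderiv k (pderiv j p)) y)); auto.
  - intros j Hj.
    rewrite (sumN_ext _ _ (fun i => peval (pderiv k (pderiv j p)) y * (coord (reflected e i) k * coord (reflected e i) j)))
      by (intros; ring).
    rewrite sumN_scal. f_equal.
    rewrite (sumN_ext _ _ (fun i => (if Nat.eqb j k then 1 else 0) * (if Nat.eqb i k then 1 else 0)
      + (-2 * coord e j) * (coord e i * (if Nat.eqb i k then 1 else 0))
      + (-2 * coord e k) * (coord e i * (if Nat.eqb i j then 1 else 0))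
      + (4 * coord e k * coord e j) * (coord e i ^ 2))).
    + rewrite !sumN_plus, !sumN_scal.
      rewrite (sumN_ext _ (fun i => if Nat.eqb i k then 1 else 0) (fun i => 1 * (if Nat.eqb i k then 1 else 0))) by (intros; ring).
      rewrite (sumN_delta N k (fun _ => 1)), !sumN_delta by auto.
      fold (nsq e). rewrite He. ring.
    + intros i Hi. unfold reflected. rewrite !coord_vsub, !coord_vscal, !coord_basis by auto.
      rewrite (Nat.eqb_sym k i), (Nat.eqb_sym j i).
      destruct (Nat.eqb_spec i k), (Nat.eqb_spec i j), (Nat.eqb_spec j k); subst; try lia; ring.
Qed.
End Doubling.

Section Lipschitz.
Context {N : nat}.
Hypothesis HN0 : (0 < N)%nat.
Implicit Types x y v : RN N.

Lemma logw_uniform k B : 0 < k -> 0 < B -> forall s t, 0 <= s -> 0 <= t ->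
  Rabs (logw k B s - logw k B t) <= B / k * Rabs (s - t).
Proof.
  intros Hk HB.
  assert (W : forall s t, 0 <= s <= t -> Rabs (logw k B s - logw k B t) <= B / k * Rabs (s - t)).
  { intros s t Hst. pose proof (logw_incr k B s t Hk HB Hst).
    pose proof (logw_concave k B s (t - s) Hk HB ltac:(lra) ltac:(lra)).
    replace (s + (t - s)) with t in H0 by ring.
    rewrite Rabs_minus_sym, Rabs_pos_eq by lra. rewrite Rabs_minus_sym, (Rabs_pos_eq (t - s)) by lra.
    assert (HBk : 0 < B / k) by (apply Rdiv_lt_0_compat; auto).
    assert (B / k / (1 + B * s) <= B / k).
    { assert (1 <= 1 + B * s) by nra. apply Rmult_le_reg_r with (1 + B * s); [lra|].
      replace (B / k / (1 + B * s) * (1 + B * s)) with (B / k) by (field; lra). nra. }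
    nra. }
  intros s t Hs Ht. destruct (Rle_or_lt s t); [apply W; lra|].
  rewrite Rabs_minus_sym, (Rabs_minus_sym s). apply W; lra.
Qed.

(** The term M |x - x0|^2 localizes the argument: for values of p in (0, M], a positive maximum
    cannot be attained at |x - x0| = 1. *)
Lemma doubling_max p k B M x0 r0 : 0 < k -> 0 < B -> 0 <= r0 ->
  exists x y, dist x x0 <= 1 /\ dist x y <= r0 /\ forall x' y', dist x' x0 <= 1 -> dist x' y' <= r0 ->
    peval p x' - peval p y' - logw k B (dist x' y') - M * dist x' x0 ^ 2
    <= peval p x - peval p y - logw k B (dist x y) - M * dist x x0 ^ 2.
Proof.
  intros Hk HB Hr0.
  destruct (evt (fun q : RN N * RN N => dist (fst q) x0 <= 1 /\ dist (fst q) (snd q) <= r0)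
    (fun q => peval p (fst q) - peval p (snd q) - logw k B (dist (fst q) (snd q)) - M * dist (fst q) x0 ^ 2))
    as [[x y] [[H1 H2] H3]].
  - exists (x0, x0). simpl. rewrite dist_self. lra.
  - intros qs Hqs.
    set (R1 := nrm x0 + 1 + r0).
    assert (Hb1 : forall n, nrm (fst (qs n)) <= R1).
    { intros n. destruct (Hqs n). pose proof (nrm_dist (fst (qs n)) x0). unfold R1; lra. }
    assert (Hb2 : forall n, nrm (snd (qs n)) <= R1).
    { intros n. destruct (Hqs n). pose proof (nrm_dist (snd (qs n)) (fst (qs n))).
      rewrite dist_sym in H1. pose proof (nrm_dist (fst (qs n)) x0). unfold R1; lra. }
    destruct (ball_compact _ _ Hb1) as [x [Hx Dx]]. destruct (ball_compact _ _ Hb2) as [y [Hy Dy]].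
    assert (Lx0 : ulim (fun n => dist (fst (qs n)) x0) (dist x x0)).
    { apply (ulim_squeeze _ _ _ Dx). apply uf_all. intros n. apply Rabs_le.
      pose proof (dist_tri (fst (qs n)) x x0). pose proof (dist_tri x (fst (qs n)) x0).
      rewrite (dist_sym x (fst (qs n))) in H0. lra. }
    assert (Lxy : ulim (fun n => dist (fst (qs n)) (snd (qs n))) (dist x y)).
    { pose proof (ulim_plus _ _ _ _ Dx Dy) as D. rewrite Rplus_0_r in D.
      apply (ulim_squeeze _ _ _ D). apply uf_all. intros n. apply Rabs_le.
      pose proof (dist_tri (fst (qs n)) x (snd (qs n))). pose proof (dist_tri x y (snd (qs n))).
      pose proof (dist_tri x (fst (qs n)) y). pose proof (dist_tri (fst (qs n)) (snd (qs n)) y).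
      rewrite (dist_sym x (fst (qs n))) in H1. rewrite (dist_sym y (snd (qs n))) in H0. lra. }
    exists (x, y). simpl. split; [split|].
    + eapply ulim_le; [apply Lx0|apply ulim_const|]. apply uf_all. intros n. apply Hqs.
    + eapply ulim_le; [apply Lxy|apply ulim_const|]. apply uf_all. intros n. apply Hqs.
    + repeat apply ulim_minus.
      * apply (ulim_uniform (peval p) (fun n => fst (qs n)) x R1); auto. apply poly_unif_cont.
      * apply (ulim_uniform (peval p) (fun n => snd (qs n)) y R1); auto. apply poly_unif_cont.
      * pose proof (ulim_scal (B / k) _ _ (ulim_cont Rabs _ _ (Rcontinuity_abs _)
          (ulim_minus _ _ _ _ Lxy (ulim_const (dist x y))))) as D.
        rewrite Rminus_diag, Rabs_R0, Rmult_0_r in D.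
        apply (ulim_squeeze _ _ _ D). apply uf_all. intros n.
        apply logw_uniform; auto using dist_nonneg.
      * apply ulim_scal, ulim_sqr, Lx0.
  - exists x, y. split; [auto|]. split; [auto|]. intros x' y' Hx' Hy'. apply (H3 (x', y')). split; auto.
Qed.

(** A vector and its reflection differ by 2 e_i e, a multiple of the unit vector e along x - y.
    Moving x and y along such a pair keeps x - y on its line, so the distance is affine in t as long
    as it does not change sign. *)
Lemma dist_reflect x y i t : (i < N)%nat -> 0 < dist x y -> Rabs t < dist x y / 2 ->
  let e := vscal (/ dist x y) (vsub x y) in
  dist (vadd x (vscal t (basis i))) (vadd y (vscal t (reflected e i))) = dist x y + 2 * t * coord e i.
Proof.
  intros Hi Hs Ht e. set (s := dist x y) in *.
  assert (He : nrm e = 1).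
  { unfold e. rewrite nrm_vscal, <- dist_nrm, Rabs_pos_eq by (left; apply Rinv_0_lt_compat; auto).
    fold s. field. lra. }
  pose proof (coord_le_nrm e i) as Hei. rewrite He in Hei.
  rewrite dist_nrm.
  replace (vsub (vadd x (vscal t (basis i))) (vadd y (vscal t (reflected e i))))
    with (vscal (s + 2 * t * coord e i) e).
  - rewrite nrm_vscal, He, Rmult_1_r. apply Rabs_pos_eq.
    assert (Rabs (2 * t * coord e i) <= s).
    { rewrite !Rabs_mult, (Rabs_pos_eq 2) by lra. pose proof (Rabs_pos t). pose proof (Rabs_pos (coord e i)). nra. }
    apply Rabs_le_between in H. lra.
  - apply RN_ext. intros j Hj. unfold reflected.
    rewrite coord_vsub, !coord_vadd, !coord_vscal, coord_vsub, coord_vscal.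
    assert (Ej : coord x j - coord y j = s * coord e j).
    { unfold e. rewrite coord_vscal, coord_vsub. field. lra. }
    replace (coord x j) with (coord y j + s * coord e j) by lra. ring.
Qed.

(** Second-order test in each paired direction. Moving both points in parallel would leave |x - y|
    fixed and lose the concavity of [logw]; with reflected pairs the distance moves at speed 2 e_i,
    which yields 4 k D^2 e_i^2, and the squares e_i^2 sum to 1. *)
Lemma doubling_hessian p k B M x0 r0 x y : 0 < k -> 0 < B ->
  dist x x0 < 1 -> 0 < dist x y < r0 ->
  (forall x' y', dist x' x0 <= 1 -> dist x' y' <= r0 ->
    peval p x' - peval p y' - logw k B (dist x' y') - M * dist x' x0 ^ 2
    <= peval p x - peval p y - logw k B (dist x y) - M * dist x x0 ^ 2) ->
  lap p x - lap p y + 4 * k * (B / k / (1 + B * dist x y)) ^ 2 - 2 * INR N * M <= 0.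
Proof.
  intros Hk HB Hx Hs Hmax. set (s := dist x y) in *.
  set (e := vscal (/ s) (vsub x y)).
  assert (He : nsq e = 1).
  { unfold e. rewrite nsq_vscal, <- nrm_sqr, <- dist_nrm. fold s. field. lra. }
  set (D := B / k / (1 + B * s)).
  assert (Hi : forall i, (i < N)%nat ->
    peval (pderiv i (pderiv i p)) x - peval (pdir (reflected e i) (pdir (reflected e i) p)) y
    + 4 * k * D ^ 2 * coord e i ^ 2 - 2 * M <= 0).
  { intros i Hi. set (nu := reflected e i).
    set (ei := coord e i).
    assert (Hei : Rabs ei <= 1).
    { pose proof (coord_le_nrm e i) as K. replace (nrm e) with 1 in K; auto.
      symmetry. apply nrm_eq_iff; lra. }
    apply Rabs_le_between in Hei.
    set (dl := Rmin (Rmin (s / 2) ((r0 - s) / 2)) (1 - dist x x0)).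
    assert (Hdl : 0 < dl) by (unfold dl; repeat apply Rmin_glb_lt; lra).
    assert (Hdl1 : dl <= s / 2) by (unfold dl; eapply Rle_trans; [apply Rmin_l|apply Rmin_l]).
    assert (Hdl2 : dl <= (r0 - s) / 2) by (unfold dl; eapply Rle_trans; [apply Rmin_l|apply Rmin_r]).
    assert (Hdl3 : dl <= 1 - dist x x0) by (unfold dl; apply Rmin_r).
    set (c := coord x i - coord x0 i).
    assert (Hpen : forall t, dist (vadd x (vscal t (basis i))) x0 ^ 2 = dist x x0 ^ 2 + 2 * t * c + t ^ 2).
    { intros t. rewrite !dist_nrm, !nrm_sqr.
      replace (vsub (vadd x (vscal t (basis i))) x0) with (vadd (vsub x x0) (vscal t (basis i)))
        by (apply RN_ext; intros; rewrite ?coord_vadd, ?coord_vsub, ?coord_vadd; ring).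
      rewrite nsq_vadd_basis, coord_vsub by auto. reflexivity. }
    assert (Hpos : forall t, Rabs t < dl -> 0 < 1 + B * (s + 2 * t * ei)).
    { intros t Ht. apply Rabs_lt_between in Ht. assert (0 <= s + 2 * t * ei) by nra. nra. }
    replace (peval (pderiv i (pderiv i p)) x - peval (pdir nu (pdir nu p)) y + 4 * k * D ^ 2 * ei ^ 2 - 2 * M)
      with (peval (pderiv i (pderiv i p)) x - peval (pdir nu (pdir nu p)) y - (- k * D ^ 2 * (2 * ei)) * (2 * ei) - M * 2)
      by ring.
    apply (max_second_deriv
      (fun t => peval p (vadd x (vscal t (basis i))) - peval p (vadd y (vscal t nu))
         - logw k B (s + 2 * t * ei) - M * (dist x x0 ^ 2 + 2 * t * c + t ^ 2))
      (fun t => peval (pderiv i p) (vadd x (vscal t (basis i))) - peval (pdir nu p) (vadd y (vscal t nu))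
         - B / k / (1 + B * (s + 2 * t * ei)) * (2 * ei) - M * (2 * c + 2 * t)) _ dl); auto.
    - intros t Ht. specialize (Hpos t Ht).
      apply (is_derive_minus (V := R_NormedModule)); [apply (is_derive_minus (V := R_NormedModule)); [apply (is_derive_minus (V := R_NormedModule))|]|].
      + apply peval_basis_deriv; auto.
      + pose proof (peval_line_deriv p y nu t) as K. rewrite <- peval_pdir in K. exact K.
      + pose proof (is_derive_comp (logw k B) (fun t => s + 2 * t * ei) t _ (2 * ei) (logw_deriv k B _ Hk HB Hpos)) as K.
        replace (B / k / (1 + B * (s + 2 * t * ei)) * (2 * ei)) with (scal (2 * ei) (B / k / (1 + B * (s + 2 * t * ei)))).
        * apply K. auto_derive; auto; ring.
        * unfold scal; simpl; unfold mult; simpl; ring.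
      + auto_derive; auto; ring.
    - apply (is_derive_minus (V := R_NormedModule)); [apply (is_derive_minus (V := R_NormedModule)); [apply (is_derive_minus (V := R_NormedModule))|]|].
      + pose proof (peval_basis_deriv (pderiv i p) x i 0 Hi) as K. rewrite vscal_0, vadd_vzero in K. exact K.
      + pose proof (peval_line_deriv (pdir nu p) y nu 0) as K. rewrite <- peval_pdir in K.
        rewrite vscal_0, vadd_vzero in K. exact K.
      + assert (H0 : 0 < 1 + B * s) by nra.
        auto_derive; [nra|]. unfold D. replace (s + 2 * 0 * ei) with s by ring. field. lra.
      + auto_derive; auto; ring.
    - intros t Ht.
      assert (Ht2 : Rabs t < s / 2) by lra.
      pose proof (dist_reflect x y i t Hi (proj1 Hs) Ht2) as Ed. cbv zeta in Ed. fold s e nu ei in Ed.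
      assert (Hx' : dist (vadd x (vscal t (basis i))) x0 <= 1).
      { eapply Rle_trans; [apply (dist_tri _ x)|]. rewrite dist_vadd, nrm_vscal, nrm_basis by auto. lra. }
      assert (Hy' : dist (vadd x (vscal t (basis i))) (vadd y (vscal t nu)) <= r0).
      { rewrite Ed. apply Rabs_lt_between in Ht. nra. }
      specialize (Hmax _ _ Hx' Hy'). rewrite Ed, Hpen in Hmax.
      rewrite !vscal_0, !vadd_vzero.
      replace (s + 2 * 0 * ei) with s by ring. replace (dist x x0 ^ 2 + 2 * 0 * c + 0 ^ 2) with (dist x x0 ^ 2) by ring.
      exact Hmax. }
  assert (S0 : sumN N (fun i => peval (pderiv i (pderiv i p)) x - peval (pdir (reflected e i) (pdir (reflected e i) p)) y
    + 4 * k * D ^ 2 * coord e i ^ 2 - 2 * M) <= 0).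
  { rewrite <- (Rmult_0_r (INR N)), <- sumN_const. apply sumN_le. auto. }
  rewrite sumN_minus, sumN_plus, sumN_minus, sumN_scal, sumN_const, reflect_trace in S0 by auto.
  fold (lap p x) (nsq e) in S0. rewrite He in S0. lra.
Qed.
End Lipschitz.

Section LocalLipschitz.
Context {N : nat}.
Hypothesis HN0 : (0 < N)%nat.
Implicit Types x y v : RN N.

(* Doubling of variables with the penalty [logw k B], whose second derivative is -k times the square
   of the first and absorbs the quadratic gradient term. *)
Lemma local_lipschitz m M a1 c1 : 0 < m -> 0 < M -> 0 <= a1 -> 0 <= c1 ->
  exists L, 0 <= L /\ forall rho r h p (C : RN N -> R), 0 < rho -> rho + 3 <= r -> 0 < h <= 1 ->
  (forall x, nrm x <= rho + 3 -> m <= peval p x <= M) ->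
  (forall x, nrm x <= rho + 3 -> 0 <= C x <= c1) ->
  (forall x, nrm x <= rho + 3 -> Rabs (- lap p x + C x * upwind h (ext r p) x) <= a1) ->
  forall x y, nrm x <= rho -> nrm y <= rho -> Rabs (peval p x - peval p y) <= L * dist x y.
Proof.
  intros Hm HM Ha1 Hc1. pose proof (pos_INR N) as HNR.
  (* 4 k - 1 = c1 N / m: of the 4 k D^2 gained in [doubling_hessian], the gradient term at y uses up
     all but D^2. *)
  set (k := (c1 * INR N / m + 1) / 4).
  assert (Hcm : 0 <= c1 * INR N / m) by (apply Rdiv_le_0_compat; nra).
  assert (Hk : / 4 <= k) by (unfold k; lra).
  set (Q := 2 * a1 + 2 * INR N * M + 2).
  assert (HQ : 2 <= Q) by (unfold Q; nra).
  (* With B r0 = exp (k M) the penalty at distance r0 is at least M, so a positive maximum has |x -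
     y| < r0. There 1 + B s <= 2 B r0, so the slope D of the penalty is at least 1 / (2 k r0) = Q,
     and D^2 > Q exceeds the remaining terms 2 a1 + 2 N M. *)
  set (r0 := / (2 * k * Q)).
  assert (HkQ : 1 <= 2 * k * Q) by nra.
  assert (Hr0 : 0 < r0 <= 1).
  { unfold r0. split; [apply Rinv_0_lt_compat; lra|]. rewrite <- Rinv_1. apply Rinv_le_contravar; lra. }
  set (B := exp (k * M) / r0).
  assert (Hexp : 1 <= exp (k * M)).
  { pose proof (exp_ineq1_le (k * M)). nra. }
  assert (HB : 0 < B) by (apply Rdiv_lt_0_compat; lra).
  assert (HBr : B * r0 = exp (k * M)) by (unfold B; field; lra).
  assert (HL1 : 0 < B / k) by (apply Rdiv_lt_0_compat; lra).
  assert (HL2 : 0 < M / r0) by (apply Rdiv_lt_0_compat; lra).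
  exists (B / k + M / r0). split; [lra|].
  intros rho r h p C Hrho Hr Hh Hp HC Hres.
  assert (Hpsi0 : M <= logw k B r0).
  { unfold logw. rewrite HBr. apply Rmult_le_reg_l with k; [lra|].
    rewrite <- Rmult_assoc, Rinv_r, Rmult_1_l by lra. rewrite <- (ln_exp (k * M)) at 1.
    left. apply ln_increasing; lra. }
  assert (Main : forall x0 y0, nrm x0 <= rho -> dist x0 y0 <= r0 ->
    peval p x0 - peval p y0 <= logw k B (dist x0 y0)).
  { intros x0 y0 Hx0 Hxy0.
    destruct (Rle_or_lt (peval p x0 - peval p y0) (logw k B (dist x0 y0))) as [|Hbad]; auto. exfalso.
    destruct (doubling_max p k B M x0 r0 ltac:(lra) HB ltac:(lra)) as [x [y [Hx [Hxy Hmax]]]].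
    assert (Hth : 0 < peval p x - peval p y - logw k B (dist x y) - M * dist x x0 ^ 2).
    { specialize (Hmax x0 y0). rewrite dist_self in Hmax. specialize (Hmax ltac:(lra) Hxy0). lra. }
    set (s := dist x y) in *.
    assert (Hs0 : 0 <= s) by apply dist_nonneg.
    pose proof (dist_nonneg x x0) as Hd0.
    assert (Nx : nrm x <= rho + 1) by (pose proof (nrm_dist x x0); lra).
    assert (Ny : nrm y <= rho + 2).
    { pose proof (nrm_dist y x). rewrite dist_sym in H. fold s in H. lra. }
    pose proof (Hp x ltac:(lra)) as Px. pose proof (Hp y ltac:(lra)) as Py.
    assert (Hpsis : 0 <= logw k B s).
    { rewrite <- (logw_0 k B). apply logw_incr; lra. }
    assert (Hpen : 0 <= M * dist x x0 ^ 2) by (apply Rmult_le_pos; [lra|apply pow2_ge_0]).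
    assert (Hx1 : dist x x0 < 1).
    { destruct (Rle_lt_or_eq_dec _ _ Hx) as [|E]; auto. rewrite E in Hth. lra. }
    assert (Hs1 : s < r0).
    { destruct (Rle_lt_or_eq_dec _ _ Hxy) as [|E]; auto. rewrite E in Hth. lra. }
    assert (Hs2 : 0 < s).
    { destruct (Rle_lt_or_eq_dec _ _ Hs0) as [|E]; auto. exfalso.
      assert (Exy : x = y) by (apply dist_eq0; fold s; lra). rewrite Exy in Hth. rewrite Exy in Hpen. lra. }
    pose proof (doubling_hessian HN0 p k B M x0 r0 x y ltac:(lra) HB Hx1 (conj Hs2 Hs1) Hmax) as Hess.
    fold s in Hess. set (D := B / k / (1 + B * s)) in *.
    assert (Hden : 0 < 1 + B * s) by nra.
    assert (HD0 : 0 < D) by (unfold D; apply Rdiv_lt_0_compat; auto).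
    assert (HDQ : Q <= D).
    { assert (1 + B * s <= 2 * (B * r0)) by nra.
      unfold D. apply Rmult_le_reg_r with (1 + B * s); auto.
      replace (B / k / (1 + B * s) * (1 + B * s)) with (B / k) by (field; lra).
      apply Rle_trans with (Q * (2 * (B * r0))); [apply Rmult_le_compat_l; lra|].
      right. unfold r0. field. split; lra. }
    (* Maximality in the second variable bounds the drop of p from y to a neighbour by h D, and the
       upwind quotient sees only drops. If the neighbour is farther than r0 from x, the penalty
       exceeds M and positivity of the maximum gives the same bound. At x only the sign of the
       gradient term matters. *)
    assert (Hup : upwind h (ext r p) y <= INR N * (D ^ 2 / m)).
    { assert (Hh2 : 0 < h ^ 2) by (apply pow_lt; lra).
      unfold upwind. apply Rmult_le_reg_r with (h ^ 2); auto.
      unfold Rdiv at 1. rewrite Rmult_assoc, Rinv_l, Rmult_1_r by lra.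
      rewrite Rmult_assoc, <- sumN_const. apply sumN_le. intros i Hi.
      assert (Nb : forall t, t = h \/ t = - h ->
        ext r p y - ext r p (vadd y (vscal t (basis i))) <= h * D).
      { intros t Ht. set (y' := vadd y (vscal t (basis i))).
        assert (Hdy : dist y' y = h).
        { unfold y'. rewrite dist_vadd, nrm_vscal, nrm_basis, Rmult_1_r by auto.
          destruct Ht; subst t; [|rewrite Rabs_Ropp]; apply Rabs_pos_eq; lra. }
        assert (Ny' : nrm y' <= rho + 3) by (pose proof (nrm_dist y' y); lra).
        rewrite !ext_in by lra. pose proof (Hp y' Ny') as Py'.
        pose proof (logw_concave k B s h ltac:(lra) HB Hs0 ltac:(lra)) as Cv. fold D in Cv.
        assert (Hxy' : dist x y' <= s + h).
        { eapply Rle_trans; [apply (dist_tri x y y')|]. rewrite (dist_sym y), Hdy. fold s. lra. }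
        destruct (Rle_or_lt (dist x y') r0) as [Hin|Hout].
        - specialize (Hmax x y' Hx Hin).
          pose proof (logw_incr k B (dist x y') (s + h) ltac:(lra) HB (conj (dist_nonneg _ _) Hxy')). lra.
        - pose proof (logw_incr k B r0 (s + h) ltac:(lra) HB ltac:(lra)). lra. }
      assert (HX : 0 <= Rmax 0 (ext r p y - low_nbr h (ext r p) i y) <= h * D).
      { split; [apply Rmax_l|]. apply Rmax_lub; [apply Rmult_le_pos; lra|].
        unfold low_nbr, Rmin. destruct Rle_dec; apply Nb; auto. }
      assert (Ey : ext r p y = peval p y) by (apply ext_in; lra).
      apply Rle_trans with ((h * D) ^ 2 / m).
      - unfold Rdiv. apply Rmult_le_compat; [apply pow2_ge_0|left; apply Rinv_0_lt_compat; lra|apply pow_incr; auto|].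
        apply Rinv_le_contravar; lra.
      - right. field. lra. }
    pose proof (HC x ltac:(lra)) as Cx. pose proof (HC y ltac:(lra)) as Cy.
    pose proof (Hres x ltac:(lra)) as Rx. pose proof (Hres y ltac:(lra)) as Ry.
    apply Rabs_le_between in Rx, Ry.
    assert (Hux : 0 <= C x * upwind h (ext r p) x).
    { apply Rmult_le_pos; [lra|]. apply upwind_nonneg; [lra|]. rewrite ext_in by lra. lra. }
    assert (Huy : C y * upwind h (ext r p) y <= c1 * (INR N * (D ^ 2 / m))).
    { apply Rmult_le_compat; try lra. apply upwind_nonneg; [lra|]. rewrite ext_in by lra. lra. }
    replace (c1 * (INR N * (D ^ 2 / m))) with ((4 * k - 1) * D ^ 2) in Huy by (unfold k; field; lra).
    assert (HDD : Q < D ^ 2) by nra. unfold Q in HDD. lra. }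
  assert (One : forall x y, nrm x <= rho -> nrm y <= rho ->
    peval p x - peval p y <= (B / k + M / r0) * dist x y).
  { intros x y Hx Hy. pose proof (dist_nonneg x y).
    destruct (Rle_or_lt (dist x y) r0) as [Hle|Hgt].
    - eapply Rle_trans; [apply Main; auto|].
      pose proof (logw_concave k B 0 (dist x y) ltac:(lra) HB ltac:(lra) H) as Cv.
      rewrite logw_0, Rplus_0_l, Rmult_0_r, Rplus_0_r, Rdiv_1_r in Cv. nra.
    - pose proof (Hp x ltac:(lra)). pose proof (Hp y ltac:(lra)).
      apply Rle_trans with (M / r0 * dist x y); [|nra].
      apply Rle_trans with (M / r0 * r0); [|nra].
      replace (M / r0 * r0) with M by (field; lra). lra. }
  intros x y Hx Hy. apply Rabs_le. split; [|apply One; auto].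
  pose proof (One y x Hy Hx). rewrite dist_sym in H. lra.
Qed.
End LocalLipschitz.

(** * The radial supersolution *)

Lemma nonincreasing_of_deriv (f f' : R -> R) a b : a <= b ->
  (forall t, a <= t <= b -> is_derive f t (f' t)) -> (forall t, a <= t <= b -> f' t <= 0) -> f b <= f a.
Proof.
  intros Hab Hf Hneg. destruct (MVT_gen f a b f') as [c [Hc E]].
  - intros x Hx. rewrite Rmin_left, Rmax_right in Hx by lra. apply Hf; lra.
  - intros x Hx. rewrite Rmin_left, Rmax_right in Hx by lra.
    apply derivable_continuous_pt. exists (f' x). apply is_derive_Reals, Hf; lra.
  - rewrite Rmin_left, Rmax_right in Hc by lra. specialize (Hneg c Hc). nra.
Qed.

Section Radial.
Variables (g : R -> R) (n : nat) (L : R).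
Hypothesis Hg : forall t, continuous g t.
Hypothesis Hgpos : forall t, 0 < g t.

(** The dimension is written n + 3, so that the exponents N - 1 = n + 2 and N - 2 = S n are natural
    numbers. L plays the role of the integral of t g over the half-line, and L - [moment] r that of
    its tail. *)
Definition mass (r : R) : R := RInt (fun t => t ^ (n + 2) * g t) 0 r.
Definition moment (r : R) : R := RInt (fun t => t * g t) 0 r.

Hypothesis HL1 : forall r, 0 <= r -> moment r <= L.
Hypothesis HL2 : forall eps, 0 < eps -> exists T, forall r, T <= r -> L - eps <= moment r.

(* The decaying solution of -Lap U = g(|x|) in dimension n + 3. *)
Definition radU (r : R) : R := / INR (S n) * (mass r / r ^ S n + (L - moment r)).

Lemma cont_mass t : continuous (fun t => t ^ (n + 2) * g t) t.
Proof.
  apply (continuous_mult (K := R_AbsRing)); auto.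
  apply continuity_pt_filterlim, derivable_continuous_pt, derivable_pt_pow.
Qed.

Lemma cont_moment t : continuous (fun t => t * g t) t.
Proof. apply (continuous_mult (K := R_AbsRing)); auto. apply continuous_id. Qed.

Lemma ex_mass a b : ex_RInt (fun t => t ^ (n + 2) * g t) a b.
Proof. apply (ex_RInt_continuous (V := R_CompleteNormedModule)). intros; apply cont_mass. Qed.

Lemma ex_moment a b : ex_RInt (fun t => t * g t) a b.
Proof. apply (ex_RInt_continuous (V := R_CompleteNormedModule)). intros; apply cont_moment. Qed.

Lemma mass_deriv r : is_derive mass r (r ^ (n + 2) * g r).
Proof.
  apply (is_derive_RInt (V := R_CompleteNormedModule) (fun t => t ^ (n + 2) * g t) mass 0 r).
  - exists (mkposreal 1 Rlt_0_1). intros y _. apply (RInt_correct (V := R_CompleteNormedModule)), ex_mass.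
  - apply cont_mass.
Qed.

Lemma moment_deriv r : is_derive moment r (r * g r).
Proof.
  apply (is_derive_RInt (V := R_CompleteNormedModule) (fun t => t * g t) moment 0 r).
  - exists (mkposreal 1 Rlt_0_1). intros y _. apply (RInt_correct (V := R_CompleteNormedModule)), ex_moment.
  - apply cont_moment.
Qed.

Lemma mass_0 : mass 0 = 0.
Proof. unfold mass. apply (RInt_point (V := R_CompleteNormedModule)). Qed.

Lemma moment_0 : moment 0 = 0.
Proof. unfold moment. apply (RInt_point (V := R_CompleteNormedModule)). Qed.

Lemma mass_pos r : 0 < r -> 0 < mass r.
Proof.
  intros Hr. apply RInt_gt_0; auto.
  - intros t Ht. apply Rmult_lt_0_compat; auto. apply pow_lt; lra.
  - intros; apply cont_mass.
Qed.

Lemma mass_nonneg r : 0 <= r -> 0 <= mass r.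
Proof. intros [Hr|<-]; [left; apply mass_pos; auto|rewrite mass_0; lra]. Qed.

Lemma mass_diff_le a b : 0 <= a <= b -> mass b - mass a <= b ^ S n * (moment b - moment a).
Proof.
  intros Hab.
  assert (H : mass b - b ^ S n * moment b <= mass a - b ^ S n * moment a).
  { apply (nonincreasing_of_deriv (fun t => mass t - b ^ S n * moment t)
      (fun t => t ^ (n + 2) * g t - b ^ S n * (t * g t))); [lra| |].
    - intros t Ht. apply (is_derive_minus (V := R_NormedModule)); [apply mass_deriv|].
      apply is_derive_scal, moment_deriv.
    - intros t Ht. replace (n + 2)%nat with (S (S n)) by lia.
      replace (t ^ S (S n) * g t - b ^ S n * (t * g t)) with ((t ^ S n - b ^ S n) * (t * g t)) by (simpl; ring).
      pose proof (Hgpos t). assert (t ^ S n <= b ^ S n) by (apply pow_incr; lra).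
      assert (0 <= t * g t) by (apply Rmult_le_pos; lra). nra. }
  lra.
Qed.

Lemma moment_incr a b : 0 <= a <= b -> moment a <= moment b.
Proof.
  intros Hab.
  assert (- moment b <= - moment a); [|lra].
  apply (nonincreasing_of_deriv (fun t => - moment t) (fun t => - (t * g t))); [lra| |].
  - intros t Ht. apply (is_derive_opp (V := R_NormedModule)), moment_deriv.
  - intros t Ht. pose proof (Hgpos t). nra.
Qed.

Lemma INR_S_pos : 0 < INR (S n).
Proof. apply lt_0_INR; lia. Qed.

Lemma radU_pos r : 0 < r -> 0 < radU r.
Proof.
  intros Hr. pose proof INR_S_pos. unfold radU. apply Rmult_lt_0_compat; [apply Rinv_0_lt_compat; auto|].
  pose proof (HL1 r ltac:(lra)).
  assert (0 < mass r / r ^ S n) by (apply Rdiv_lt_0_compat; [apply mass_pos|apply pow_lt]; auto). lra.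
Qed.

Lemma mass_ratio r : 0 < r -> 0 <= mass r / r ^ S n <= moment r.
Proof.
  intros Hr. pose proof (pow_lt r (S n) Hr). split.
  - apply Rdiv_le_0_compat; auto. apply mass_nonneg; lra.
  - pose proof (mass_diff_le 0 r ltac:(lra)) as H1. rewrite mass_0, moment_0, !Rminus_0_r in H1.
    apply Rmult_le_reg_r with (r ^ S n); auto.
    replace (mass r / r ^ S n * r ^ S n) with (mass r) by (field; lra). lra.
Qed.

(** The quotient 0 / 0 has value 0, which is also the limit of mass r / r^(N-2) at 0 by
    [mass_ratio]; the formula is therefore right at the origin. *)
Lemma radU_0 : radU 0 = / INR (S n) * L.
Proof. unfold radU. rewrite mass_0, moment_0. unfold Rdiv. rewrite Rmult_0_l. f_equal. ring. Qed.

Lemma radU_le_0 r : 0 <= r -> radU r <= radU 0.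
Proof.
  intros [Hr|<-]; [|lra]. rewrite radU_0. unfold radU. pose proof INR_S_pos.
  apply Rmult_le_compat_l; [left; apply Rinv_0_lt_compat; auto|].
  pose proof (mass_ratio r Hr). lra.
Qed.

Lemma radU_deriv r : 0 < r -> is_derive radU r (- (mass r / r ^ (n + 2))).
Proof.
  intros Hr. pose proof INR_S_pos. pose proof (pow_lt r n Hr) as Hp.
  unfold radU.
  replace (- (mass r / r ^ (n + 2))) with
    (/ INR (S n) * (((r ^ (n + 2) * g r) * r ^ S n - mass r * (INR (S n) * r ^ n)) / (r ^ S n) ^ 2 + (0 - r * g r))).
  - apply (is_derive_scal (fun r => mass r / r ^ S n + (L - moment r))).
    apply (is_derive_plus (V := R_NormedModule)).
    + apply is_derive_div; [apply mass_deriv| |apply pow_nonzero; lra].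
      apply is_derive_Reals. apply (derivable_pt_lim_pow r (S n)).
    + apply (is_derive_minus (V := R_NormedModule)); [apply (is_derive_const (V := R_NormedModule))|apply moment_deriv].
  - replace (n + 2)%nat with (S (S n)) by lia. simpl pow. field. repeat split; lra.
Qed.

Lemma ratio_deriv r : 0 < r -> is_derive (fun r => mass r / r ^ (n + 3)) r
  ((g r - INR (n + 3) * (mass r / r ^ (n + 3))) / r).
Proof.
  intros Hr. pose proof (pow_lt r n Hr) as Hp.
  replace ((g r - INR (n + 3) * (mass r / r ^ (n + 3))) / r) with
    (((r ^ (n + 2) * g r) * r ^ (n + 3) - mass r * (INR (n + 3) * r ^ (n + 2))) / (r ^ (n + 3)) ^ 2).
  - apply is_derive_div; [apply mass_deriv| |apply pow_nonzero; lra].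
    apply is_derive_Reals. pose proof (derivable_pt_lim_pow r (n + 3)) as K.
    replace (Nat.pred (n + 3)) with (n + 2)%nat in K by lia. exact K.
  - replace (n + 2)%nat with (S (S n)) by lia. replace (n + 3)%nat with (S (S (S n))) by lia. simpl pow. field. lra.
Qed.

Lemma radU_cont_abs r : continuity_pt (fun t => radU (Rabs t)) r.
Proof.
  destruct (Req_dec r 0) as [->|Hr].
  - intros e He.
    assert (Hc : continuity_pt moment 0).
    { apply derivable_continuous_pt. eexists. apply is_derive_Reals, moment_deriv. }
    pose proof INR_S_pos as HS.
    destruct (Hc (e * INR (S n)) ltac:(nra)) as [d [Hd H]].
    exists d. split; auto. intros x [_ Hx]. simpl in Hx |- *. unfold Rdist in Hx |- *.
    rewrite Rminus_0_r in Hx. rewrite Rabs_R0.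
    destruct (Req_dec x 0) as [->|Hx0]; [rewrite Rabs_R0, Rminus_diag, Rabs_R0; auto|].
    assert (Hxp : 0 < Rabs x) by (apply Rabs_pos_lt; auto).
    assert (K : Rabs (moment (Rabs x)) < e * INR (S n)).
    { rewrite <- (Rminus_0_r (moment (Rabs x))), <- moment_0 at 1. apply H.
      split; [split; [exact I|lra]|]. simpl. unfold Rdist. rewrite Rminus_0_r, Rabs_Rabsolu; auto. }
    pose proof (radU_le_0 (Rabs x) ltac:(lra)) as H1.
    rewrite Rabs_minus_sym, Rabs_pos_eq by lra.
    rewrite radU_0. unfold radU. pose proof (mass_ratio (Rabs x) Hxp).
    apply Rabs_lt_between in K.
    replace (/ INR (S n) * L - / INR (S n) * (mass (Rabs x) / Rabs x ^ S n + (L - moment (Rabs x))))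
      with (/ INR (S n) * (moment (Rabs x) - mass (Rabs x) / Rabs x ^ S n)) by ring.
    set (X := moment (Rabs x) - mass (Rabs x) / Rabs x ^ S n).
    replace e with (/ INR (S n) * (e * INR (S n))) by (field; lra).
    apply Rmult_lt_compat_l; [apply Rinv_0_lt_compat; auto|unfold X; lra].
  - apply (continuity_pt_comp Rabs radU); [apply Rcontinuity_abs|].
    apply derivable_continuous_pt. eexists. apply is_derive_Reals, radU_deriv, Rabs_pos_lt; auto.
Qed.

(** The mass is split at T1: the part within T1 is divided by r^(N-2) >= r, and the part beyond is
    controlled by the tail of the moment through [mass_diff_le]. *)
Lemma radU_tends0 eps : 0 < eps -> exists T, 0 < T /\ forall r, T <= r -> radU r < eps.
Proof.
  intros He. pose proof INR_S_pos as HS.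
  destruct (HL2 (eps * INR (S n) / 4) ltac:(apply Rdiv_lt_0_compat; nra)) as [T HT].
  set (T1 := Rmax T 1).
  assert (HT1 : 1 <= T1) by apply Rmax_r. assert (HT2 : T <= T1) by apply Rmax_l.
  pose proof (mass_nonneg T1 ltac:(lra)) as Hm.
  exists (T1 + 4 * mass T1 / (eps * INR (S n))).
  assert (0 <= 4 * mass T1 / (eps * INR (S n))) by (apply Rdiv_le_0_compat; nra).
  split; [lra|]. intros r Hr.
  assert (Hr1 : 1 <= r) by lra.
  pose proof (mass_diff_le T1 r ltac:(lra)) as Hd.
  pose proof (HL1 r ltac:(lra)). pose proof (HT T1 HT2). pose proof (HT r ltac:(lra)).
  assert (Hp : 0 < r ^ S n) by (apply pow_lt; lra).
  assert (Hpr : r <= r ^ S n).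
  { simpl. assert (1 <= r ^ n) by (apply pow_R1_Rle; auto). nra. }
  assert (M1 : mass r / r ^ S n <= mass T1 / r ^ S n + (moment r - moment T1)).
  { apply Rmult_le_reg_r with (r ^ S n); auto.
    replace (mass r / r ^ S n * r ^ S n) with (mass r) by (field; lra).
    replace ((mass T1 / r ^ S n + (moment r - moment T1)) * r ^ S n)
      with (mass T1 + r ^ S n * (moment r - moment T1)) by (field; lra). lra. }
  assert (M2 : mass T1 / r ^ S n <= eps * INR (S n) / 4).
  { apply Rmult_le_reg_r with (r ^ S n); auto.
    replace (mass T1 / r ^ S n * r ^ S n) with (mass T1) by (field; lra).
    replace (mass T1) with (eps * INR (S n) / 4 * (4 * mass T1 / (eps * INR (S n)))) by (field; split; lra).
    apply Rmult_le_compat_l; [apply Rdiv_le_0_compat; nra|]. lra. }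
  unfold radU. apply Rmult_lt_reg_l with (INR (S n)); auto.
  rewrite <- Rmult_assoc, Rinv_r, Rmult_1_l by lra. nra.
Qed.

Lemma Rpower_deriv y t : 0 < t -> is_derive (fun s => Rpower s y) t (y * Rpower t (y - 1)).
Proof. intros. apply is_derive_Reals, derivable_pt_lim_power; auto. Qed.

(** Derivatives are compared with powers: mu < N makes the mass grow at most like r^(N - mu), into
    which the constant mass T is absorbed, and mu > 2 makes the tail of the moment decay like r^(2 -
    mu). *)
Lemma radU_decay mu K T : 2 < mu < INR (n + 3) -> 0 <= K -> 1 <= T ->
  (forall t, T <= t -> g t <= K * Rpower t (- mu)) ->
  exists C, forall r, T <= r -> radU r <= C * Rpower r (2 - mu).
Proof.
  intros Hmu HK HT Hd. pose proof INR_S_pos as HS.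
  set (nu := INR (n + 3)) in *.
  assert (Enu : INR (n + 2) = nu - 1) by (unfold nu; rewrite !plus_INR; simpl; ring).
  assert (EnS : INR (S n) = nu - 2) by (unfold nu; rewrite S_INR, plus_INR; simpl; ring).
  exists (/ INR (S n) * (mass T + K / (nu - mu) + K / (mu - 2))). intros r Hr.
  assert (Hp : 0 < r ^ S n) by (apply pow_lt; lra).
  assert (M : mass r - K / (nu - mu) * Rpower r (nu - mu) <= mass T - K / (nu - mu) * Rpower T (nu - mu)).
  { apply (nonincreasing_of_deriv (fun t => mass t - K / (nu - mu) * Rpower t (nu - mu))
      (fun t => t ^ (n + 2) * g t - K / (nu - mu) * ((nu - mu) * Rpower t (nu - mu - 1)))); auto.
    - intros t Ht. apply (is_derive_minus (V := R_NormedModule)); [apply mass_deriv|].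
      apply is_derive_scal, Rpower_deriv. lra.
    - intros t Ht. specialize (Hd t ltac:(lra)).
      replace (nu - mu - 1) with (INR (n + 2) + - mu) by (rewrite Enu; ring).
      rewrite Rpower_plus, Rpower_pow by lra.
      replace (K / (nu - mu) * ((nu - mu) * (t ^ (n + 2) * Rpower t (- mu))))
        with (t ^ (n + 2) * (K * Rpower t (- mu))) by (field; lra).
      assert (0 < t ^ (n + 2)) by (apply pow_lt; lra). nra. }
  assert (Mo : forall b, r <= b -> moment b <= moment r + K / (mu - 2) * Rpower r (2 - mu)).
  { intros b Hb.
    assert (Q : moment b + K / (mu - 2) * Rpower b (2 - mu) <= moment r + K / (mu - 2) * Rpower r (2 - mu)).
    { apply (nonincreasing_of_deriv (fun t => moment t + K / (mu - 2) * Rpower t (2 - mu))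
        (fun t => t * g t + K / (mu - 2) * ((2 - mu) * Rpower t (2 - mu - 1)))); auto.
      - intros t Ht. apply (is_derive_plus (V := R_NormedModule)); [apply moment_deriv|].
        apply is_derive_scal, Rpower_deriv. lra.
      - intros t Ht. specialize (Hd t ltac:(lra)).
        replace (2 - mu - 1) with (1 + - mu) by ring. rewrite Rpower_plus, Rpower_1 by lra.
        replace (K / (mu - 2) * ((2 - mu) * (t * Rpower t (- mu)))) with (- (t * (K * Rpower t (- mu)))) by (field; lra).
        assert (t * g t <= t * (K * Rpower t (- mu))) by (apply Rmult_le_compat_l; lra). lra. }
    assert (0 <= K / (mu - 2) * Rpower b (2 - mu)).
    { apply Rmult_le_pos; [apply Rdiv_le_0_compat; lra|left; apply exp_pos]. }
    lra. }
  assert (ML : L - moment r <= K / (mu - 2) * Rpower r (2 - mu)).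
  { apply Rle_minus_l. rewrite Rplus_comm. apply le_epsilon. intros e He.
    destruct (HL2 e He) as [T2 HT2]. specialize (HT2 (Rmax T2 r) (Rmax_l _ _)).
    specialize (Mo (Rmax T2 r) (Rmax_r _ _)). lra. }
  assert (E1 : Rpower r (nu - mu) = Rpower r (2 - mu) * r ^ S n).
  { rewrite <- Rpower_pow, <- Rpower_plus by lra. f_equal. rewrite EnS. ring. }
  assert (Hone : 1 <= Rpower r (nu - mu)).
  { rewrite <- (Rpower_O r) by lra. apply Rle_Rpower; lra. }
  pose proof (mass_nonneg T ltac:(lra)) as HmT.
  assert (HK1 : 0 <= K / (nu - mu)) by (apply Rdiv_le_0_compat; lra).
  assert (HTp : 0 < Rpower T (nu - mu)) by apply exp_pos.
  unfold radU. rewrite Rmult_assoc. apply Rmult_le_compat_l; [left; apply Rinv_0_lt_compat; auto|].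
  assert (mass r / r ^ S n <= (mass T + K / (nu - mu)) * Rpower r (2 - mu)); [|lra].
  apply Rmult_le_reg_r with (r ^ S n); auto.
  replace (mass r / r ^ S n * r ^ S n) with (mass r) by (field; lra).
  rewrite Rmult_assoc, <- E1. nra.
Qed.
End Radial.

Lemma is_derive_comp_R (f h : R -> R) t df dh : is_derive f (h t) df -> is_derive h t dh ->
  is_derive (fun t => f (h t)) t (df * dh).
Proof.
  intros Hf Hh. pose proof (is_derive_comp f h t df dh Hf Hh) as K.
  replace (df * dh) with (scal dh df); auto. unfold scal; simpl; unfold mult; simpl; ring.
Qed.

(** * Comparison with the radial supersolution *)

Section RadialBarrier.
Variables (g : R -> R) (n : nat) (L : R).
Let N : nat := (n + 3)%nat.
Hypothesis Hg : forall t, continuous g t.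
Hypothesis Hgpos : forall t, 0 < g t.
Hypothesis HL1 : forall r, 0 <= r -> moment g r <= L.
Implicit Types x y v : RN N.

Lemma cusp_no_max (q : R -> R) d e r : 0 < e -> 0 < r -> is_derive q 0 d ->
  (forall t, Rabs t < r -> q t + e * Rabs t <= q 0) -> False.
Proof.
  intros He Hr Hd H. apply is_derive_Reals in Hd. destruct (Hd (e / 2) ltac:(lra)) as [dl Hdl].
  pose proof (cond_pos dl). set (t := Rmin (dl / 2) (r / 2)).
  assert (Ht : 0 < t) by (apply Rmin_glb_lt; lra).
  assert (Ht1 : t <= dl / 2) by apply Rmin_l. assert (Ht2 : t <= r / 2) by apply Rmin_r.
  assert (A1 : Rabs t = t) by (apply Rabs_pos_eq; lra).
  assert (A2 : Rabs (- t) = t) by (rewrite Rabs_Ropp; auto).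
  pose proof (Hdl t ltac:(lra) ltac:(lra)) as D1. pose proof (Hdl (- t) ltac:(lra) ltac:(lra)) as D2.
  rewrite Rplus_0_l in D1, D2. apply Rabs_lt_between in D1, D2.
  pose proof (H t ltac:(lra)) as H1. pose proof (H (- t) ltac:(lra)) as H2. rewrite A1 in H1. rewrite A2 in H2.
  assert ((q t - q 0) / t <= - e).
  { apply Rmult_le_reg_r with t; auto. replace ((q t - q 0) / t * t) with (q t - q 0) by (field; lra). lra. }
  assert (e <= (q (- t) - q 0) / (- t)).
  { apply Rmult_le_reg_r with t; auto.
    replace ((q (- t) - q 0) / (- t) * t) with (- (q (- t) - q 0)) by (field; lra). lra. }
  lra.
Qed.

Lemma radial_hessian p e r x : 0 < e -> nrm x < r -> x <> vzero ->
  (forall y, nrm y <= r -> peval p y - 2 * radU g n L (nrm y) + e * nrm y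
     <= peval p x - 2 * radU g n L (nrm x) + e * nrm x) ->
  lap p x + 2 * g (nrm x) <= 0.
Proof.
  intros He Hx Hx0 Hmax. set (s := nrm x) in *.
  assert (Hs : 0 < s).
  { destruct (nrm_nonneg x) as [|E]; auto. exfalso. apply Hx0, dist_eq0. rewrite dist_zero. auto. }
  (* E = - U'(r) / r, so the gradient of - 2 U(|x|) is 2 E(|x|) x, with divergence 2 (N E + r E') =
     2 g. This needs no second derivative of U beyond that of the quotient E. *)
  set (E := fun r => mass g n r / r ^ (n + 3)).
  set (E' := (g s - INR (n + 3) * E s) / s).
  assert (Hi : forall i, (i < N)%nat ->
    peval (pderiv i (pderiv i p)) x + ((2 * E' - e / s ^ 2) * (coord x i / s)) * coord x i + (2 * E s + e / s) <= 0).
  { intros i Hi. set (xi := coord x i).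
    set (sg := fun t => nsq x + 2 * t * xi + t ^ 2).
    assert (Esg : forall t, sqrt (sg t) = nrm (vadd x (vscal t (basis i)))).
    { intros t. unfold sg, xi. rewrite <- nsq_vadd_basis by auto. reflexivity. }
    set (dl := Rmin s (r - s)).
    assert (Hdl : 0 < dl) by (apply Rmin_glb_lt; lra).
    assert (Hdl1 : dl <= s) by apply Rmin_l. assert (Hdl2 : dl <= r - s) by apply Rmin_r.
    assert (Hsq : forall t, Rabs t < dl -> 0 < sqrt (sg t)).
    { intros t Ht. rewrite Esg. pose proof (nrm_dist x (vadd x (vscal t (basis i)))) as K.
      rewrite dist_sym, dist_vadd, nrm_vscal, nrm_basis in K by auto. fold s in K. lra. }
    assert (Hsg : forall t, Rabs t < dl -> 0 < sg t).
    { intros t Ht. destruct (Rle_or_lt (sg t) 0) as [K|K]; auto.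
      specialize (Hsq t Ht). rewrite sqrt_neg_0 in Hsq by auto. lra. }
    assert (Dsq : forall t, Rabs t < dl -> is_derive (fun t => sqrt (sg t)) t ((xi + t) / sqrt (sg t))).
    { intros t Ht. specialize (Hsg t Ht). specialize (Hsq t Ht). unfold sg in *.
      auto_derive; [lra|]. replace (t * (t * 1)) with (t ^ 2) by ring. field. lra. }
    assert (Hsg0 : sqrt (sg 0) = s).
    { rewrite Esg, vscal_0, vadd_vzero. reflexivity. }
    assert (R0 : Rabs 0 < dl) by (rewrite Rabs_R0; auto).
    apply (max_second_deriv
      (fun t => peval p (vadd x (vscal t (basis i))) - 2 * radU g n L (sqrt (sg t)) + e * sqrt (sg t))
      (fun t => peval (pderiv i p) (vadd x (vscal t (basis i))) + (2 * E (sqrt (sg t)) + e / sqrt (sg t)) * (xi + t))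
      _ dl); auto.
    - intros t Ht. pose proof (Hsq t Ht) as Hq. pose proof (Dsq t Ht) as Dq.
      replace (peval (pderiv i p) (vadd x (vscal t (basis i))) + (2 * E (sqrt (sg t)) + e / sqrt (sg t)) * (xi + t))
        with (peval (pderiv i p) (vadd x (vscal t (basis i)))
          - 2 * (- (mass g n (sqrt (sg t)) / sqrt (sg t) ^ (n + 2)) * ((xi + t) / sqrt (sg t)))
          + e * ((xi + t) / sqrt (sg t))).
      + apply (is_derive_plus (V := R_NormedModule)); [apply (is_derive_minus (V := R_NormedModule))|].
        * apply peval_basis_deriv; auto.
        * apply is_derive_scal. apply (is_derive_comp_R (radU g n L)); auto. apply radU_deriv; auto.
        * apply is_derive_scal; auto.
      + unfold E. replace (n + 3)%nat with (S (n + 2)) by lia. simpl pow. field.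
        split; [lra|]. apply pow_nonzero; lra.
    - assert (DE : is_derive (fun t => 2 * E (sqrt (sg t)) + e / sqrt (sg t)) 0 ((2 * E' - e / s ^ 2) * (xi / s))).
      { apply (is_derive_comp_R (fun r => 2 * E r + e / r) (fun t => sqrt (sg t))).
        - rewrite Hsg0. apply (is_derive_plus (V := R_NormedModule) (fun r => 2 * E r) (fun r => e / r) s (2 * E') (- (e / s ^ 2))).
          + apply is_derive_scal. unfold E', E. apply ratio_deriv; auto.
          + auto_derive; [lra|field; lra].
        - pose proof (Dsq 0 R0) as K. rewrite Hsg0, Rplus_0_r in K. exact K. }
      replace (peval (pderiv i (pderiv i p)) x + (2 * E' - e / s ^ 2) * (xi / s) * xi + (2 * E s + e / s))
        with (peval (pderiv i (pderiv i p)) x + ((2 * E' - e / s ^ 2) * (xi / s) * (xi + 0) + (2 * E s + e / s) * 1)) by ring.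
      apply (is_derive_plus (V := R_NormedModule)).
      + pose proof (peval_basis_deriv (pderiv i p) x i 0 Hi) as K. rewrite vscal_0, vadd_vzero in K. exact K.
      + replace (2 * E s + e / s) with (2 * E (sqrt (sg 0)) + e / sqrt (sg 0)) by (rewrite Hsg0; reflexivity).
        apply (is_derive_mult (K := R_AbsRing) (fun t => 2 * E (sqrt (sg t)) + e / sqrt (sg t)) (fun t => xi + t) 0 _ 1); auto.
        * auto_derive; auto; ring.
        * intros; apply Rmult_comm.
    - intros t Ht. rewrite Hsg0, vscal_0, vadd_vzero, Esg. apply Hmax.
      eapply Rle_trans; [apply nrm_vadd_basis; auto|]. fold s. lra. }
  assert (S0 : sumN N (fun i => peval (pderiv i (pderiv i p)) x
     + (2 * E' - e / s ^ 2) / s * coord x i ^ 2 + (2 * E s + e / s)) <= 0).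
  { rewrite <- (Rmult_0_r (INR N)), <- sumN_const. apply sumN_le. intros i Hj. specialize (Hi i Hj).
    replace ((2 * E' - e / s ^ 2) / s * coord x i ^ 2) with ((2 * E' - e / s ^ 2) * (coord x i / s) * coord x i) by (field; lra).
    exact Hi. }
  rewrite !sumN_plus, sumN_scal, !sumN_const in S0. fold (lap p x) (nsq x) in S0.
  rewrite <- nrm_sqr in S0. fold s in S0.
  replace ((2 * E' - e / s ^ 2) / s * s ^ 2) with (2 * (g s - INR N * E s) - e / s) in S0
    by (unfold E'; fold N; field; lra).
  assert (1 <= INR N) by (apply (le_INR 1); unfold N; lia).
  assert (0 < e / s) by (apply Rdiv_lt_0_compat; auto).
  assert (e / s <= INR N * (e / s)) by (rewrite <- (Rmult_1_l (e / s)) at 1; apply Rmult_le_compat_r; lra). lra.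
Qed.

(** U(|x|) is not known to be twice differentiable at the origin. The added term e |x| has a convex
    cusp there, which excludes a maximum, while elsewhere its Laplacian is nonnegative and does no
    harm. The value of e makes the compared function vanish on the sphere. *)
Lemma radial_barrier p r eta : 0 < r -> eta < 2 * radU g n L r ->
  (forall x, nrm x = r -> peval p x = eta) ->
  (forall x, nrm x <= r -> - lap p x < 2 * g (nrm x)) ->
  forall x, nrm x <= r -> peval p x <= 2 * radU g n L (nrm x).
Proof.
  intros Hr Heta Hb Hl.
  set (e := (2 * radU g n L r - eta) / r).
  assert (He : 0 < e) by (apply Rdiv_lt_0_compat; lra).
  destruct (evt (fun x : RN N => nrm x <= r) (fun x => peval p x - 2 * radU g n L (nrm x) + e * nrm x)) as [x [Hx Hmax]].
  - exists vzero. rewrite nrm_vzero. lra.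
  - intros xs Hxs. destruct (ball_compact xs r Hxs) as [x [Hx Hd]]. exists x. split; auto.
    assert (Ln : ulim (fun n => nrm (xs n)) (nrm x)).
    { apply (ulim_squeeze _ _ _ Hd). apply uf_all. intros k. apply Rabs_le.
      pose proof (nrm_dist (xs k) x). pose proof (nrm_dist x (xs k)). rewrite (dist_sym x) in H0. lra. }
    apply ulim_plus; [apply ulim_minus|apply ulim_scal; auto].
    + apply (ulim_uniform (peval p) xs x r); auto. apply poly_unif_cont.
    + apply ulim_scal.
      pose proof (ulim_cont (fun t => radU g n L (Rabs t)) _ _ (radU_cont_abs g n L Hg Hgpos (nrm x)) Ln) as K.
      cbv beta in K. rewrite (Rabs_pos_eq (nrm x)) in K by apply nrm_nonneg.
      apply (ulim_ext _ _ _ (fun k => f_equal (radU g n L) (Rabs_pos_eq _ (nrm_nonneg (xs k)))) K).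
  - intros y Hy. specialize (Hmax y Hy) as Hy'.
    assert (Hfin : peval p x - 2 * radU g n L (nrm x) + e * nrm x <= 0).
    { destruct (Rle_lt_or_eq_dec _ _ Hx) as [Hlt|E].
      - exfalso. destruct (classic (x = vzero)) as [->|Hx0].
        + assert (H0N : (0 < N)%nat) by (unfold N; lia).
          apply (cusp_no_max (fun t => peval p (vadd vzero (vscal t (basis 0)))) _ e r He Hr
            (peval_basis_deriv p vzero 0 0 H0N)).
          intros t Ht. rewrite vscal_0, vadd_vzero.
          assert (En : nrm (vadd (@vzero N) (vscal t (basis 0))) = Rabs t).
          { replace (vadd vzero (vscal t (basis 0))) with (vscal (N := N) t (basis 0))
              by (apply RN_ext; intros; rewrite coord_vadd, coord_vzero; ring).
            rewrite nrm_vscal, nrm_basis by auto. ring. }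
          specialize (Hmax (vadd vzero (vscal t (basis 0)))). rewrite En, nrm_vzero in Hmax.
          specialize (Hmax ltac:(lra)).
          pose proof (radU_le_0 g n L Hg Hgpos (Rabs t) (Rabs_pos t)). lra.
        + pose proof (radial_hessian p e r x He Hlt Hx0 Hmax). specialize (Hl x Hx). lra.
      - rewrite E, Hb by auto. unfold e. right. field. lra. }
    pose proof (nrm_nonneg y). assert (0 <= e * nrm y) by (apply Rmult_le_pos; lra). lra.
Qed.
End RadialBarrier.

(** * Pointwise Campanato estimates *)

Lemma mvt_bound (f f' : R -> R) B t : 0 <= t -> (forall s, is_derive f s (f' s)) ->
  (forall s, 0 <= s <= t -> Rabs (f' s) <= B) -> Rabs (f t - f 0) <= B * t.
Proof.
  intros Ht Hf HB. destruct (MVT_gen f 0 t f') as [c [Hc E]].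
  - intros; auto.
  - intros x _. apply derivable_continuous_pt. exists (f' x). apply is_derive_Reals; auto.
  - rewrite Rmin_left, Rmax_right in Hc by lra. rewrite E, Rminus_0_r, Rabs_mult, (Rabs_pos_eq t) by lra.
    apply Rmult_le_compat_r; auto.
Qed.

Definition taylor_sum (k : nat) (f : nat -> R) (t : R) : R :=
  sumN (S k) (fun m => f m * t ^ m / INR (fact m)).

Lemma taylor_sum_deriv k f t :
  is_derive (taylor_sum (S k) f) t (taylor_sum k (fun m => f (S m)) t).
Proof.
  unfold taylor_sum. induction k as [|k IH].
  - replace (sumN 1 (fun m => f (S m) * t ^ m / INR (fact m))) with (f 1%nat) by (simpl; field).
    apply (is_derive_ext (fun t => f 0%nat + f 1%nat * t)); [intros; simpl; field|].
    auto_derive; auto; ring.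
  - apply (is_derive_ext (fun t => sumN (S (S k)) (fun m => f m * t ^ m / INR (fact m))
      + f (S (S k)) * t ^ S (S k) / INR (fact (S (S k))))); [reflexivity|].
    change (sumN (S (S k)) (fun m => f (S m) * t ^ m / INR (fact m))) with
      (sumN (S k) (fun m => f (S m) * t ^ m / INR (fact m)) + f (S (S k)) * t ^ S k / INR (fact (S k))).
    apply (is_derive_plus (V := R_NormedModule)); [exact IH|].
    replace (f (S (S k)) * t ^ S k / INR (fact (S k))) with
      (f (S (S k)) / INR (fact (S (S k))) * (INR (S (S k)) * t ^ S k)).
    + apply (is_derive_ext (fun t => f (S (S k)) / INR (fact (S (S k))) * t ^ S (S k))).
      { intros s; match goal with |- @eq _ ?a ?b => change (@eq R a b) end; unfold Rdiv; ring. }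
      apply is_derive_scal, is_derive_Reals, (derivable_pt_lim_pow t (S (S k))).
    + rewrite (fact_simpl (S k)), mult_INR. field.
      split; [apply INR_fact_neq_0|apply not_0_INR; lia].
Qed.

Lemma taylor_sum_0 k f : taylor_sum k f 0 = f 0%nat.
Proof.
  unfold taylor_sum. induction k as [|k IH].
  - simpl. field.
  - change (sumN (S k) (fun m => f m * 0 ^ m / INR (fact m)) + f (S k) * 0 ^ S k / INR (fact (S k)) = f 0%nat).
    rewrite IH, pow_ne_zero by lia. unfold Rdiv. ring.
Qed.

(** The mean value bound applied to f minus its Taylor polynomial, by induction; the factorial gain
    in the remainder is given up. *)
Lemma taylor_bound k : forall (f : nat -> R -> R) B, 0 <= B -> (forall m t, is_derive (f m) t (f (S m) t)) ->
  (forall t, 0 <= t <= 1 -> Rabs (f (S k) t) <= B) ->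
  forall t, 0 <= t <= 1 -> Rabs (f 0%nat t - taylor_sum k (fun m => f m 0) t) <= B.
Proof.
  induction k as [|k IH]; intros f B HB Hf Hb t Ht.
  - unfold taylor_sum. simpl. replace (_ - _) with (f 0%nat t - f 0%nat 0) by field.
    apply Rle_trans with (B * t); [|nra].
    apply (mvt_bound _ (f 1%nat)); [lra|apply Hf|]. intros; apply Hb; lra.
  - pose proof (mvt_bound (fun t => f 0%nat t - taylor_sum (S k) (fun m => f m 0) t)
      (fun t => f 1%nat t - taylor_sum k (fun m => f (S m) 0) t) B t ltac:(lra)) as K.
    cbv beta in K. rewrite taylor_sum_0, Rminus_diag, Rminus_0_r in K.
    apply Rle_trans with (B * t); [|nra]. apply K.
    + intros s. apply (is_derive_minus (V := R_NormedModule)); [apply Hf|].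
      apply (taylor_sum_deriv k (fun m => f m 0)).
    + intros s Hs. apply (IH (fun m => f (S m)) B HB); auto. lra.
Qed.

Section Campanato.
Context {N : nat}.
Hypothesis HN0 : (0 < N)%nat.
Implicit Types x y v : RN N.

Lemma peval_pdirn_pminus m v p q x :
  peval (pdirn m v (pminus p q)) x = peval (pdirn m v p) x - peval (pdirn m v q) x.
Proof.
  revert x. induction m as [|m IH]; intros x; simpl pdirn; [apply peval_pminus|].
  rewrite !peval_pdir, <- sumN_minus. apply sumN_ext. intros i Hi.
  rewrite (pderiv_ext _ (pminus (pdirn m v p) (pdirn m v q)) i Hi).
  - simpl. ring.
  - intros y. rewrite peval_pminus. apply IH.
Qed.

Variables (k : nat) (q A M : R).
Hypotheses (Hq : / 2 < q < 1) (HA : 0 <= A) (HM : 0 <= M).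

(** Here q stands for 2^(-alpha). [campC1] bounds the change of an m-jet between consecutive scales,
    summed with 1 / (1 - q) since q < 1. [campX] bounds derivatives of order k + 1, which may grow
    like (2 q)^J, and needs q > 1/2. The last sum in [campC] makes it dominate the bound of
    [jet_bound] too. *)
Definition campC1 (m : nat) : R := dirC N m * (2 * A) * 2 ^ m.
Definition campX : R := M + A + 2 * A * 2 ^ S k / (2 * q - 1).
Definition campC : R :=
  A + dirC N (S k) * campX + sumN (S k) (fun m => campC1 m / (1 - q)) +
  sumN (S k) (fun m => dirC N m * (M + A) + campC1 m / (1 - q)).

Lemma campC1_nonneg m : 0 <= campC1 m.
Proof.
  unfold campC1. pose proof (dirC_nonneg (N := N) m) as H.
  apply Rmult_le_pos; [nra|]. left; apply pow_lt; lra.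
Qed.

Lemma campX_nonneg : 0 <= campX.
Proof.
  unfold campX. pose proof (pow_lt 2 (S k) ltac:(lra)).
  assert (0 <= 2 * A * 2 ^ S k / (2 * q - 1)) by (apply Rdiv_le_0_compat; nra). lra.
Qed.

Definition rad (j : nat) : R := (/ 2) ^ j.

Lemma rad_pos j : 0 < rad j.
Proof. apply pow_lt; lra. Qed.

Lemma rad_le_1 j : rad j <= 1.
Proof. unfold rad. rewrite <- (pow1 j). apply pow_incr; lra. Qed.

Lemma rad_S j : rad (S j) = rad j / 2.
Proof. unfold rad. simpl. field. Qed.

Lemma rad_decr i j : (i <= j)%nat -> rad j <= rad i.
Proof.
  induction 1 as [|j H IH]; [lra|]. rewrite rad_S. pose proof (rad_pos j). lra.
Qed.

Variables (g : RN N -> R) (hs : nat -> poly).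
Hypothesis Hharm : forall j, harmonic (N := N) (hs j).
Hypothesis Happrox : forall j x, nrm x <= rad j -> Rabs (g x - peval (hs j) x) <= A * (rad j ^ k * q ^ j).
Hypothesis HgM : forall x, nrm x <= 1 -> Rabs (g x) <= M.

Let djet (m : nat) v (j : nat) : R := peval (pdirn m v (hs j)) (@vzero N).

Lemma qj_pos j : 0 < q ^ j.
Proof. apply pow_lt; lra. Qed.

Lemma step_diff j x : nrm x <= rad (S j) ->
  Rabs (peval (pminus (hs (S j)) (hs j)) x) <= 2 * A * (rad j ^ k * q ^ j).
Proof.
  intros Hx. rewrite peval_pminus.
  pose proof (rad_decr j (S j) ltac:(lia)) as Hd.
  pose proof (Happrox j x ltac:(lra)) as H1. pose proof (Happrox (S j) x Hx) as H2.
  pose proof (rad_pos (S j)). pose proof (qj_pos j). pose proof (rad_pos j).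
  assert (rad (S j) ^ k * q ^ S j <= rad j ^ k * q ^ j).
  { apply Rmult_le_compat.
    - apply pow_le; lra.
    - left; apply qj_pos.
    - apply pow_incr; lra.
    - simpl. nra. }
  assert (A * (rad (S j) ^ k * q ^ S j) <= A * (rad j ^ k * q ^ j)) by (apply Rmult_le_compat_l; auto).
  replace (peval (hs (S j)) x - peval (hs j) x) with ((g x - peval (hs j) x) - (g x - peval (hs (S j)) x)) by ring.
  eapply Rle_trans; [apply Rabs_triang|]. rewrite Rabs_Ropp. lra.
Qed.

Lemma rad_pow_split m j : (m <= k)%nat -> rad j ^ k = rad j ^ m * rad j ^ (k - m).
Proof. intros. rewrite <- pow_add. f_equal. lia. Qed.

(** Consecutive approximants differ by a harmonic polynomial of size 2^(-jk) q^j on a ball of radius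
    comparable to 2^(-j). Each derivative at the centre costs a factor 2^j, and the result is
    summable in j up to order k. *)
Lemma djet_step m v j : (m <= k)%nat ->
  Rabs (djet m v (S j) - djet m v j) <= campC1 m * nrm v ^ m * (rad j ^ (k - m) * q ^ j).
Proof.
  intros Hm. unfold djet. rewrite <- peval_pdirn_pminus.
  pose proof (rad_pos (S j)) as HrS. pose proof (rad_pos j) as Hr.
  eapply Rle_trans; [apply (harmonic_pdirn_bound HN0 m (pminus (hs (S j)) (hs j)) vzero v (rad (S j))
    (2 * A * (rad j ^ k * q ^ j)))|]; auto.
  - apply harmonic_pminus; auto.
  - intros x Hx. rewrite dist_zero in Hx. apply step_diff; auto.
  - rewrite dist_zero, nrm_vzero. apply Rdiv_le_0_compat; [lra|apply pow_lt; lra].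
  - right. unfold campC1. rewrite (rad_pow_split m) by auto.
    rewrite rad_S. replace (nrm v / (rad j / 2)) with (nrm v * (2 * / rad j)) by (field; lra).
    rewrite !Rpow_mult_distr. rewrite pow_inv. field. apply pow_nonzero; lra.
Qed.

Lemma djet_far m v i n : (m <= k)%nat ->
  Rabs (djet m v (i + n) - djet m v i) <= campC1 m * nrm v ^ m * (rad i ^ (k - m) * q ^ i) * ((1 - q ^ n) / (1 - q)).
Proof.
  intros Hm. induction n as [|n IH].
  - rewrite Nat.add_0_r, Rminus_diag, Rabs_R0. simpl. right. field. lra.
  - rewrite Nat.add_succ_r.
    pose proof (djet_step m v (i + n) Hm) as H1.
    replace (djet m v (S (i + n)) - djet m v i) with
      ((djet m v (S (i + n)) - djet m v (i + n)) + (djet m v (i + n) - djet m v i)) by ring.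
    eapply Rle_trans; [apply Rabs_triang|].
    assert (H2 : rad (i + n) ^ (k - m) * q ^ (i + n) <= rad i ^ (k - m) * q ^ i * q ^ n).
    { rewrite pow_add, <- Rmult_assoc. apply Rmult_le_compat_r; [left; apply qj_pos|].
      apply Rmult_le_compat_r; [left; apply qj_pos|]. apply pow_incr.
      pose proof (rad_pos (i + n)). pose proof (rad_decr i (i + n) ltac:(lia)). lra. }
    assert (H3 : 0 <= campC1 m * nrm v ^ m).
    { apply Rmult_le_pos; [apply campC1_nonneg|apply pow_le, nrm_nonneg]. }
    set (c := campC1 m * nrm v ^ m) in *. set (b := rad i ^ (k - m) * q ^ i) in *.
    assert (c * (rad (i + n) ^ (k - m) * q ^ (i + n)) <= c * (b * q ^ n)) by (apply Rmult_le_compat_l; auto).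
    replace (c * b * ((1 - q ^ S n) / (1 - q))) with (c * (b * q ^ n) + c * b * ((1 - q ^ n) / (1 - q)))
      by (simpl; field; lra). lra.
Qed.

Lemma djet_cauchy m v i j : (m <= k)%nat -> (i <= j)%nat ->
  Rabs (djet m v j - djet m v i) <= campC1 m / (1 - q) * nrm v ^ m * (rad i ^ (k - m) * q ^ i).
Proof.
  intros Hm Hij. replace j with (i + (j - i))%nat by lia.
  eapply Rle_trans; [apply djet_far; auto|].
  assert (0 <= campC1 m * nrm v ^ m * (rad i ^ (k - m) * q ^ i)).
  { apply Rmult_le_pos; [apply Rmult_le_pos; [apply campC1_nonneg|apply pow_le, nrm_nonneg]|].
    apply Rmult_le_pos; [apply pow_le; left; apply rad_pos|left; apply qj_pos]. }
  replace (campC1 m / (1 - q) * nrm v ^ m * (rad i ^ (k - m) * q ^ i))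
    with (campC1 m * nrm v ^ m * (rad i ^ (k - m) * q ^ i) * (1 / (1 - q))) by (field; lra).
  apply Rmult_le_compat_l; auto. apply Rmult_le_compat_r; [left; apply Rinv_0_lt_compat; lra|].
  pose proof (qj_pos (j - i)). lra.
Qed.

Lemma h0_bound x : nrm x <= 1 -> Rabs (peval (hs 0) x) <= M + A.
Proof.
  intros Hx. pose proof (Happrox 0 x) as H. unfold rad in H. rewrite !pow_O, pow1, Rmult_1_r, Rmult_1_r in H.
  specialize (H Hx). specialize (HgM x Hx).
  replace (peval (hs 0) x) with (g x - (g x - peval (hs 0) x)) by ring.
  eapply Rle_trans; [apply Rabs_triang|]. rewrite Rabs_Ropp. lra.
Qed.

Lemma djet_0_bound m v : Rabs (djet m v 0) <= dirC N m * (M + A) * nrm v ^ m.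
Proof.
  unfold djet. replace (nrm v ^ m) with ((nrm v / 1) ^ m) by (f_equal; field).
  apply (harmonic_pdirn_bound HN0 m (hs 0) vzero v 1 (M + A)); auto; [lra| |].
  - intros x Hx. rewrite dist_zero in Hx. apply h0_bound; auto.
  - rewrite dist_zero, nrm_vzero. apply Rdiv_le_0_compat; [lra|apply pow_lt; lra].
Qed.

Lemma djet_bound m v j : (m <= k)%nat ->
  Rabs (djet m v j) <= (dirC N m * (M + A) + campC1 m / (1 - q)) * nrm v ^ m.
Proof.
  intros Hm. pose proof (djet_cauchy m v 0 j Hm ltac:(lia)) as H1. pose proof (djet_0_bound m v) as H2.
  unfold rad in H1. rewrite !pow_O, pow1, !Rmult_1_r in H1.
  replace (djet m v j) with ((djet m v j - djet m v 0) + djet m v 0) by ring.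
  eapply Rle_trans; [apply Rabs_triang|]. lra.
Qed.

Definition jet (m : nat) v : R := ulimit (djet m v).

Lemma jet_lim m v : (m <= k)%nat -> ulim (djet m v) (jet m v).
Proof. intros Hm. eapply ulimit_spec. apply uf_all. intros j. apply djet_bound; auto. Qed.

Lemma jet_close m v i : (m <= k)%nat ->
  Rabs (djet m v i - jet m v) <= campC1 m / (1 - q) * nrm v ^ m * (rad i ^ (k - m) * q ^ i).
Proof.
  intros Hm. pose proof (jet_lim m v Hm) as H.
  pose proof (ulim_cont Rabs _ _ (Rcontinuity_abs _) (ulim_minus _ _ _ _ H (ulim_const (djet m v i)))) as H1.
  rewrite Rabs_minus_sym. apply (ulim_le _ _ _ _ H1 (ulim_const _)).
  eapply uf_mono; [|apply (uf_cofin i)]. intros j Hj. apply djet_cauchy; auto.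
Qed.

Lemma jet_bound m v : (m <= k)%nat ->
  Rabs (jet m v) <= (dirC N m * (M + A) + campC1 m / (1 - q)) * nrm v ^ m.
Proof.
  intros Hm. pose proof (ulim_cont Rabs _ _ (Rcontinuity_abs _) (jet_lim m v Hm)) as H1.
  apply (ulim_le _ _ _ _ H1 (ulim_const _)). apply uf_all. intros j. apply djet_bound; auto.
Qed.

(** One order beyond k the increments no longer decay but grow like (2 q)^J, and their sum is
    dominated by its last terms. [campX] satisfies the resulting recursion, Y <= campX (2 q - 1). *)
Lemma top_growth v J : forall x, nrm x <= rad J / 2 ^ S k ->
  Rabs (peval (pdirn (S k) v (hs J)) x) <= dirC N (S k) * nrm v ^ S k * (campX * (2 * q) ^ J).
Proof.
  pose proof (pow_lt 2 (S k) ltac:(lra)) as H2k.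
  assert (Hc : 0 <= dirC N (S k) * nrm v ^ S k).
  { apply Rmult_le_pos; [apply dirC_nonneg|apply pow_le, nrm_nonneg]. }
  set (Y := 2 * A * 2 ^ S k).
  assert (HY : 0 <= Y / (2 * q - 1)) by (apply Rdiv_le_0_compat; unfold Y; nra).
  induction J as [|J IH]; intros x Hx.
  - eapply Rle_trans; [apply (harmonic_pdirn_bound HN0 (S k) (hs 0) vzero v 1 (M + A))|]; auto; [lra| | |].
    + intros y Hy. rewrite dist_zero in Hy. apply h0_bound; auto.
    + rewrite dist_zero. unfold rad in Hx. rewrite pow_O in Hx. exact Hx.
    + rewrite Rdiv_1_r, pow_O, Rmult_1_r. unfold campX. fold Y.
      replace (dirC N (S k) * (M + A) * nrm v ^ S k) with (dirC N (S k) * nrm v ^ S k * (M + A)) by ring.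
      apply Rmult_le_compat_l; auto. lra.
  - pose proof (rad_pos J) as HrJ. pose proof (rad_pos (S J)) as HrSJ. pose proof (qj_pos J) as HqJ.
    assert (Hx' : nrm x <= rad J / 2 ^ S k).
    { eapply Rle_trans; [apply Hx|]. apply Rmult_le_compat_r; [left; apply Rinv_0_lt_compat; auto|].
      apply rad_decr; lia. }
    specialize (IH x Hx').
    assert (HD : Rabs (peval (pdirn (S k) v (pminus (hs (S J)) (hs J))) x) <=
      dirC N (S k) * nrm v ^ S k * (Y * (2 * q) ^ J)).
    { eapply Rle_trans; [apply (harmonic_pdirn_bound HN0 (S k) (pminus (hs (S J)) (hs J)) vzero v (rad (S J))
        (2 * A * (rad J ^ k * q ^ J)))|]; auto.
      - apply harmonic_pminus; auto.
      - intros y Hy. rewrite dist_zero in Hy. apply step_diff; auto.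
      - rewrite dist_zero. auto.
      - right. rewrite rad_S. replace (nrm v / (rad J / 2)) with (nrm v * (2 * / rad J)) by (field; lra).
        rewrite !Rpow_mult_distr, pow_inv. unfold Y.
        replace (2 ^ J) with (/ rad J) by (unfold rad; rewrite pow_inv, Rinv_inv; reflexivity).
        change (rad J ^ S k) with (rad J * rad J ^ k). field. split; [lra|apply pow_nonzero; lra]. }
    rewrite peval_pdirn_pminus in HD.
    replace (peval (pdirn (S k) v (hs (S J))) x) with
      ((peval (pdirn (S k) v (hs (S J))) x - peval (pdirn (S k) v (hs J)) x) + peval (pdirn (S k) v (hs J)) x) by ring.
    eapply Rle_trans; [apply Rabs_triang|].
    assert (H2q : 0 < (2 * q) ^ J) by (apply pow_lt; lra).
    assert (Hstep : Y * (2 * q) ^ J + campX * (2 * q) ^ J <= campX * (2 * q) ^ S J).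
    { change ((2 * q) ^ S J) with (2 * q * (2 * q) ^ J).
      replace (campX * (2 * q * (2 * q) ^ J)) with (campX * (2 * q) * (2 * q) ^ J) by ring.
      rewrite <- Rmult_plus_distr_r. apply Rmult_le_compat_r; [lra|].
      assert (Y <= campX * (2 * q - 1)); [|lra].
      unfold campX. fold Y. replace Y with (Y / (2 * q - 1) * (2 * q - 1)) at 1 by (field; lra).
      apply Rmult_le_compat_r; lra. }
    assert (dirC N (S k) * nrm v ^ S k * (Y * (2 * q) ^ J + campX * (2 * q) ^ J) <=
      dirC N (S k) * nrm v ^ S k * (campX * (2 * q) ^ S J)) by (apply Rmult_le_compat_l; auto).
    lra.
Qed.

(** Three errors of the same order: g against the approximant at scale J, the Taylor remainder of
    that approximant, and its jets against their limits. In the remainder |v|^(k+1) (2 q)^J <=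
    2^(-Jk) q^J, because (2 q)^J is q^J divided by the radius. *)
Lemma jet_expansion J v : nrm v <= rad J / 2 ^ S k ->
  Rabs (g v - sumN (S k) (fun m => jet m v / INR (fact m))) <= campC * (rad J ^ k * q ^ J).
Proof.
  intros Hv. pose proof (rad_pos J) as Hr. pose proof (qj_pos J) as HqJ.
  pose proof (nrm_nonneg v) as Hv0. pose proof (pow_lt 2 (S k) ltac:(lra)) as H2k.
  assert (H2k1 : 1 <= 2 ^ S k) by (apply pow_R1_Rle; lra).
  assert (HvJ : nrm v <= rad J).
  { eapply Rle_trans; [apply Hv|]. apply Rmult_le_reg_r with (2 ^ S k); auto.
    replace (rad J / 2 ^ S k * 2 ^ S k) with (rad J) by (field; lra). nra. }
  pose proof (Happrox J v HvJ) as H1.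
  assert (Hb : 0 < rad J ^ k * q ^ J) by (apply Rmult_lt_0_compat; auto; apply pow_lt; auto).
  assert (Htop : nrm v ^ S k * (2 * q) ^ J <= rad J ^ k * q ^ J).
  { apply Rle_trans with (rad J ^ S k * (2 * q) ^ J).
    - apply Rmult_le_compat_r; [apply pow_le; lra|]. apply pow_incr; lra.
    - right. rewrite Rpow_mult_distr. replace (2 ^ J) with (/ rad J) by (unfold rad; rewrite pow_inv, Rinv_inv; reflexivity).
      simpl. field. lra. }
  assert (H2 : Rabs (peval (hs J) v - sumN (S k) (fun m => djet m v J / INR (fact m))) <=
     dirC N (S k) * campX * (rad J ^ k * q ^ J)).
  { pose proof (taylor_bound k (fun m t => peval (pdirn m v (hs J)) (vadd vzero (vscal t v)))
      (dirC N (S k) * nrm v ^ S k * (campX * (2 * q) ^ J))) as T.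
    assert (Z : forall w : RN N, vadd vzero w = w) by (intros; apply RN_ext; intros; rewrite coord_vadd, coord_vzero; ring).
    apply Rle_trans with (dirC N (S k) * campX * (nrm v ^ S k * (2 * q) ^ J)).
    2: { apply Rmult_le_compat_l; auto. apply Rmult_le_pos; [apply dirC_nonneg|apply campX_nonneg]. }
    replace (dirC N (S k) * campX * (nrm v ^ S k * (2 * q) ^ J)) with
      (dirC N (S k) * nrm v ^ S k * (campX * (2 * q) ^ J)) by ring.
    replace (peval (hs J) v) with (peval (pdirn 0 v (hs J)) (vadd vzero (vscal 1 v))).
    2: { rewrite Z. simpl. f_equal. apply RN_ext; intros; rewrite coord_vscal; ring. }
    replace (sumN (S k) (fun m => djet m v J / INR (fact m))) with
      (taylor_sum k (fun m => peval (pdirn m v (hs J)) (vadd vzero (vscal 0 v))) 1).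
    2: { apply sumN_ext. intros m Hm. rewrite Z, vscal_0, pow1. unfold djet. field. apply INR_fact_neq_0. }
    apply T; [| | |lra].
    - apply Rmult_le_pos; [apply Rmult_le_pos; [apply dirC_nonneg|apply pow_le; auto]|].
      apply Rmult_le_pos; [apply campX_nonneg|apply pow_le; lra].
    - intros m t. apply pdirn_line.
    - intros t Ht. rewrite Z. apply top_growth. rewrite nrm_vscal, Rabs_pos_eq by lra. nra. }
  assert (H3 : Rabs (sumN (S k) (fun m => djet m v J / INR (fact m)) - sumN (S k) (fun m => jet m v / INR (fact m)))
     <= sumN (S k) (fun m => campC1 m / (1 - q)) * (rad J ^ k * q ^ J)).
  { rewrite <- sumN_minus. eapply Rle_trans; [apply sumN_abs|].
    rewrite Rmult_comm, <- sumN_scal. apply sumN_le. intros m Hm.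
    replace (djet m v J / INR (fact m) - jet m v / INR (fact m)) with ((djet m v J - jet m v) * / INR (fact m))
      by (field; apply INR_fact_neq_0).
    assert (F1 : 1 <= INR (fact m)) by (apply (le_INR 1), lt_O_fact).
    assert (F2 : 0 < / INR (fact m) <= 1).
    { split; [apply Rinv_0_lt_compat; lra|]. rewrite <- Rinv_1. apply Rinv_le_contravar; lra. }
    rewrite Rabs_mult, (Rabs_pos_eq (/ _)) by lra.
    pose proof (jet_close m v J ltac:(lia)) as Hc. pose proof (Rabs_pos (djet m v J - jet m v)).
    apply Rle_trans with (Rabs (djet m v J - jet m v)); [nra|]. eapply Rle_trans; [apply Hc|].
    rewrite (rad_pow_split m J) by lia.
    assert (nrm v ^ m <= rad J ^ m) by (apply pow_incr; lra).
    assert (0 <= campC1 m / (1 - q)) by (apply Rdiv_le_0_compat; [apply campC1_nonneg|lra]).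
    assert (0 <= campC1 m / (1 - q) * (rad J ^ (k - m) * q ^ J)).
    { apply Rmult_le_pos; auto. apply Rmult_le_pos; [apply pow_le; lra|lra]. }
    replace (rad J ^ m * rad J ^ (k - m) * q ^ J * (campC1 m / (1 - q))) with
      (campC1 m / (1 - q) * (rad J ^ (k - m) * q ^ J) * rad J ^ m) by ring.
    replace (campC1 m / (1 - q) * nrm v ^ m * (rad J ^ (k - m) * q ^ J)) with
      (campC1 m / (1 - q) * (rad J ^ (k - m) * q ^ J) * nrm v ^ m) by ring.
    apply Rmult_le_compat_l; auto. }
  assert (H4 : 0 <= sumN (S k) (fun m => dirC N m * (M + A) + campC1 m / (1 - q)) * (rad J ^ k * q ^ J)).
  { apply Rmult_le_pos; [|lra]. apply sumN_nonneg. intros m Hm. pose proof (dirC_nonneg (N := N) m).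
    assert (0 <= campC1 m / (1 - q)) by (apply Rdiv_le_0_compat; [apply campC1_nonneg|lra]). nra. }
  replace (g v - sumN (S k) (fun m => jet m v / INR (fact m))) with
    ((g v - peval (hs J) v) + (peval (hs J) v - sumN (S k) (fun m => djet m v J / INR (fact m)))
     + (sumN (S k) (fun m => djet m v J / INR (fact m)) - sumN (S k) (fun m => jet m v / INR (fact m)))) by ring.
  eapply Rle_trans; [apply Rabs_triang|]. eapply Rle_trans; [apply Rplus_le_compat_r; apply Rabs_triang|].
  unfold campC. lra.
Qed.
End Campanato.

Lemma Rpower_pos x y : 0 < Rpower x y.
Proof. apply exp_pos. Qed.

Lemma Rpower_half_range alpha : 0 < alpha < 1 -> / 2 < Rpower (/ 2) alpha < 1.
Proof.
  intros Ha. assert (Hln : ln (/ 2) < 0) by (rewrite <- ln_1; apply ln_increasing; lra).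
  unfold Rpower. split.
  - rewrite <- (exp_ln (/ 2)) at 1 by lra. apply exp_increasing. nra.
  - rewrite <- exp_0. apply exp_increasing. nra.
Qed.

Lemma Rpower_rad alpha j : Rpower (/ 2) alpha ^ j = Rpower (rad j) alpha.
Proof.
  unfold rad. rewrite <- (Rpower_pow j (Rpower (/ 2) alpha)) by apply Rpower_pos.
  rewrite <- (Rpower_pow j (/ 2)) by lra. rewrite !Rpower_mult. f_equal. ring.
Qed.

Lemma dyadic_scale t : 0 < t <= 1 -> exists j, rad (S j) < t <= rad j.
Proof.
  intros Ht. assert (H : exists n, rad n < t).
  { destruct (pow_lt_1_zero (/ 2) ltac:(rewrite Rabs_pos_eq; lra) t ltac:(lra)) as [n Hn].
    exists n. specialize (Hn n (le_n n)). apply Rabs_lt_between in Hn. unfold rad. lra. }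
  destruct H as [n Hn]. induction n as [|n IH].
  - unfold rad in Hn. simpl in Hn. lra.
  - destruct (Rle_or_lt t (rad n)); [exists n; lra|auto].
Qed.

Section CampanatoPack.
Context {N : nat}.
Hypothesis HN0 : (0 < N)%nat.
Implicit Types x y v : RN N.

Local Notation bas := (@basis N).

Lemma pdir_basis i p x : (i < N)%nat -> peval (pdir (bas i) p) x = peval (pderiv i p) x.
Proof.
  intros Hi. rewrite peval_pdir.
  rewrite (sumN_ext _ _ (fun j => peval (pderiv j p) x * (if Nat.eqb j i then 1 else 0))).
  - apply (sumN_delta N i (fun j => peval (pderiv j p) x)); auto.
  - intros j Hj. rewrite coord_basis by auto. ring.
Qed.

Lemma pdir_vadd v w p x : peval (pdir (vadd v w) p) x = peval (pdir v p) x + peval (pdir w p) x.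
Proof.
  rewrite !peval_pdir, <- sumN_plus. apply sumN_ext. intros. rewrite coord_vadd. ring.
Qed.

Lemma pdir2_basis i l p x : (i < N)%nat -> (l < N)%nat ->
  peval (pdir (bas i) (pdir (bas l) p)) x = peval (pderiv i (pderiv l p)) x.
Proof.
  intros Hi Hl. rewrite pdir_basis by auto. apply pderiv_ext; auto. intros; apply pdir_basis; auto.
Qed.

(** The jets are recorded as derivatives along a single vector; polarization recovers the mixed
    second derivatives from them. *)
Lemma pdir2_polar i l p x : (i < N)%nat -> (l < N)%nat ->
  peval (pderiv i (pderiv l p)) x =
  / 2 * (peval (pdirn 2 (vadd (bas i) (bas l)) p) x - peval (pdirn 2 (bas i) p) x - peval (pdirn 2 (bas l) p) x).
Proof.
  intros Hi Hl. simpl pdirn. rewrite pdir_vadd.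
  assert (E : forall k, (k < N)%nat -> peval (pdir (bas k) (pdir (vadd (bas i) (bas l)) p)) x =
    peval (pderiv k (pderiv i p)) x + peval (pderiv k (pderiv l p)) x).
  { intros k Hk. rewrite pdir_basis by auto.
    rewrite (pderiv_ext _ (PA (pderiv i p) (pderiv l p)) k Hk); [reflexivity|].
    intros y. rewrite pdir_vadd, !pdir_basis by auto. reflexivity. }
  rewrite !E, !pdir2_basis by auto. rewrite (pderiv_comm l i). field.
Qed.

Lemma pdirn2_quad v p x : peval (pdirn 2 v p) x =
  sumN N (fun i => sumN N (fun l => coord v i * coord v l * peval (pderiv i (pderiv l p)) x)).
Proof.
  simpl pdirn. rewrite peval_pdir. apply sumN_ext. intros i Hi. unfold pdir. rewrite pderiv_psum, <- sumN_scal.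
  apply sumN_ext. intros l Hl. simpl. ring.
Qed.

Variables (alpha A M : R).
Hypotheses (Halpha : 0 < alpha < 1) (HA : 0 <= A) (HM : 0 <= M).
Let q : R := Rpower (/ 2) alpha.

Definition harmonically_approx (k : nat) (g : RN N -> R) : Prop :=
  forall r, 0 < r <= 1 -> exists h, harmonic (N := N) h /\
    forall x, nrm x <= r -> Rabs (g x - peval h x) <= A * (r ^ k * Rpower r alpha).

(** The constant is fixed before g is given. Applied to translates of a whole sequence of
    polynomials, this yields estimates uniform along the sequence and over the centres. *)
Lemma jets_exist k : exists C, 0 <= C /\ forall g, (forall x, nrm x <= 1 -> Rabs (g x) <= M) ->
  harmonically_approx k g ->
  exists (hs : nat -> poly) (P : nat -> RN N -> R),
    (forall j, harmonic (N := N) (hs j)) /\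
    (forall m v, (m <= k)%nat -> ulim (fun j => peval (pdirn m v (hs j)) (@vzero N)) (P m v)) /\
    (forall m v, (m <= k)%nat -> Rabs (P m v) <= C * nrm v ^ m) /\
    (forall v, P 0%nat v = g vzero) /\
    forall v, 0 < nrm v <= / 2 ^ S k ->
      Rabs (g v - sumN (S k) (fun m => P m v / INR (fact m))) <= C * (nrm v ^ k * Rpower (nrm v) alpha).
Proof.
  pose proof (Rpower_half_range alpha Halpha) as Hq. fold q in Hq.
  set (C0 := campC (N := N) k q A M).
  assert (HC0 : 0 <= C0 /\ forall m, (m <= k)%nat -> dirC N m * (M + A) + campC1 (N := N) A m / (1 - q) <= C0).
  { assert (T : forall m, 0 <= dirC N m * (M + A) + campC1 (N := N) A m / (1 - q)).
    { intros m. pose proof (dirC_nonneg (N := N) m). pose proof (campC1_nonneg (N := N) A HA m).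
      assert (0 <= campC1 (N := N) A m / (1 - q)) by (apply Rdiv_le_0_compat; lra). nra. }
    assert (T2 : 0 <= sumN (S k) (fun m => campC1 (N := N) A m / (1 - q))).
    { apply sumN_nonneg. intros m _. apply Rdiv_le_0_compat; [apply campC1_nonneg; auto|lra]. }
    assert (T3 : 0 <= dirC N (S k) * campX k q A M).
    { apply Rmult_le_pos; [apply dirC_nonneg|apply campX_nonneg; auto]. }
    unfold C0, campC. split.
    - assert (0 <= sumN (S k) (fun m => dirC N m * (M + A) + campC1 (N := N) A m / (1 - q))) by (apply sumN_nonneg; auto).
      lra.
    - intros m Hm.
      pose proof (sumN_term_le (S k) (fun m => dirC N m * (M + A) + campC1 (N := N) A m / (1 - q)) m
        (fun j _ => T j) ltac:(lia)) as T4. cbv beta in T4. lra. }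
  destruct HC0 as [HC0 HC1].
  (* Passage from dyadic radii to |v|: the radius chosen for v is at most 2 * 2^(k+1) |v|. *)
  set (c := (2 * 2 ^ S k) ^ k * Rpower (2 * 2 ^ S k) alpha).
  pose proof (pow_lt 2 (S k) ltac:(lra)) as H2k.
  assert (H2k1 : 1 <= 2 ^ S k) by (apply pow_R1_Rle; lra).
  assert (Hc : 1 <= c).
  { unfold c. assert (1 <= (2 * 2 ^ S k) ^ k) by (apply pow_R1_Rle; lra).
    assert (1 <= Rpower (2 * 2 ^ S k) alpha).
    { rewrite <- (Rpower_O (2 * 2 ^ S k)) by lra. apply Rle_Rpower; lra. }
    nra. }
  exists (C0 * c). split; [nra|]. intros g HgM Happ.
  assert (Hh : forall j, exists h, harmonic (N := N) h /\
    forall x, nrm x <= rad j -> Rabs (g x - peval h x) <= A * (rad j ^ k * q ^ j)).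
  { intros j. unfold q. rewrite Rpower_rad. apply Happ. split; [apply rad_pos|apply rad_le_1]. }
  apply choice in Hh. destruct Hh as [hs Hhs].
  assert (Hharm : forall j, harmonic (N := N) (hs j)) by (intros; apply Hhs).
  assert (Happrox : forall j x, nrm x <= rad j -> Rabs (g x - peval (hs j) x) <= A * (rad j ^ k * q ^ j))
    by (intros; apply Hhs; auto).
  set (P := fun m v => jet (N := N) hs m v).
  pose proof (jet_lim HN0 k q A M Hq HA g hs Hharm Happrox HgM) as Hlim.
  pose proof (jet_bound HN0 k q A M Hq HA g hs Hharm Happrox HgM) as Hbd.
  pose proof (jet_expansion HN0 k q A M Hq HA HM g hs Hharm Happrox HgM) as Hexp.
  assert (Hbd' : forall m v, (m <= k)%nat -> Rabs (P m v) <= C0 * nrm v ^ m).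
  { intros m v Hm. eapply Rle_trans; [apply Hbd; auto|].
    apply Rmult_le_compat_r; [apply pow_le, nrm_nonneg|auto]. }
  exists hs, P. split; [auto|]. split; [exact Hlim|]. split; [|split].
  - intros m v Hm. eapply Rle_trans; [apply Hbd'; auto|].
    apply Rmult_le_compat_r; [apply pow_le, nrm_nonneg|nra].
  - intros v. change (P 0%nat v) with (P 0%nat vzero). symmetry. apply Rminus_diag_uniq.
    (* At v = 0 the expansion holds at every scale J; the jets of positive order vanish there, and
       the error tends to 0. *)
    assert (Z : forall J, Rabs (g vzero - P 0%nat vzero) <= C0 * q ^ J).
    { intros J. assert (Hz : nrm (@vzero N) <= rad J / 2 ^ S k).
      { rewrite nrm_vzero. apply Rdiv_le_0_compat; auto. left; apply rad_pos. }
      pose proof (Hexp J vzero Hz) as K.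
      replace (sumN (S k) (fun m => jet hs m (@vzero N) / INR (fact m))) with (P 0%nat vzero) in K.
      - eapply Rle_trans; [apply K|]. apply Rmult_le_compat_l; auto.
        pose proof (rad_pos J). pose proof (rad_le_1 J).
        assert (rad J ^ k <= 1) by (rewrite <- (pow1 k); apply pow_incr; lra).
        assert (0 < q ^ J) by (apply pow_lt; lra). nra.
      - assert (Zm : forall m, (m < k)%nat -> P (S m) vzero = 0).
        { intros m Hm. pose proof (Hbd' (S m) vzero ltac:(lia)) as B.
          rewrite nrm_vzero, pow_ne_zero, Rmult_0_r in B by lia.
          pose proof (Rabs_pos (P (S m) vzero)).
          destruct (Req_dec (P (S m) vzero) 0) as [|Hne]; auto. apply Rabs_no_R0 in Hne. lra. }
        clear - Zm. unfold P in *. revert Zm. induction k as [|k IH]; intros Zm.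
        + simpl. field.
        + change (jet hs 0 (@vzero N) = sumN (S k) (fun m => jet hs m (@vzero N) / INR (fact m))
            + jet hs (S k) (@vzero N) / INR (fact (S k))).
          rewrite <- IH by (intros; apply Zm; lia). rewrite Zm by lia. unfold Rdiv. ring. }
    destruct (Req_dec (g vzero - P 0%nat vzero) 0) as [|Hne]; auto. exfalso.
    apply Rabs_pos_lt in Hne. set (z := Rabs (g vzero - P 0%nat vzero)) in *.
    destruct (pow_lt_1_zero q ltac:(rewrite Rabs_pos_eq; lra) (z / (C0 + 1)) ltac:(apply Rdiv_lt_0_compat; lra)) as [J HJ].
    specialize (HJ J (le_n J)). specialize (Z J). assert (0 < q ^ J) by (apply pow_lt; lra).
    rewrite Rabs_pos_eq in HJ by lra.
    apply Rmult_lt_compat_r with (r := C0 + 1) in HJ; [|lra].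
    replace (z / (C0 + 1) * (C0 + 1)) with z in HJ by (field; lra). nra.
  - intros v Hv. set (t := nrm v) in *.
    destruct (dyadic_scale (t * 2 ^ S k)) as [J HJ].
    { split; [nra|]. apply Rmult_le_reg_r with (/ 2 ^ S k); [apply Rinv_0_lt_compat; auto|].
      rewrite Rmult_assoc, Rinv_r by lra. lra. }
    pose proof (rad_pos J) as HrJ.
    assert (HvJ : t <= rad J / 2 ^ S k).
    { apply Rmult_le_reg_r with (2 ^ S k); auto. replace (rad J / 2 ^ S k * 2 ^ S k) with (rad J) by (field; lra). lra. }
    eapply Rle_trans; [apply (Hexp J v HvJ)|].
    fold C0. rewrite Rmult_assoc. apply Rmult_le_compat_l; auto.
    assert (Hrt : rad J <= 2 * 2 ^ S k * t) by (rewrite rad_S in HJ; lra).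
    replace (c * (t ^ k * Rpower t alpha)) with ((2 * 2 ^ S k * t) ^ k * Rpower (2 * 2 ^ S k * t) alpha).
    2: { unfold c.
         rewrite <- (Rpower_mult_distr (2 * 2 ^ S k) t alpha) by lra. rewrite Rpow_mult_distr. ring. }
    unfold q. rewrite Rpower_rad. apply Rmult_le_compat.
    + apply pow_le; lra.
    + left; apply Rpower_pos.
    + apply pow_incr; lra.
    + apply Rle_Rpower_l; lra.
Qed.

(** The first-order jet is a limit of linear functionals of v, hence linear and given by its values
    on the basis. *)
Lemma first_order_expansion : exists C, 0 <= C /\ forall g, (forall x, nrm x <= 1 -> Rabs (g x) <= M) ->
  harmonically_approx 1 g ->
  exists D : nat -> R, (forall i, (i < N)%nat -> Rabs (D i) <= C) /\
    forall v, 0 < nrm v <= / 4 ->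
      Rabs (g v - g vzero - sumN N (fun i => D i * coord v i)) <= C * (nrm v * Rpower (nrm v) alpha).
Proof.
  destruct (jets_exist 1) as [C [HC H]]. exists C. split; auto. intros g HgM Happ.
  destruct (H g HgM Happ) as (hs & P & Hh & Hlim & Hbd & H0 & Hexp).
  exists (fun i => P 1%nat (bas i)). split.
  - intros i Hi. pose proof (Hbd 1%nat (bas i) (le_n 1)) as B. rewrite nrm_basis in B by auto. simpl in B. lra.
  - intros v Hv. specialize (Hexp v). replace (/ 2 ^ 2) with (/ 4) in Hexp by field. specialize (Hexp Hv).
    assert (E1 : P 1%nat v = sumN N (fun i => P 1%nat (bas i) * coord v i)).
    { apply (ulim_unique _ _ _ (Hlim 1%nat v (le_n 1))).
      apply (ulim_ext (fun j => sumN N (fun i => coord v i * peval (pdirn 1 (bas i) (hs j)) (@vzero N)))).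
      - intros j. simpl pdirn. rewrite peval_pdir. apply sumN_ext. intros i Hi. rewrite pdir_basis; auto.
      - rewrite (sumN_ext _ _ (fun i => coord v i * P 1%nat (bas i))) by (intros; ring).
        apply (ulim_sumN N (fun i j => coord v i * peval (pdirn 1 (bas i) (hs j)) (@vzero N))).
        intros i Hi. apply ulim_scal, Hlim; auto. }
    simpl sumN in Hexp. rewrite H0, E1 in Hexp. simpl in Hexp. rewrite Rmult_1_r in Hexp.
    replace (g v - g vzero - sumN N (fun i => P 1%nat (bas i) * coord v i)) with
      (g v - (0 + g vzero / 1 + sumN N (fun i => P 1%nat (bas i) * coord v i) / 1)) by field.
    exact Hexp.
Qed.

(** The matrix inherits symmetry from polarization and zero trace from harmonicity of the
    approximants. Its entries are at most (4 C + C + C) / 2, since basis sums have norm at most 2;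
    this is the factor 3. *)
Lemma second_order_expansion : exists C, 0 <= C /\ forall g, (forall x, nrm x <= 1 -> Rabs (g x) <= M) ->
  harmonically_approx 2 g ->
  exists (D : nat -> R) (H : nat -> nat -> R),
    (forall i, (i < N)%nat -> Rabs (D i) <= C) /\
    (forall i l, (i < N)%nat -> (l < N)%nat -> Rabs (H i l) <= C) /\
    (forall i l, H i l = H l i) /\ sumN N (fun i => H i i) = 0 /\
    forall v, 0 < nrm v <= / 8 ->
      Rabs (g v - g vzero - sumN N (fun i => D i * coord v i)
        - / 2 * sumN N (fun i => sumN N (fun l => H i l * coord v i * coord v l)))
      <= C * (nrm v ^ 2 * Rpower (nrm v) alpha).
Proof.
  destruct (jets_exist 2) as [C [HC H]]. exists (3 * C). split; [lra|]. intros g HgM Happ.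
  destruct (H g HgM Happ) as (hs & P & Hh & Hlim & Hbd & H0 & Hexp).
  assert (N2 : forall i, (i < N)%nat -> Rabs (P 2%nat (bas i)) <= C).
  { intros i Hi. pose proof (Hbd 2%nat (bas i) (le_n 2)) as B. rewrite nrm_basis in B by auto. simpl in B. lra. }
  set (Hm := fun i l => / 2 * (P 2%nat (vadd (bas i) (bas l)) - P 2%nat (bas i) - P 2%nat (bas l))).
  assert (Hml : forall i l, (i < N)%nat -> (l < N)%nat ->
    ulim (fun j => peval (pderiv i (pderiv l (hs j))) (@vzero N)) (Hm i l)).
  { intros i l Hi Hl. eapply ulim_ext; [intros j; symmetry; apply pdir2_polar; auto|].
    apply ulim_scal. repeat apply ulim_minus; apply Hlim; auto. }
  exists (fun i => P 1%nat (bas i)), Hm. repeat split.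
  - intros i Hi. pose proof (Hbd 1%nat (bas i) ltac:(lia)) as B. rewrite nrm_basis in B by auto. simpl in B. lra.
  - intros i l Hi Hl. unfold Hm.
    pose proof (Hbd 2%nat (vadd (bas i) (bas l)) (le_n 2)) as B.
    assert (nrm (vadd (bas i) (bas l)) <= 2).
    { eapply Rle_trans; [apply nrm_vadd|]. rewrite !nrm_basis by auto. lra. }
    pose proof (nrm_nonneg (vadd (bas i) (bas l))) as Hn0.
    pose proof (N2 i Hi) as B1. pose proof (N2 l Hl) as B2.
    assert (B3 : Rabs (P 2%nat (vadd (bas i) (bas l))) <= 4 * C).
    { eapply Rle_trans; [apply B|]. assert (nrm (vadd (bas i) (bas l)) ^ 2 <= 2 ^ 2) by (apply pow_incr; lra). nra. }
    apply Rabs_le_between in B1, B2, B3. apply Rabs_le. lra.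
  - intros i l. unfold Hm. rewrite (RN_ext (vadd (bas i) (bas l)) (vadd (bas l) (bas i))).
    + ring.
    + intros; rewrite !coord_vadd; ring.
  - apply (ulim_unique (fun j => lap (hs j) (@vzero N))).
    + apply (ulim_sumN N (fun i j => peval (pderiv i (pderiv i (hs j))) (@vzero N))). intros i Hi. apply Hml; auto.
    + apply (ulim_ext (fun _ => 0)); [intros j; symmetry; apply Hh|apply ulim_const].
  - intros v Hv. specialize (Hexp v). replace (/ 2 ^ 3) with (/ 8) in Hexp by field. specialize (Hexp Hv).
    assert (E1 : P 1%nat v = sumN N (fun i => P 1%nat (bas i) * coord v i)).
    { apply (ulim_unique _ _ _ (Hlim 1%nat v ltac:(lia))).
      apply (ulim_ext (fun j => sumN N (fun i => coord v i * peval (pdirn 1 (bas i) (hs j)) (@vzero N)))).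
      - intros j. simpl pdirn. rewrite peval_pdir. apply sumN_ext. intros i Hi. rewrite pdir_basis; auto.
      - rewrite (sumN_ext _ _ (fun i => coord v i * P 1%nat (bas i))) by (intros; ring).
        apply (ulim_sumN N (fun i j => coord v i * peval (pdirn 1 (bas i) (hs j)) (@vzero N))).
        intros i Hi. apply ulim_scal, Hlim; lia. }
    assert (E2 : P 2%nat v = sumN N (fun i => sumN N (fun l => Hm i l * coord v i * coord v l))).
    { apply (ulim_unique _ _ _ (Hlim 2%nat v ltac:(lia))).
      eapply ulim_ext; [intros j; symmetry; apply pdirn2_quad|].
      apply (ulim_sumN N (fun i j => sumN N (fun l => coord v i * coord v l * peval (pderiv i (pderiv l (hs j))) (@vzero N)))).
      intros i Hi.
      rewrite (sumN_ext _ _ (fun l => coord v i * coord v l * Hm i l)) by (intros; ring).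
      apply (ulim_sumN N (fun l j => coord v i * coord v l * peval (pderiv i (pderiv l (hs j))) (@vzero N))).
      intros l Hl. apply ulim_scal, Hml; auto. }
    simpl sumN in Hexp. rewrite H0, E1, E2 in Hexp. simpl fact in Hexp. simpl INR in Hexp.
    eapply Rle_trans; [|eapply Rle_trans; [apply Hexp|]].
    + right. f_equal. field.
    + assert (0 <= nrm v ^ 2 * Rpower (nrm v) alpha).
      { apply Rmult_le_pos; [apply pow2_ge_0|left; apply Rpower_pos]. } nra.
Qed.
End CampanatoPack.

(** * Hoelder functions and Taylor expansions *)

Section Hoelder.
Context {N : nat}.
Implicit Types x y v w : RN N.
Variable alpha : R.
Hypothesis Halpha : 0 < alpha < 1.
Let om (t : R) : R := Rpower t alpha.

Lemma om_pos t : 0 < om t.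
Proof. apply Rpower_pos. Qed.

Lemma om_mono s t : 0 < s <= t -> om s <= om t.
Proof. intros. apply Rle_Rpower_l; lra. Qed.

Lemma om_ge t : 0 < t <= 1 -> t <= om t.
Proof.
  intros Ht. unfold om, Rpower. rewrite <- (exp_ln t) at 1 by lra.
  assert (ln t <= 0).
  { rewrite <- ln_1. destruct (Req_dec t 1) as [->|]; [lra|]. left. apply ln_increasing; lra. }
  destruct (Rle_lt_or_eq_dec (ln t) (alpha * ln t)) as [|E]; [nra| |].
  - left. apply exp_increasing. auto.
  - right. f_equal. auto.
Qed.

Lemma om_ge1 t : 1 <= t -> 1 <= om t.
Proof. intros. unfold om. rewrite <- (Rpower_O t) by lra. apply Rle_Rpower; lra. Qed.

Lemma om_double t : 0 < t -> om (2 * t) <= 2 * om t.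
Proof.
  intros. unfold om. rewrite <- Rpower_mult_distr by lra.
  apply Rmult_le_compat_r; [left; apply Rpower_pos|].
  rewrite <- (Rpower_1 2) at 2 by lra. apply Rle_Rpower; lra.
Qed.

Lemma om_lin t T : 0 < t <= T -> 1 <= T -> t <= T * om t.
Proof.
  intros Ht HT. destruct (Rle_or_lt t 1).
  - pose proof (om_ge t ltac:(lra)). pose proof (om_pos t). nra.
  - pose proof (om_ge1 t ltac:(lra)). nra.
Qed.

Definition hold (rho C : R) (f : RN N -> R) : Prop := forall x y,
  nrm x <= rho -> nrm y <= rho -> 0 < dist x y -> Rabs (f x - f y) <= C * Rpower (dist x y) alpha.

Lemma hold_weaken rho C C' f : C <= C' -> hold rho C f -> hold rho C' f.
Proof.
  intros HC H x y Hx Hy Hd. eapply Rle_trans; [apply H; auto|].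
  apply Rmult_le_compat_r; auto. left; apply Rpower_pos.
Qed.

(** At distances beyond d0 the bound on f itself is used, at the price of 2 B / d0^alpha. *)
Lemma hold_of_local rho d0 C B f : 0 < d0 -> 0 <= C -> 0 <= B ->
  (forall x, nrm x <= rho -> Rabs (f x) <= B) ->
  (forall x y, nrm x <= rho -> nrm y <= rho -> 0 < dist x y <= d0 -> Rabs (f x - f y) <= C * om (dist x y)) ->
  hold rho (C + 2 * B / om d0) f.
Proof.
  intros Hd0 HC HB Hf Hl x y Hx Hy Hd. fold (om (dist x y)). pose proof (om_pos d0). pose proof (om_pos (dist x y)).
  assert (0 <= 2 * B / om d0) by (apply Rdiv_le_0_compat; lra).
  destruct (Rle_or_lt (dist x y) d0) as [Hle|Hgt].
  - specialize (Hl x y Hx Hy (conj Hd Hle)). nra.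
  - pose proof (om_mono d0 (dist x y) ltac:(lra)).
    pose proof (Hf x Hx). pose proof (Hf y Hy).
    assert (Rabs (f x - f y) <= 2 * B).
    { eapply Rle_trans; [apply Rabs_triang|]. rewrite Rabs_Ropp. lra. }
    assert (2 * B <= 2 * B / om d0 * om (dist x y)).
    { replace (2 * B) with (2 * B / om d0 * om d0) at 1 by (field; lra). apply Rmult_le_compat_l; auto. }
    nra.
Qed.

Lemma hold_lip rho L f : 0 <= rho -> 0 <= L ->
  (forall x y, nrm x <= rho -> nrm y <= rho -> Rabs (f x - f y) <= L * dist x y) ->
  hold rho (L * (2 * rho + 1)) f.
Proof.
  intros Hrho HL H x y Hx Hy Hd. eapply Rle_trans; [apply H; auto|].
  rewrite Rmult_assoc. apply Rmult_le_compat_l; auto. apply om_lin; [|lra].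
  split; auto. rewrite dist_nrm.
  replace (vsub x y) with (vadd x (vscal (-1) y)) by (apply RN_ext; intros; rewrite coord_vadd, coord_vsub, coord_vscal; ring).
  eapply Rle_trans; [apply nrm_vadd|]. rewrite nrm_vscal, (Rabs_left1 (-1)) by lra. lra.
Qed.

Lemma hold_mult rho B1 B2 C1 C2 f1 f2 : 0 <= C1 -> 0 <= C2 ->
  (forall x, nrm x <= rho -> Rabs (f1 x) <= B1) -> (forall x, nrm x <= rho -> Rabs (f2 x) <= B2) ->
  hold rho C1 f1 -> hold rho C2 f2 -> hold rho (C1 * B2 + B1 * C2) (fun x => f1 x * f2 x).
Proof.
  intros HC1 HC2 Hb1 Hb2 H1 H2 x y Hx Hy Hd. specialize (H1 x y Hx Hy Hd). specialize (H2 x y Hx Hy Hd).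
  specialize (Hb1 y Hy). specialize (Hb2 x Hx).
  replace (f1 x * f2 x - f1 y * f2 y) with ((f1 x - f1 y) * f2 x + f1 y * (f2 x - f2 y)) by ring.
  eapply Rle_trans; [apply Rabs_triang|]. rewrite !Rabs_mult, Rmult_plus_distr_r.
  apply Rplus_le_compat.
  - replace (C1 * B2 * Rpower (dist x y) alpha) with ((C1 * Rpower (dist x y) alpha) * B2) by ring.
    apply Rmult_le_compat; auto using Rabs_pos.
  - rewrite Rmult_assoc. apply Rmult_le_compat; auto using Rabs_pos.
Qed.

Lemma hold_sumN rho n (F : nat -> RN N -> R) C : (forall i, (i < n)%nat -> hold rho C (F i)) ->
  hold rho (INR n * C) (fun x => sumN n (fun i => F i x)).
Proof.
  intros H x y Hx Hy Hd. rewrite <- sumN_minus, Rmult_assoc. apply sumN_abs_le.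
  intros i Hi. apply H; auto.
Qed.

Lemma hold_inv rho m C f : 0 < m -> 0 <= C -> (forall x, nrm x <= rho -> m <= f x) -> hold rho C f ->
  hold rho (C / m ^ 2) (fun x => / f x).
Proof.
  intros Hm HC Hl H x y Hx Hy Hd. specialize (H x y Hx Hy Hd). pose proof (Hl x Hx). pose proof (Hl y Hy).
  pose proof (Rpower_pos (dist x y) alpha) as Hp.
  assert (Hm2 : 0 < m ^ 2) by nra. assert (Hxy : m ^ 2 <= f x * f y) by nra.
  replace (/ f x - / f y) with (- (f x - f y) * / (f x * f y)) by (field; lra).
  rewrite Rabs_mult, Rabs_Ropp, (Rabs_pos_eq (/ _)) by (left; apply Rinv_0_lt_compat; lra).
  replace (C / m ^ 2 * Rpower (dist x y) alpha) with ((C * Rpower (dist x y) alpha) * / m ^ 2) by (field; lra).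
  apply Rmult_le_compat; auto using Rabs_pos; [left; apply Rinv_0_lt_compat; lra|].
  apply Rinv_le_contravar; auto.
Qed.

Definition lin_form (D : nat -> R) v : R := sumN N (fun i => D i * coord v i).
Lemma lin_form_basis D i t : (i < N)%nat -> lin_form D (vscal t (basis i)) = t * D i.
Proof.
  intros Hi. unfold lin_form.
  rewrite (sumN_ext _ _ (fun j => (t * D j) * (if Nat.eqb j i then 1 else 0))).
  - apply (sumN_delta N i (fun j => t * D j)); auto.
  - intros j Hj. rewrite coord_vscal, coord_basis by auto. ring.
Qed.

Lemma lin_form_vadd D v w : lin_form D (vadd v w) = lin_form D v + lin_form D w.
Proof. unfold lin_form. rewrite <- sumN_plus. apply sumN_ext; intros; rewrite coord_vadd; ring. Qed.

Definition bil_form (H : nat -> nat -> R) v w : R :=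
  sumN N (fun i => sumN N (fun l => H i l * coord v i * coord w l)).

Lemma bil_form_vadd_l H v w z : bil_form H (vadd v w) z = bil_form H v z + bil_form H w z.
Proof.
  unfold bil_form. rewrite <- sumN_plus. apply sumN_ext; intros. rewrite <- sumN_plus.
  apply sumN_ext; intros. rewrite coord_vadd; ring.
Qed.
Lemma bil_form_vadd_r H v w z : bil_form H z (vadd v w) = bil_form H z v + bil_form H z w.
Proof.
  unfold bil_form. rewrite <- sumN_plus. apply sumN_ext; intros. rewrite <- sumN_plus.
  apply sumN_ext; intros. rewrite coord_vadd; ring.
Qed.
Lemma bil_form_vscal_l H t v z : bil_form H (vscal t v) z = t * bil_form H v z.
Proof.
  unfold bil_form. rewrite <- sumN_scal. apply sumN_ext; intros. rewrite <- sumN_scal.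
  apply sumN_ext; intros. rewrite coord_vscal; ring.
Qed.
Lemma bil_form_vscal_r H t v z : bil_form H z (vscal t v) = t * bil_form H z v.
Proof.
  unfold bil_form. rewrite <- sumN_scal. apply sumN_ext; intros. rewrite <- sumN_scal.
  apply sumN_ext; intros. rewrite coord_vscal; ring.
Qed.
Lemma bil_form_sym H v w : (forall i l, H i l = H l i) -> bil_form H v w = bil_form H w v.
Proof.
  intros Hs. unfold bil_form. rewrite sumN_swap. apply sumN_ext; intros. apply sumN_ext; intros.
  rewrite Hs. ring.
Qed.
Lemma bil_form_basis_l H i v : (i < N)%nat -> bil_form H (basis i) v = sumN N (fun l => H i l * coord v l).
Proof.
  intros Hi. unfold bil_form.
  rewrite (sumN_ext _ _ (fun j => sumN N (fun l => H j l * coord v l) * (if Nat.eqb j i then 1 else 0))).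
  - apply (sumN_delta N i (fun j => sumN N (fun l => H j l * coord v l))); auto.
  - intros j Hj. rewrite (Rmult_comm (sumN _ _)), <- sumN_scal. apply sumN_ext; intros.
    rewrite coord_basis by auto. ring.
Qed.
Lemma bil_form_basis H i l : (i < N)%nat -> (l < N)%nat -> bil_form H (basis i) (basis l) = H i l.
Proof.
  intros Hi Hl. rewrite bil_form_basis_l by auto.
  rewrite (sumN_ext _ _ (fun j => H i j * (if Nat.eqb j l then 1 else 0))).
  - apply sumN_delta; auto.
  - intros; rewrite coord_basis by auto; reflexivity.
Qed.

(** D is an arbitrary family here; it is identified with derivatives by [expansion_deriv]. The
    radius / 4, like / 8 in [expand2], is the 1 / 2^(k+1) of [jets_exist]. *)
Definition expand1 (rho C : R) (f : RN N -> R) (D : nat -> RN N -> R) : Prop :=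
  (forall i x, (i < N)%nat -> nrm x <= rho -> Rabs (D i x) <= C) /\
  forall x v, nrm x <= rho -> 0 < nrm v <= / 4 ->
    Rabs (f (vadd x v) - f x - lin_form (fun i => D i x) v) <= C * (nrm v * Rpower (nrm v) alpha).

Lemma expansion_deriv x d0 C (f : RN N -> R) (D : nat -> R) i : 0 < d0 -> 0 <= C -> (i < N)%nat ->
  (forall v, 0 < nrm v <= d0 -> Rabs (f (vadd x v) - f x - lin_form D v) <= C * (nrm v * Rpower (nrm v) alpha)) ->
  is_derive (fun t => f (vadd x (vscal t (basis i)))) 0 (D i).
Proof.
  intros Hd0 HC Hi H. apply is_derive_Reals. intros e He.
  set (d := Rmin d0 (Rpower (e / (C + 1)) (/ alpha))).
  assert (Hq : 0 < e / (C + 1)) by (apply Rdiv_lt_0_compat; lra).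
  assert (Hd : 0 < d) by (apply Rmin_glb_lt; [lra|apply Rpower_pos]).
  exists (mkposreal d Hd). simpl. intros t Ht0 Ht. rewrite Rplus_0_l, vscal_0, vadd_vzero.
  pose proof (Rabs_pos_lt t Ht0) as Htp.
  assert (Hn : nrm (vscal t (@basis N i)) = Rabs t) by (rewrite nrm_vscal, nrm_basis by auto; ring).
  specialize (H (vscal t (basis i))). rewrite Hn, lin_form_basis in H by auto.
  assert (Hd1 : d <= d0) by apply Rmin_l.
  specialize (H ltac:(lra)).
  replace ((f (vadd x (vscal t (basis i))) - f x) / t - D i) with
    ((f (vadd x (vscal t (basis i))) - f x - t * D i) * / t) by (field; auto).
  rewrite Rabs_mult, Rabs_inv.
  apply Rmult_lt_reg_r with (Rabs t); auto. rewrite Rmult_assoc, Rinv_l, Rmult_1_r by lra.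
  eapply Rle_lt_trans; [apply H|].
  assert (Hom : Rpower (Rabs t) alpha <= e / (C + 1)).
  { apply Rle_trans with (Rpower (Rpower (e / (C + 1)) (/ alpha)) alpha).
    - apply Rle_Rpower_l; [lra|]. split; auto. left. eapply Rlt_le_trans; [apply Ht|apply Rmin_r].
    - rewrite Rpower_mult, Rinv_l, Rpower_1 by lra. lra. }
  pose proof (Rpower_pos (Rabs t) alpha).
  assert ((C + 1) * Rpower (Rabs t) alpha <= e).
  { replace e with ((C + 1) * (e / (C + 1))) by (field; lra). apply Rmult_le_compat_l; lra. }
  replace (C * (Rabs t * Rpower (Rabs t) alpha)) with (C * Rpower (Rabs t) alpha * Rabs t) by ring.
  apply Rmult_lt_compat_r; auto. lra.
Qed.

(** With t = |x - y|, the value at y + t e_i is expanded at x and at y, and the value at y is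
    expanded at x. The values of f cancel and t (D_i x - D_i y) remains. The increment of length at
    most 2 t contributes 4 of the 6. *)
Lemma expand1_hold rho C f D i : 0 <= C -> (i < N)%nat -> expand1 rho C f D ->
  hold rho (6 * C + 2 * C / om (/ 8)) (D i).
Proof.
  intros HC Hi [Hb H]. apply hold_of_local; auto; try lra.
  intros x y Hx Hy Hd. set (t := dist x y) in *. set (w := vsub y x).
  assert (Hw : nrm w = t) by (unfold w, t; rewrite <- dist_nrm, dist_sym; auto).
  assert (Ey : y = vadd x w) by (unfold w; rewrite vadd_vsub; auto).
  set (z := vscal t (@basis N i)).
  assert (Hz : nrm z = t) by (unfold z; rewrite nrm_vscal, nrm_basis, Rabs_pos_eq by (auto; lra); ring).
  pose proof (H x w Hx ltac:(lra)) as A1. pose proof (H y z Hy ltac:(lra)) as A2.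
  rewrite Hw in A1. rewrite Hz in A2.
  assert (A3 : Rabs (f (vadd x (vadd w z)) - f x - lin_form (fun i => D i x) (vadd w z)) <= C * (2 * t * (2 * om t))).
  { pose proof (nrm_vadd w z) as Hs. rewrite Hw, Hz in Hs. pose proof (om_double t ltac:(lra)) as Ho.
    destruct (Req_dec (nrm (vadd w z)) 0) as [E0|E0].
    - assert (vadd w z = vzero) as -> by (apply dist_eq0; rewrite dist_zero; auto).
      rewrite vadd_vzero. unfold lin_form. rewrite (sumN_ext _ _ (fun _ => 0)), sumN_const by (intros; rewrite coord_vzero; ring).
      rewrite Rmult_0_r, Rminus_0_r, Rminus_diag, Rabs_R0.
      pose proof (om_pos t). repeat apply Rmult_le_pos; lra.
    - pose proof (nrm_nonneg (vadd w z)).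
      eapply Rle_trans; [apply H; auto; lra|]. apply Rmult_le_compat_l; auto.
      apply Rmult_le_compat; try lra; [left; apply Rpower_pos|].
      eapply Rle_trans; [apply (om_mono _ (2 * t))|]; lra. }
  replace (vadd x (vadd w z)) with (vadd y z) in A3.
  2: { rewrite Ey. apply RN_ext; intros; rewrite !coord_vadd; ring. }
  rewrite lin_form_vadd in A3. unfold z in A2, A3. rewrite !lin_form_basis in A2, A3 by auto. fold z in A2, A3.
  rewrite <- Ey in A1. fold (om t) in A1, A2.
  apply Rabs_le_between in A1, A2, A3.
  assert (K : Rabs (t * (D i x - D i y)) <= t * (6 * C * om t)) by (apply Rabs_le; split; lra).
  rewrite Rabs_mult, (Rabs_pos_eq t) in K by lra.
  apply Rmult_le_reg_l with t; lra.
Qed.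

Definition expand2 (rho C : R) (f : RN N -> R) (D : nat -> RN N -> R) (H : nat -> nat -> RN N -> R) : Prop :=
  (forall i l x, (i < N)%nat -> (l < N)%nat -> nrm x <= rho -> Rabs (H i l x) <= C) /\
  (forall i l x, nrm x <= rho -> H i l x = H l i x) /\
  forall x v, nrm x <= rho -> 0 < nrm v <= / 8 ->
    Rabs (f (vadd x v) - f x - lin_form (fun i => D i x) v - / 2 * bil_form (fun i l => H i l x) v v)
    <= C * (nrm v ^ 2 * Rpower (nrm v) alpha).

(* Two quadratic approximations of f, centred at x and y, differ by O(t^(2+alpha)) on the ball of radius
   t = |x - y| around y; this bounds the coefficients of their difference. *)
Lemma expand2_compare rho C f D H x y : 0 <= C -> expand2 rho C f D H ->
  nrm x <= rho -> nrm y <= rho -> 0 < dist x y <= / 16 ->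
  forall z, nrm z <= dist x y ->
  Rabs ((f x - f y + lin_form (fun i => D i x) (vsub y x) + / 2 * bil_form (fun i l => H i l x) (vsub y x) (vsub y x))
    + (lin_form (fun i => D i x) z - lin_form (fun i => D i y) z + bil_form (fun i l => H i l x) (vsub y x) z)
    + / 2 * (bil_form (fun i l => H i l x) z z - bil_form (fun i l => H i l y) z z))
  <= 9 * C * (dist x y ^ 2 * om (dist x y)).
Proof.
  intros HC [_ [Hs H2]] Hx Hy Hd z Hz. set (t := dist x y) in *. set (w := vsub y x).
  assert (Hw : nrm w = t) by (unfold w, t; rewrite <- dist_nrm, dist_sym; auto).
  pose proof (om_pos t) as Hop.
  assert (G : forall x0 v s, nrm x0 <= rho -> nrm v <= s -> 0 < s <= / 8 ->
    Rabs (f (vadd x0 v) - f x0 - lin_form (fun i => D i x0) v - / 2 * bil_form (fun i l => H i l x0) v v)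
      <= C * (s ^ 2 * om s)).
  { intros x0 v s Hx0 Hv Hs0. destruct (Req_dec (nrm v) 0) as [E0|E0].
    - assert (v = vzero) as -> by (apply dist_eq0; rewrite dist_zero; auto).
      rewrite vadd_vzero. replace (bil_form _ vzero vzero) with 0.
      2: { symmetry. rewrite <- (vscal_0 (@vzero N)) at 1. rewrite bil_form_vscal_l. ring. }
      unfold lin_form. rewrite (sumN_ext _ _ (fun _ => 0)), sumN_const by (intros; rewrite coord_vzero; ring).
      rewrite !Rmult_0_r, !Rminus_0_r, Rminus_diag, Rabs_R0. pose proof (om_pos s).
      apply Rmult_le_pos; auto. apply Rmult_le_pos; [apply pow2_ge_0|lra].
    - pose proof (nrm_nonneg v).
      eapply Rle_trans; [apply H2; auto; lra|]. apply Rmult_le_compat_l; auto.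
      apply Rmult_le_compat; [apply pow2_ge_0|left; apply Rpower_pos|apply pow_incr; lra|apply om_mono; lra]. }
  assert (Hwz : nrm (vadd w z) <= 2 * t) by (eapply Rle_trans; [apply nrm_vadd|lra]).
  pose proof (G x (vadd w z) (2 * t) Hx Hwz ltac:(lra)) as A1.
  pose proof (G y z t Hy Hz ltac:(lra)) as A2.
  replace (vadd x (vadd w z)) with (vadd y z) in A1.
  2: { unfold w. apply RN_ext; intros; rewrite !coord_vadd, coord_vsub; ring. }
  rewrite lin_form_vadd, !bil_form_vadd_l, !bil_form_vadd_r in A1.
  rewrite (bil_form_sym _ z w) in A1 by (intros; apply Hs; auto).
  pose proof (om_double t ltac:(lra)) as Ho.
  assert (A1' : C * ((2 * t) ^ 2 * om (2 * t)) <= C * (8 * (t ^ 2 * om t))).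
  { apply Rmult_le_compat_l; auto. replace ((2 * t) ^ 2) with (4 * t ^ 2) by ring.
    pose proof (pow2_ge_0 t). nra. }
  match goal with |- Rabs ?G <= _ => replace G with
    ((f (vadd y z) - f y - lin_form (fun i => D i y) z - / 2 * bil_form (fun i l => H i l y) z z)
     - (f (vadd y z) - f x - (lin_form (fun i => D i x) w + lin_form (fun i => D i x) z)
        - / 2 * (bil_form (fun i l => H i l x) w w + bil_form (fun i l => H i l x) w z +
                 (bil_form (fun i l => H i l x) w z + bil_form (fun i l => H i l x) z z)))) by field end.
  eapply Rle_trans; [apply Rabs_triang|]. rewrite Rabs_Ropp. lra.
Qed.

(** Subtracting the estimates of [expand2_compare] at z = t e_i and z = - t e_i isolates the odd
    part of the quadratic polynomial in z. *)
Lemma expand2_grad rho C f D H x y i : 0 <= C -> (i < N)%nat -> expand2 rho C f D H ->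
  nrm x <= rho -> nrm y <= rho -> 0 < dist x y <= / 16 ->
  Rabs (D i y - D i x - lin_form (fun l => H i l x) (vsub y x)) <= 9 * C * (dist x y * om (dist x y)).
Proof.
  intros HC Hi HE Hx Hy Hd. set (t := dist x y) in *.
  pose proof (expand2_compare rho C f D H x y HC HE Hx Hy Hd) as G. fold t in G.
  assert (Hb : forall s, s = t \/ s = - t -> nrm (vscal s (@basis N i)) <= t).
  { intros s Hs. rewrite nrm_vscal, nrm_basis, Rmult_1_r by auto.
    destruct Hs; subst s; [|rewrite Rabs_Ropp]; rewrite Rabs_pos_eq; lra. }
  pose proof (G _ (Hb t (or_introl eq_refl))) as A1. pose proof (G _ (Hb (- t) (or_intror eq_refl))) as A2.
  destruct HE as [_ [Hs _]].
  rewrite !lin_form_basis, !bil_form_vscal_r, !bil_form_vscal_l in A1, A2 by auto.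
  rewrite (bil_form_sym _ _ (basis i)), bil_form_basis_l in A1, A2 by (auto; intros; apply Hs; auto).
  fold (lin_form (fun l => H i l x) (vsub y x)) in A1, A2.
  set (P := lin_form (fun l => H i l x) (vsub y x)) in *.
  apply Rabs_le_between in A1, A2.
  assert (K : Rabs (t * (D i y - D i x - P)) <= t * (9 * C * (t * om t))) by (apply Rabs_le; split; lra).
  rewrite Rabs_mult, (Rabs_pos_eq t) in K by lra. apply Rmult_le_reg_l with t; lra.
Qed.

(** The second difference over v, - v and 0 isolates the even part, with 36 = 4 * 9. Polarization
    with (t/2) (e_i + e_l) then costs (4 + 1 + 1) / 2 = 3, whence 108. *)
Lemma expand2_hess rho C f D H x y i l : 0 <= C -> (i < N)%nat -> (l < N)%nat -> expand2 rho C f D H ->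
  nrm x <= rho -> nrm y <= rho -> 0 < dist x y <= / 16 ->
  Rabs (H i l x - H i l y) <= 108 * C * om (dist x y).
Proof.
  intros HC Hi Hl HE Hx Hy Hd. set (t := dist x y) in *.
  pose proof (expand2_compare rho C f D H x y HC HE Hx Hy Hd) as G. fold t in G.
  destruct HE as [_ [Hs _]].
  set (K := fun v => bil_form (fun i l => H i l x) v v - bil_form (fun i l => H i l y) v v).
  assert (Q : forall v, nrm v <= t -> Rabs (K v) <= 36 * C * (t ^ 2 * om t)).
  { intros v Hv.
    assert (Hv' : nrm (vscal (-1) v) <= t) by (rewrite nrm_vscal, (Rabs_left1 (-1)) by lra; lra).
    assert (Hz : nrm (vscal 0 v) <= t) by (rewrite nrm_vscal, Rabs_R0; lra).
    pose proof (G v Hv) as A1. pose proof (G _ Hv') as A2. pose proof (G _ Hz) as A3.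
    assert (Ls : forall (E : nat -> R) s, lin_form E (vscal s v) = s * lin_form E v).
    { intros E s. unfold lin_form. rewrite <- sumN_scal. apply sumN_ext; intros; rewrite coord_vscal; ring. }
    rewrite !Ls, !bil_form_vscal_r, !bil_form_vscal_l in A2, A3.
    apply Rabs_le_between in A1, A2, A3. unfold K. apply Rabs_le. split; lra. }
  assert (B1 : forall k, (k < N)%nat -> nrm (vscal t (@basis N k)) <= t).
  { intros k Hk. rewrite nrm_vscal, nrm_basis, Rabs_pos_eq by (auto; lra). lra. }
  assert (B2 : nrm (vscal (t / 2) (vadd (@basis N i) (basis l))) <= t).
  { rewrite nrm_vscal, Rabs_pos_eq by lra. pose proof (nrm_vadd (@basis N i) (basis l)) as T.
    rewrite !nrm_basis in T by auto. nra. }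
  pose proof (Q _ (B1 i Hi)) as A1. pose proof (Q _ (B1 l Hl)) as A2. pose proof (Q _ B2) as A3.
  unfold K in A1, A2, A3.
  rewrite !bil_form_vscal_r, !bil_form_vscal_l in A1, A2, A3.
  rewrite !bil_form_vadd_l, !bil_form_vadd_r in A3.
  repeat rewrite bil_form_basis in A1 by auto. repeat rewrite bil_form_basis in A2 by auto.
  repeat rewrite bil_form_basis in A3 by auto.
  rewrite (Hs l i x Hx), (Hs l i y Hy) in A3.
  apply Rabs_le_between in A1, A2, A3.
  assert (Z : Rabs (t ^ 2 * (H i l x - H i l y)) <= t ^ 2 * (108 * C * om t)).
  { apply Rabs_le. split; lra. }
  assert (Ht2 : 0 < t ^ 2) by (apply pow_lt; lra).
  rewrite Rabs_mult, (Rabs_pos_eq (t ^ 2)) in Z by lra. apply Rmult_le_reg_l with (t ^ 2); lra.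
Qed.
End Hoelder.

(** * The approximating sequence *)

Definition srad (m : nat) : R := INR m + 1.
Definition sstep (m : nat) : R := / INR (S m).

Lemma srad_pos m : 0 < srad m.
Proof. unfold srad. pose proof (pos_INR m). lra. Qed.

Lemma sstep_pos m : 0 < sstep m.
Proof. apply Rinv_0_lt_compat, lt_0_INR; lia. Qed.

Lemma sstep_le_1 m : sstep m <= 1.
Proof. unfold sstep. rewrite <- Rinv_1. apply Rinv_le_contravar; [lra|]. apply (le_INR 1); lia. Qed.

Lemma srad_large r : exists m0, forall m, (m0 <= m)%nat -> r <= srad m.
Proof.
  destruct (INR_unbounded r) as [m0 H]. exists m0. intros m Hm. apply le_INR in Hm. unfold srad. lra.
Qed.

Section Sequence.
Variables (g : R -> R) (n : nat) (L : R).
Local Notation N := (n + 3)%nat.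
Hypothesis Hg : forall t, continuous g t.
Hypothesis Hgpos : forall t, 0 < g t.
Hypothesis HL1 : forall r, 0 <= r -> moment g r <= L.
Variables (a c : RN N -> R).
Hypothesis Ha : forall r, 0 < r -> unif_cont_on r a.
Hypothesis Hc : forall r, 0 < r -> unif_cont_on r c.
Hypothesis Hapos : forall x, 0 < a x.
Hypothesis Hcpos : forall x, 0 < c x.
Hypothesis Hag : forall x, a x <= g (nrm x).
Implicit Types x y v : RN N.

Let HN0 : (0 < N)%nat := Nat.lt_lt_add_l 0 3 n (Nat.lt_0_succ 2).

Lemma ball_min_pos (f : RN N -> R) r : 0 < r -> unif_cont_on r f -> (forall x, 0 < f x) ->
  exists m, 0 < m /\ forall x, nrm x <= r -> m <= f x.
Proof.
  intros Hr Hf Hpos. destruct (ball_max (fun x => - f x) r ltac:(lra)) as [x [_ H]].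
  - intros e He. destruct (Hf e He) as [d [Hd Q]]. exists d. split; auto.
    intros. replace (- f y - - f z) with (- (f y - f z)) by ring. rewrite Rabs_Ropp; auto.
  - exists (f x). split; auto. intros y Hy. specialize (H y Hy). lra.
Qed.

Definition residual (r h : R) (p : poly) x : R :=
  - lap p x + c x * upwind h (ext r p) x - a x.

(** The boundary value U(r) lies below the barrier 2 U(r). The tolerance min (sstep, a0 / 2) makes
    the residual both small and at most a/2, so - Lap p <= (3/2) a < 2 g and the radial barrier
    applies. *)
Lemma approx_member m : exists p,
  (forall x, nrm x <= srad m -> 0 < peval p x <= 2 * radU g n L (nrm x)) /\
  (exists eta, 0 < eta /\ forall x, nrm x <= srad m -> eta <= peval p x) /\
  forall x, nrm x <= srad m -> Rabs (residual (srad m) (sstep m) p x) <= sstep m /\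
    Rabs (residual (srad m) (sstep m) p x) <= a x / 2.
Proof.
  pose proof (srad_pos m) as Hr. pose proof (sstep_pos m) as Hh. set (r := srad m) in *.
  destruct (ball_min_pos a r Hr (Ha r Hr) Hapos) as [a0 [Ha0 Hamin]].
  pose proof (radU_pos g n L Hg Hgpos HL1 r Hr) as HU.
  destruct (approx_solution HN0 r (sstep m) (radU g n L r) (Rmin (sstep m) (a0 / 2)) a0
    (fun x => a (clip r x)) (fun x => c (clip r x))) as [p [H1 [H2 H3]]]; auto.
  - apply Rmin_glb_lt; lra.
  - apply unif_cont_clip; auto.
  - apply unif_cont_clip; auto.
  - intros x. apply Hamin, clip_nrm; auto.
  - intros x. left; auto.
  - exists p.
    assert (Hres : forall x, nrm x <= r -> Rabs (residual r (sstep m) p x) <= Rmin (sstep m) (a0 / 2)).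
    { intros x Hx. specialize (H3 x Hx). cbv beta in H3. rewrite clip_id in H3 by auto. exact H3. }
    assert (Hres2 : forall x, nrm x <= r -> Rabs (residual r (sstep m) p x) <= a x / 2).
    { intros x Hx. eapply Rle_trans; [apply Hres; auto|].
      eapply Rle_trans; [apply Rmin_r|]. specialize (Hamin x Hx). lra. }
    split; [|split].
    + intros x Hx. split; [specialize (H1 x Hx); lra|].
      apply (radial_barrier g n L Hg Hgpos p r (radU g n L r)); auto; [lra|].
      intros y Hy. specialize (Hres2 y Hy). unfold residual in Hres2. apply Rabs_le_between in Hres2.
      assert (0 <= c y * upwind (sstep m) (ext r p) y).
      { apply Rmult_le_pos; [left; auto|]. apply upwind_nonneg; auto. rewrite ext_in by auto.
        specialize (H1 y Hy). lra. }
      pose proof (Hag y). pose proof (Hapos y). lra.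
    + exists (radU g n L r). auto.
    + intros x Hx. split; [eapply Rle_trans; [apply Hres; auto|apply Rmin_l]|auto].
Qed.

Lemma approx_sequence : exists p : nat -> poly,
  (forall m x, nrm x <= srad m -> 0 < peval (p m) x <= 2 * radU g n L (nrm x)) /\
  (forall m x, nrm x <= srad m -> Rabs (residual (srad m) (sstep m) (p m) x) <= sstep m) /\
  forall rho, 0 < rho -> exists m0 delta, 0 < delta /\ forall m, (m0 <= m)%nat ->
    rho <= srad m /\ forall x, nrm x <= rho -> delta <= peval (p m) x.
Proof.
  destruct (choice _ approx_member) as [p Hp]. exists p. split; [|split].
  - intros m x Hx. apply Hp; auto.
  - intros m x Hx. apply Hp; auto.
  - intros rho Hrho.
    destruct (ball_min_pos a (2 * rho) ltac:(lra) (Ha (2 * rho) ltac:(lra)) Hapos) as [a0 [Ha0 Hamin]].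
    destruct (ball_max c (2 * rho) ltac:(lra) (Hc (2 * rho) ltac:(lra))) as [xc [_ Hcmax]].
    assert (HNR : 0 < INR N) by (apply lt_0_INR; auto).
    set (c1 := c xc) in *. assert (Hc1 : 0 < c1) by apply Hcpos.
    (* The barrier is used on the ball of radius 2 rho, so that on radius rho it is at least eps (3
       rho^2)^2. All these quantities depend on rho only, not on m. *)
    set (Q := (4 * INR N + 36 * c1 * INR N) * (2 * rho) ^ 2).
    assert (HQ : 0 < Q) by (unfold Q; apply Rmult_lt_0_compat; [nra|apply pow_lt; lra]).
    set (eps := a0 / 4 / Q). assert (Heps : 0 < eps) by (apply Rdiv_lt_0_compat; lra).
    destruct (srad_large (2 * rho)) as [m1 Hm1].
    destruct (inv_succ_small (2 * rho) ltac:(lra)) as [m2 Hm2].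
    exists (Nat.max m1 m2), (eps * (3 * rho ^ 2) ^ 2). split.
    { apply Rmult_lt_0_compat; auto. apply pow_lt. assert (0 < rho ^ 2) by (apply pow_lt; auto). lra. }
    intros m Hm. specialize (Hm1 m ltac:(lia)). specialize (Hm2 m ltac:(lia)). fold (sstep m) in Hm2.
    split; [lra|]. intros x Hx.
    destruct (Hp m) as [Hpos [[eta [Heta Hpe]] Hres]].
    pose proof (sstep_pos m) as Hh.
    assert (Hlow : eps * ((2 * rho) ^ 2 - nsq x) ^ 2 <= peval (p m) x).
    { apply (lower_barrier (srad m) (2 * rho) (sstep m) eta (a0 / 2) c1 eps (p m) c); auto; try lra.
      - intros y Hy. split; [left; auto|]. auto.
      - intros y Hy. destruct (Hres y ltac:(lra)) as [_ R2]. unfold residual in R2.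
        apply Rabs_le_between in R2. specialize (Hamin y Hy). lra.
      - fold Q. unfold eps. replace (a0 / 4 / Q * Q) with (a0 / 4) by (field; lra). lra. }
    eapply Rle_trans; [|apply Hlow]. apply Rmult_le_compat_l; [lra|].
    apply nrm_le_iff in Hx; [|lra]. pose proof (pow2_ge_0 rho). apply pow_incr. split; [lra|].
    replace ((2 * rho) ^ 2) with (4 * rho ^ 2) by ring. lra.
Qed.

Variable p : nat -> poly.
Hypothesis Hp1 : forall m x, nrm x <= srad m -> 0 < peval (p m) x <= 2 * radU g n L (nrm x).
Hypothesis Hp2 : forall m x, nrm x <= srad m -> Rabs (residual (srad m) (sstep m) (p m) x) <= sstep m.
Hypothesis Hp3 : forall rho, 0 < rho -> exists m0 delta, 0 < delta /\ forall m, (m0 <= m)%nat ->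
    rho <= srad m /\ forall x, nrm x <= rho -> delta <= peval (p m) x.

Definition ucap : R := 2 * radU g n L 0.

Lemma ucap_bound m x : nrm x <= srad m -> peval (p m) x <= ucap.
Proof.
  intros Hx. destruct (Hp1 m x Hx) as [_ H]. eapply Rle_trans; [apply H|].
  unfold ucap. apply Rmult_le_compat_l; [lra|]. apply radU_le_0; auto. apply nrm_nonneg.
Qed.

Lemma sequence_lipschitz rho : 0 < rho -> exists m0 delta K, 0 < delta /\ 0 <= K /\
  forall m, (m0 <= m)%nat -> rho + 3 <= srad m /\
    (forall x, nrm x <= rho + 3 -> delta <= peval (p m) x <= ucap) /\
    forall x y, nrm x <= rho -> nrm y <= rho -> Rabs (peval (p m) x - peval (p m) y) <= K * dist x y.
Proof.
  intros Hrho. destruct (Hp3 (rho + 3) ltac:(lra)) as [m0 [delta [Hd Hm]]].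
  destruct (ball_max c (rho + 3) ltac:(lra) (Hc (rho + 3) ltac:(lra))) as [xc [_ Hcmax]].
  destruct (ball_max a (rho + 3) ltac:(lra) (Ha (rho + 3) ltac:(lra))) as [xa [_ Hamax]].
  assert (Hucap : 0 < ucap).
  { assert (Hz : nrm (@vzero N) <= srad 0) by (rewrite nrm_vzero; left; apply srad_pos).
    pose proof (ucap_bound 0 vzero Hz). pose proof (Hp1 0 vzero Hz). lra. }
  pose proof (Hapos xa). pose proof (Hcpos xc).
  destruct (local_lipschitz HN0 delta ucap (a xa + 1) (c xc) Hd Hucap ltac:(lra) ltac:(lra)) as [K [HK Hlip]].
  exists m0, delta, K. split; auto. split; auto. intros m Hm0. destruct (Hm m Hm0) as [Hr Hlow].
  split; auto.
  assert (Hb : forall x, nrm x <= rho + 3 -> delta <= peval (p m) x <= ucap).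
  { intros x Hx. split; [auto|apply ucap_bound; lra]. }
  split; auto. apply (Hlip rho (srad m) (sstep m) (p m) c); auto.
  - split; [apply sstep_pos|apply sstep_le_1].
  - intros x Hx. split; [left; auto|auto].
  - intros x Hx. pose proof (Hp2 m x ltac:(lra)) as R2. unfold residual in R2.
    pose proof (sstep_le_1 m). pose proof (Hamax x Hx). pose proof (Hapos x).
    apply Rabs_le_between in R2. apply Rabs_le. lra.
Qed.
End Sequence.

(** * The limit *)

Section Limit.
Context {N : nat}.
Hypothesis HN0 : (0 < N)%nat.
Implicit Types x y v : RN N.
Variables (alpha M : R) (a c : RN N -> R) (p : nat -> poly).
Hypothesis Halpha : 0 < alpha < 1.
Hypothesis Ha : forall r, 0 < r -> exists K, 0 <= K /\ hold alpha r K a.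
Hypothesis Hc : forall r, 0 < r -> exists K, 0 <= K /\ hold alpha r K c.
Hypothesis Hab : forall r, 0 < r -> exists B, forall x, nrm x <= r -> Rabs (a x) <= B.
Hypothesis Hcb : forall r, 0 < r -> exists B, forall x, nrm x <= r -> Rabs (c x) <= B.
Hypothesis Hlip : forall rho, 0 < rho -> exists m0 delta K, 0 < delta /\ 0 <= K /\
  forall m, (m0 <= m)%nat -> rho + 3 <= srad m /\
    (forall x, nrm x <= rho + 3 -> delta <= peval (p m) x <= M) /\
    forall x y, nrm x <= rho -> nrm y <= rho -> Rabs (peval (p m) x - peval (p m) y) <= K * dist x y.
Hypothesis Hres : forall m x, nrm x <= srad m ->
  Rabs (- lap (p m) x + c x * upwind (sstep m) (ext (srad m) (p m)) x - a x) <= sstep m.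

Lemma usol_cap_pos : 0 < M.
Proof.
  destruct (Hlip 1 ltac:(lra)) as (m0 & delta & K & Hd & _ & H).
  destruct (H m0 (le_n m0)) as [_ [Hb _]]. specialize (Hb vzero). rewrite nrm_vzero in Hb. specialize (Hb ltac:(lra)). lra.
Qed.

Lemma nrm_ball x v rho : nrm x <= rho -> nrm v <= 1 -> nrm (vadd x v) <= rho + 1.
Proof. intros. eapply Rle_trans; [apply nrm_vadd|lra]. Qed.

Lemma vadd_comm x y : vadd x y = vadd y x.
Proof. apply RN_ext; intros; rewrite !coord_vadd; ring. Qed.

Lemma upwind_le_lipschitz h (w : RN N -> R) x delta K : 0 < h -> 0 < delta <= w x -> 0 <= K ->
  (forall i t, (i < N)%nat -> t = h \/ t = - h -> Rabs (w (vadd x (vscal t (basis i))) - w x) <= K * h) ->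
  upwind h w x <= INR N * (K ^ 2 / delta).
Proof.
  intros Hh Hd HK H. assert (Hh2 : 0 < h ^ 2) by (apply pow_lt; lra).
  unfold upwind. apply Rmult_le_reg_r with (h ^ 2); auto.
  unfold Rdiv at 1. rewrite Rmult_assoc, Rinv_l, Rmult_1_r by lra.
  rewrite Rmult_assoc, <- sumN_const. apply sumN_le. intros i Hi.
  assert (HX : 0 <= Rmax 0 (w x - low_nbr h w i x) <= K * h).
  { split; [apply Rmax_l|]. apply Rmax_lub; [apply Rmult_le_pos; lra|].
    pose proof (H i h Hi (or_introl eq_refl)) as B1. pose proof (H i (- h) Hi (or_intror eq_refl)) as B2.
    apply Rabs_le_between in B1, B2. unfold low_nbr, Rmin. destruct Rle_dec; lra. }
  apply Rle_trans with ((K * h) ^ 2 / delta).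
  - unfold Rdiv. apply Rmult_le_compat; [apply pow2_ge_0|left; apply Rinv_0_lt_compat; lra|apply pow_incr; auto|].
    apply Rinv_le_contravar; lra.
  - right. field. lra.
Qed.

Lemma sequence_lap_bound rho : 0 < rho -> exists m0 B, 0 <= B /\ forall m, (m0 <= m)%nat ->
  forall x, nrm x <= rho -> Rabs (lap (p m) x) <= B.
Proof.
  intros Hrho. destruct (Hlip (rho + 1) ltac:(lra)) as (m0 & delta & K & Hd & HK & H).
  destruct (Hab rho Hrho) as [a1 Ha1]. destruct (Hcb rho Hrho) as [c1 Hc1].
  assert (A0 : 0 <= a1).
  { eapply Rle_trans; [apply Rabs_pos|apply (Ha1 vzero)]. rewrite nrm_vzero; lra. }
  assert (C0 : 0 <= c1).
  { eapply Rle_trans; [apply Rabs_pos|apply (Hc1 vzero)]. rewrite nrm_vzero; lra. }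
  pose proof (pos_INR N) as HNR.
  assert (HKd : 0 <= K ^ 2 / delta) by (apply Rdiv_le_0_compat; auto; apply pow2_ge_0).
  exists m0, (c1 * (INR N * (K ^ 2 / delta)) + a1 + 1). split.
  { assert (0 <= c1 * (INR N * (K ^ 2 / delta))) by (apply Rmult_le_pos; auto; apply Rmult_le_pos; auto). lra. }
  intros m Hm x Hx. destruct (H m Hm) as [Hr [Hb HL]].
  pose proof (sstep_pos m) as Hh. pose proof (sstep_le_1 m) as Hh1.
  pose proof (Hb x ltac:(lra)) as Hbx.
  assert (Ex : ext (srad m) (p m) x = peval (p m) x) by (apply ext_in; [apply srad_pos|lra]).
  assert (Hup : upwind (sstep m) (ext (srad m) (p m)) x <= INR N * (K ^ 2 / delta)).
  { apply upwind_le_lipschitz; auto; [rewrite Ex; lra|]. intros i t Hi Ht.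
    assert (Hti : Rabs t = sstep m).
    { destruct Ht; subst t; [|rewrite Rabs_Ropp]; apply Rabs_pos_eq; lra. }
    assert (Hn : nrm (vadd x (vscal t (basis i))) <= rho + 1).
    { eapply Rle_trans; [apply nrm_vadd_basis; auto|lra]. }
    rewrite Ex, ext_in by (try apply srad_pos; lra).
    eapply Rle_trans; [apply HL; lra|]. rewrite dist_vadd, nrm_vscal, nrm_basis by auto. rewrite Hti. lra. }
  assert (Hup0 : 0 <= upwind (sstep m) (ext (srad m) (p m)) x) by (apply upwind_nonneg; auto; rewrite Ex; lra).
  pose proof (Hres m x ltac:(lra)) as R. pose proof (Ha1 x Hx) as Hax. pose proof (Hc1 x Hx) as Hcx.
  assert (Rabs (c x * upwind (sstep m) (ext (srad m) (p m)) x) <= c1 * (INR N * (K ^ 2 / delta))).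
  { rewrite Rabs_mult. apply Rmult_le_compat; auto using Rabs_pos. rewrite Rabs_pos_eq; auto. }
  apply Rabs_le_between in R, Hax, H0. apply Rabs_le. lra.
Qed.

(** A bounded Laplacian gives distance O(r^2) to harmonic polynomials on balls of radius r <= 1, and
    r^2 <= r^(1 + alpha). Uniqueness of derivatives identifies the coefficients of the expansion
    with the partial derivatives. *)
Lemma sequence_expand1 rho : 0 < rho -> exists m0 C, 0 <= C /\ forall m, (m0 <= m)%nat ->
  expand1 (N := N) alpha rho C (peval (p m)) (fun i => peval (pderiv i (p m))).
Proof.
  intros Hrho. assert (HNR : 0 < INR N) by (apply lt_0_INR; auto). pose proof usol_cap_pos as HM0.
  destruct (Hlip (rho + 1) ltac:(lra)) as (m1 & delta & K & Hd & HK & H1).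
  destruct (sequence_lap_bound (rho + 1) ltac:(lra)) as (m2 & B & HB & H2).
  assert (HBN : 0 <= B / (2 * INR N)) by (apply Rdiv_le_0_compat; lra).
  destruct (first_order_expansion HN0 alpha (B / (2 * INR N)) M Halpha HBN ltac:(lra)) as [C [HC HE]].
  exists (Nat.max m1 m2), C. split; auto. intros m Hm.
  destruct (H1 m ltac:(lia)) as [Hr [Hb HL]]. specialize (H2 m ltac:(lia)).
  assert (G : forall x, nrm x <= rho -> exists D : nat -> R, (forall i, (i < N)%nat -> Rabs (D i) <= C) /\
    forall v, 0 < nrm v <= / 4 ->
      Rabs (peval (p m) (vadd x v) - peval (p m) x - lin_form D v) <= C * (nrm v * Rpower (nrm v) alpha)).
  { intros x Hx. destruct (HE (fun v => peval (p m) (vadd x v))) as [D [HD1 HD2]].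
    - intros v Hv. pose proof (Hb (vadd x v)) as B1.
      pose proof (nrm_ball x v rho Hx Hv). specialize (B1 ltac:(lra)). rewrite Rabs_pos_eq; lra.
    - intros r Hr0. destruct (harmonic_approx_center HN0 (ptrans x (p m)) 0 B r HB ltac:(lra)) as [h [Hh1 Hh2]].
      + intros y Hy. rewrite lap_ptrans, Rminus_0_r. apply H2. rewrite vadd_comm. apply nrm_ball; auto. lra.
      + exists h. split; auto. intros y Hy. specialize (Hh2 y Hy).
        rewrite peval_ptrans, (vadd_comm y x) in Hh2.
        replace (0 / (2 * INR N) * nsq y) with 0 in Hh2 by (field; lra). rewrite Rminus_0_r in Hh2.
        eapply Rle_trans; [apply Hh2|]. replace (B * r ^ 2 / (2 * INR N)) with (B / (2 * INR N) * (r ^ 1 * r)) by (field; lra).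
        apply Rmult_le_compat_l; auto. apply Rmult_le_compat_l; [simpl; lra|]. apply om_ge; auto.
    - exists D. split; auto. intros v Hv. specialize (HD2 v Hv). rewrite vadd_vzero in HD2. exact HD2. }
  assert (E : forall x i D, (i < N)%nat -> (forall v, 0 < nrm v <= / 4 ->
      Rabs (peval (p m) (vadd x v) - peval (p m) x - lin_form D v) <= C * (nrm v * Rpower (nrm v) alpha)) ->
      D i = peval (pderiv i (p m)) x).
  { intros x i D Hi HD. pose proof (expansion_deriv alpha Halpha x (/ 4) C (peval (p m)) D i ltac:(lra) HC Hi HD) as D1.
    pose proof (peval_basis_deriv (p m) x i 0 Hi) as D2. rewrite vscal_0, vadd_vzero in D2.
    apply is_derive_unique in D1. apply is_derive_unique in D2. congruence. }
  split.
  - intros i x Hi Hx. destruct (G x Hx) as [D [HD1 HD2]]. rewrite <- (E x i D Hi HD2). auto.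
  - intros x v Hx Hv. destruct (G x Hx) as [D [HD1 HD2]].
    replace (lin_form (fun i => peval (pderiv i (p m)) x) v) with (lin_form D v); [apply HD2; auto|].
    apply sumN_ext. intros i Hi. rewrite (E x i D Hi HD2). reflexivity.
Qed.

Definition usol x : R := ulimit (fun m => peval (p m) x).
Definition ugrad (i : nat) x : R := ulimit (fun m => peval (pderiv i (p m)) x).

Lemma usol_lim x : ulim (fun m => peval (p m) x) (usol x).
Proof.
  pose proof (nrm_nonneg x). destruct (Hlip (nrm x + 1) ltac:(lra)) as (m0 & delta & K & Hd & _ & H1).
  apply (ulimit_spec _ M). eapply uf_mono; [|apply (uf_cofin m0)]. intros m Hm.
  destruct (H1 m Hm) as [_ [Hb _]]. specialize (Hb x ltac:(lra)). rewrite Rabs_pos_eq; lra.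
Qed.

Lemma ugrad_lim i x : (i < N)%nat -> ulim (fun m => peval (pderiv i (p m)) x) (ugrad i x).
Proof.
  intros Hi. pose proof (nrm_nonneg x).
  destruct (sequence_expand1 (nrm x + 1) ltac:(lra)) as (m0 & C & HC & H1).
  apply (ulimit_spec _ C). eapply uf_mono; [|apply (uf_cofin m0)]. intros m Hm.
  destruct (H1 m Hm) as [Hb _]. apply Hb; auto. lra.
Qed.

Lemma ulim_abs_le s l B : ulim s l -> ufilter (fun m => Rabs (s m) <= B) -> Rabs l <= B.
Proof.
  intros Hs HB. apply (ulim_le _ _ _ _ (ulim_cont Rabs _ _ (Rcontinuity_abs _) Hs) (ulim_const B)). exact HB.
Qed.

Lemma usol_bounds rho : 0 < rho -> exists delta K, 0 < delta /\ 0 <= K /\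
  (forall x, nrm x <= rho -> delta <= usol x <= M) /\
  forall x y, nrm x <= rho -> nrm y <= rho -> Rabs (usol x - usol y) <= K * dist x y.
Proof.
  intros Hrho. destruct (Hlip rho Hrho) as (m0 & delta & K & Hd & HK & H1).
  exists delta, K. do 2 (split; auto). split.
  - intros x Hx. split.
    + apply (ulim_le _ _ _ _ (ulim_const delta) (usol_lim x)). eapply uf_mono; [|apply (uf_cofin m0)].
      intros m Hm. destruct (H1 m Hm) as [_ [Hb _]]. apply Hb. lra.
    + apply (ulim_le _ _ _ _ (usol_lim x) (ulim_const M)). eapply uf_mono; [|apply (uf_cofin m0)].
      intros m Hm. destruct (H1 m Hm) as [_ [Hb _]]. apply Hb. lra.
  - intros x y Hx Hy. apply (ulim_abs_le _ _ _ (ulim_minus _ _ _ _ (usol_lim x) (usol_lim y))).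
    eapply uf_mono; [|apply (uf_cofin m0)]. intros m Hm. destruct (H1 m Hm) as [_ [_ HL]]. apply HL; auto.
Qed.

Lemma usol_expand1 rho : 0 < rho -> exists C, 0 <= C /\ expand1 alpha rho C usol ugrad.
Proof.
  intros Hrho. destruct (sequence_expand1 rho Hrho) as (m0 & C & HC & H1). exists C. split; auto. split.
  - intros i x Hi Hx. apply (ulim_abs_le _ _ _ (ugrad_lim i x Hi)).
    eapply uf_mono; [|apply (uf_cofin m0)]. intros m Hm. apply H1; auto.
  - intros x v Hx Hv.
    assert (T : ulim (fun m => peval (p m) (vadd x v) - peval (p m) x - lin_form (fun i => peval (pderiv i (p m)) x) v)
      (usol (vadd x v) - usol x - lin_form (fun i => ugrad i x) v)).
    { apply ulim_minus; [apply ulim_minus; apply usol_lim|].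
      apply (ulim_sumN N (fun i m => peval (pderiv i (p m)) x * coord v i)). intros i Hi.
      apply ulim_mult; [apply ugrad_lim; auto|apply ulim_const]. }
    apply (ulim_abs_le _ _ _ T). eapply uf_mono; [|apply (uf_cofin m0)]. intros m Hm. apply H1; auto.
Qed.

(** Pointwise convergence becomes uniform by the common Lipschitz bound: otherwise bad points for
    ultrafilter-many m would have a limit z, and convergence at z would be contradicted. *)
Lemma usol_uniform rho e : 0 < rho -> 0 < e ->
  ufilter (fun m => forall x, nrm x <= rho -> Rabs (peval (p m) x - usol x) <= e).
Proof.
  intros Hrho He. destruct (uf_or (fun m => forall x, nrm x <= rho -> Rabs (peval (p m) x - usol x) <= e)) as [|Hbad]; auto.
  exfalso.
  assert (Hx : forall m, exists x, nrm x <= rho /\ (~ (forall x, nrm x <= rho -> Rabs (peval (p m) x - usol x) <= e) ->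
    e < Rabs (peval (p m) x - usol x))).
  { intros m. destruct (classic (exists x, nrm x <= rho /\ e < Rabs (peval (p m) x - usol x))) as [[x [H1 H2]]|H].
    - exists x. auto.
    - exists vzero. rewrite nrm_vzero. split; [lra|]. intros K. exfalso. apply K. intros x Hx.
      destruct (Rle_or_lt (Rabs (peval (p m) x - usol x)) e); auto. exfalso; eauto. }
  apply choice in Hx. destruct Hx as [xs Hxs].
  destruct (ball_compact xs rho ltac:(intros; apply Hxs)) as [z [Hz Dz]].
  destruct (Hlip rho Hrho) as (m0 & delta & K & _ & HK & H1).
  destruct (usol_bounds rho Hrho) as (delta' & K' & _ & HK' & _ & H2).
  assert (Hq : 0 < e / (4 * (K + K' + 1))) by (apply Rdiv_lt_0_compat; lra).
  destruct (uf_ex _ (uf_and _ _ (uf_and _ _ Hbad (uf_cofin m0)) (uf_and _ _ (Dz _ Hq) (usol_lim z (e / 4) ltac:(lra)))))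
    as [m [[Hb Hm] [Hd Hl]]].
  destruct (Hxs m) as [Hxm Hxe]. specialize (Hxe Hb).
  rewrite Rminus_0_r, Rabs_pos_eq in Hd by apply dist_nonneg.
  destruct (H1 m Hm) as [_ [_ HL]]. specialize (HL (xs m) z Hxm Hz). specialize (H2 (xs m) z Hxm Hz).
  pose proof (dist_nonneg (xs m) z).
  assert (Hs : (K + K' + 1) * dist (xs m) z <= e / 4).
  { replace (e / 4) with ((K + K' + 1) * (e / (4 * (K + K' + 1)))) by (field; lra). apply Rmult_le_compat_l; lra. }
  assert (Rabs (peval (p m) (xs m) - usol (xs m)) <= K * dist (xs m) z + e / 4 + K' * dist (xs m) z).
  { replace (peval (p m) (xs m) - usol (xs m)) with
      ((peval (p m) (xs m) - peval (p m) z) + (peval (p m) z - usol z) - (usol (xs m) - usol z)) by ring.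
    eapply Rle_trans; [apply Rabs_triang|]. rewrite Rabs_Ropp.
    apply Rplus_le_compat; auto. eapply Rle_trans; [apply Rabs_triang|]. lra. }
  nra.
Qed.
Lemma om_le_1 t : 0 < t <= 1 -> Rpower t alpha <= 1.
Proof.
  intros Ht. assert (E : Rpower 1 alpha = 1) by (unfold Rpower; rewrite ln_1, Rmult_0_r; apply exp_0).
  rewrite <- E. apply Rle_Rpower_l; lra.
Qed.

Lemma sstep_small e : 0 < e -> exists m0, forall m, (m0 <= m)%nat -> sstep m <= e.
Proof.
  intros He. destruct (inv_succ_small e He) as [m0 H]. exists m0. intros m Hm. left. apply H; auto.
Qed.

(** The smaller of the two neighbours lies downhill, so the positive part of the difference is h
    |D_i| up to the error of [expand1], whatever the sign of D_i. Factoring the difference of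
    squares gives 3 C times that error. *)
Lemma upwind_close rho : 0 < rho -> exists m0 B, 0 <= B /\ forall m, (m0 <= m)%nat ->
  forall x, nrm x <= rho ->
  Rabs (upwind (sstep m) (ext (srad m) (p m)) x - / peval (p m) x * gradsq (p m) x) <= B * Rpower (sstep m) alpha.
Proof.
  intros Hrho. destruct (sequence_expand1 rho Hrho) as (m1 & C & HC & H1).
  destruct (Hlip rho Hrho) as (m2 & delta & K & Hd & _ & H2).
  destruct (sstep_small (/ 4) ltac:(lra)) as [m3 H3].
  pose proof (pos_INR N) as HNR.
  exists (Nat.max m1 (Nat.max m2 m3)), (INR N * (3 * C ^ 2 / delta)).
  assert (HCd : 0 <= 3 * C ^ 2 / delta) by (apply Rdiv_le_0_compat; auto; pose proof (pow2_ge_0 C); lra).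
  split; [apply Rmult_le_pos; auto|]. intros m Hm x Hx.
  destruct (H1 m ltac:(lia)) as [HD HE]. destruct (H2 m ltac:(lia)) as [Hr [Hb _]]. specialize (H3 m ltac:(lia)).
  pose proof (sstep_pos m) as Hh. set (h := sstep m) in *.
  assert (Ex : ext (srad m) (p m) x = peval (p m) x) by (apply ext_in; [apply srad_pos|lra]).
  pose proof (Hb x ltac:(lra)) as Hbx.
  pose proof (om_le_1 h ltac:(lra)) as Hom1. pose proof (Rpower_pos h alpha) as Hom0.
  set (om := Rpower h alpha) in *.
  replace (upwind h (ext (srad m) (p m)) x - / peval (p m) x * gradsq (p m) x) with
    (sumN N (fun i => / peval (p m) x * ((Rmax 0 (peval (p m) x - low_nbr h (ext (srad m) (p m)) i x) / h) ^ 2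
      - peval (pderiv i (p m)) x ^ 2))).
  2: { rewrite sumN_scal, sumN_minus. unfold upwind, gradsq. rewrite Ex.
       rewrite Rmult_minus_distr_l. f_equal. rewrite <- sumN_scal. unfold Rdiv at 2.
       rewrite Rmult_comm, <- sumN_scal. apply sumN_ext. intros i Hi. field. split; lra. }
  rewrite Rmult_assoc. apply sumN_abs_le. intros i Hi.
  set (D := peval (pderiv i (p m)) x). set (X := Rmax 0 (peval (p m) x - low_nbr h (ext (srad m) (p m)) i x)).
  assert (HDC : Rabs D <= C) by (apply HD; auto).
  assert (HX : Rabs (X - h * Rabs D) <= C * (h * om)).
  { assert (Nb : forall t, Rabs t = h -> ext (srad m) (p m) (vadd x (vscal t (basis i))) = peval (p m) (vadd x (vscal t (basis i)))).
    { intros t Ht. apply ext_in; [apply srad_pos|]. eapply Rle_trans; [apply nrm_vadd_basis; auto|]. lra. }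
    assert (Ah : Rabs h = h) by (apply Rabs_pos_eq; lra).
    assert (Ah' : Rabs (- h) = h) by (rewrite Rabs_Ropp; auto).
    pose proof (HE x (vscal h (basis i)) Hx) as E1. pose proof (HE x (vscal (- h) (basis i)) Hx) as E2.
    rewrite nrm_vscal, nrm_basis, Ah, lin_form_basis in E1 by auto.
    rewrite nrm_vscal, nrm_basis, Ah', lin_form_basis in E2 by auto.
    rewrite !Rmult_1_r in E1, E2. specialize (E1 ltac:(lra)). specialize (E2 ltac:(lra)). fold om D in E1, E2.
    apply Rabs_le_between in E1, E2.
    unfold X, low_nbr. rewrite (Nb h Ah), (Nb (- h) Ah').
    set (u1 := peval (p m) (vadd x (vscal h (basis i)))) in *.
    set (u2 := peval (p m) (vadd x (vscal (- h) (basis i)))) in *.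
    set (u0 := peval (p m) x) in *.
    assert (Hho : 0 <= C * (h * om)) by (apply Rmult_le_pos; auto; apply Rmult_le_pos; lra).
    assert (HhD : 0 <= h * Rabs D) by (apply Rmult_le_pos; [lra|apply Rabs_pos]).
    assert (HDs : (D = Rabs D) \/ (D = - Rabs D)) by (unfold Rabs; destruct Rcase_abs; lra).
    apply Rabs_le. unfold Rmin, Rmax.
    destruct HDs as [E|E]; rewrite E in E1, E2; destruct (Rle_dec u1 u2); destruct Rle_dec; split; lra. }
  assert (HXh : Rabs (X / h - Rabs D) <= C * om).
  { replace (X / h - Rabs D) with ((X - h * Rabs D) * / h) by (field; lra).
    rewrite Rabs_mult, (Rabs_pos_eq (/ h)) by (left; apply Rinv_0_lt_compat; auto).
    apply Rmult_le_reg_r with h; auto. rewrite Rmult_assoc, Rinv_l by lra. lra. }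
  assert (HX0 : 0 <= X / h) by (apply Rdiv_le_0_compat; auto; apply Rmax_l).
  rewrite Rabs_mult, (Rabs_pos_eq (/ _)) by (left; apply Rinv_0_lt_compat; lra).
  rewrite <- (pow2_abs D). replace ((X / h) ^ 2 - Rabs D ^ 2) with ((X / h - Rabs D) * (X / h + Rabs D)) by ring.
  rewrite Rabs_mult, (Rabs_pos_eq (X / h + Rabs D)) by (pose proof (Rabs_pos D); lra).
  assert (HCo : C * om <= C) by nra.
  assert (Hsum : X / h + Rabs D <= 3 * C) by (apply Rabs_le_between in HXh; lra).
  replace (3 * C ^ 2 / delta * om) with (/ delta * ((C * om) * (3 * C))) by (field; lra).
  apply Rmult_le_compat.
  - left; apply Rinv_0_lt_compat; lra.
  - apply Rmult_le_pos; [apply Rabs_pos|pose proof (Rabs_pos D); lra].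
  - apply Rinv_le_contravar; lra.
  - apply Rmult_le_compat; auto using Rabs_pos. pose proof (Rabs_pos D); lra.
Qed.

Definition gradterm (m : nat) x : R := c x * (/ peval (p m) x * gradsq (p m) x).

Lemma gradterm_hold rho : 0 < rho -> exists m0 B, 0 <= B /\ forall m, (m0 <= m)%nat ->
  hold alpha rho B (gradterm m) /\ forall x, nrm x <= rho -> Rabs (gradterm m x) <= B.
Proof.
  intros Hrho. destruct (sequence_expand1 rho Hrho) as (m1 & C & HC & H1).
  destruct (Hlip rho Hrho) as (m2 & delta & K & Hd & HK & H2).
  destruct (Hc rho Hrho) as [Kc [HKc Hch]]. destruct (Hcb rho Hrho) as [c1 Hc1].
  assert (C0 : 0 <= c1).
  { eapply Rle_trans; [apply Rabs_pos|apply (Hc1 vzero)]. rewrite nrm_vzero; lra. }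
  pose proof (pos_INR N) as HNR.
  set (C1 := 6 * C + 2 * C / Rpower (/ 8) alpha).
  assert (HC1 : 0 <= C1).
  { assert (0 <= 2 * C / Rpower (/ 8) alpha) by (apply Rdiv_le_0_compat; [lra|apply Rpower_pos]). unfold C1; lra. }
  set (B1 := K * (2 * rho + 1) / delta ^ 2).
  assert (HB1 : 0 <= B1) by (apply Rdiv_le_0_compat; [apply Rmult_le_pos; lra|apply pow_lt; auto]).
  set (B2 := INR N * (C1 * C + C * C1)).
  assert (HB2 : 0 <= B2) by (apply Rmult_le_pos; auto; nra).
  set (S1 := INR N * C ^ 2).
  assert (HS1 : 0 <= S1) by (apply Rmult_le_pos; auto; apply pow2_ge_0).
  assert (Hdi : 0 < / delta) by (apply Rinv_0_lt_compat; auto).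
  set (B3 := B1 * S1 + / delta * B2).
  assert (HB3 : 0 <= B3) by (unfold B3; nra).
  set (S3 := / delta * S1). assert (HS3 : 0 <= S3) by (unfold S3; nra).
  exists (Nat.max m1 m2), (Kc * S3 + c1 * B3 + c1 * S3). split; [nra|]. intros m Hm.
  destruct (H1 m ltac:(lia)) as [HD HE]. destruct (H2 m ltac:(lia)) as [Hr [Hb HL]].
  assert (HDb : forall i, (i < N)%nat -> forall x, nrm x <= rho -> Rabs (peval (pderiv i (p m)) x) <= C) by auto.
  assert (G1 : hold alpha rho B1 (fun x : RN N => / peval (p m) x)).
  { apply hold_inv; auto; [apply Rmult_le_pos; lra|intros x Hx; apply Hb; lra|].
    apply hold_lip; auto; lra. }
  assert (G2 : hold alpha rho B2 (gradsq (N := N) (p m))).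
  { assert (Gs : hold alpha rho B2 (fun x => sumN N (fun i => peval (pderiv i (p m)) x * peval (pderiv i (p m)) x))).
    { apply hold_sumN. intros i Hi. apply hold_mult; auto;
      apply (expand1_hold alpha Halpha rho C (peval (p m)) (fun i => peval (pderiv i (p m)))); auto; split; auto. }
    intros x y Hx Hy Hxy. specialize (Gs x y Hx Hy Hxy).
    unfold gradsq.
    rewrite (sumN_ext _ (fun i => peval (pderiv i (p m)) x ^ 2)
      (fun i => peval (pderiv i (p m)) x * peval (pderiv i (p m)) x)) by (intros; ring).
    rewrite (sumN_ext _ (fun i => peval (pderiv i (p m)) y ^ 2)
      (fun i => peval (pderiv i (p m)) y * peval (pderiv i (p m)) y)) by (intros; ring).
    exact Gs. }
  assert (I1 : forall x : RN N, nrm x <= rho -> Rabs (/ peval (p m) x) <= / delta).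
  { intros x Hx. specialize (Hb x ltac:(lra)). rewrite Rabs_pos_eq by (left; apply Rinv_0_lt_compat; lra).
    apply Rinv_le_contravar; lra. }
  assert (I2 : forall x : RN N, nrm x <= rho -> Rabs (gradsq (p m) x) <= S1).
  { intros x Hx. apply sumN_abs_le. intros i Hi. rewrite <- RPow_abs. apply pow_incr. split; [apply Rabs_pos|auto]. }
  assert (I3 : forall x : RN N, nrm x <= rho -> Rabs (/ peval (p m) x * gradsq (p m) x) <= S3).
  { intros x Hx. rewrite Rabs_mult. apply Rmult_le_compat; auto using Rabs_pos. }
  assert (G3 : hold alpha rho B3 (fun x : RN N => / peval (p m) x * gradsq (p m) x)) by (apply hold_mult; auto).
  split.
  - apply (hold_weaken alpha rho (Kc * S3 + c1 * B3)); [nra|].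
    apply (hold_mult alpha rho c1 S3 Kc B3 c); auto.
  - intros x Hx. unfold gradterm. rewrite Rabs_mult.
    assert (Rabs (c x) * Rabs (/ peval (p m) x * gradsq (p m) x) <= c1 * S3) by (apply Rmult_le_compat; auto using Rabs_pos).
    nra.
Qed.

(** The Laplacian that u should have according to the equation. It is defined from first derivatives
    only, before second derivatives of u are known to exist; [uhess_trace] confirms it. *)
Definition ulap x : R := c x * (/ usol x * sumN N (fun i => ugrad i x ^ 2)) - a x.

Lemma gradterm_lim x : ulim (fun m => gradterm m x) (ulap x + a x).
Proof.
  unfold ulap. replace (_ - a x + a x) with (c x * (/ usol x * sumN N (fun i => ugrad i x ^ 2))) by ring.
  apply ulim_mult; [apply ulim_const|]. apply ulim_mult.
  - apply (ulim_cont Rinv); [|apply usol_lim].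
    pose proof (nrm_nonneg x). destruct (usol_bounds (nrm x + 1) ltac:(lra)) as (delta & K & Hd & _ & Hb & _).
    specialize (Hb x ltac:(lra)).
    apply (continuity_pt_inv id (usol x)); [apply derivable_continuous_pt, derivable_pt_id|unfold id; lra].
  - apply (ulim_sumN N (fun i m => peval (pderiv i (p m)) x ^ 2)). intros i Hi. apply ulim_sqr, ugrad_lim; auto.
Qed.

Lemma ulap_bounded rho : 0 < rho -> exists B, 0 <= B /\ forall x, nrm x <= rho -> Rabs (ulap x) <= B.
Proof.
  intros Hrho. destruct (gradterm_hold rho Hrho) as (m0 & B & HB & H1). destruct (Hab rho Hrho) as [a1 Ha1].
  assert (A0 : 0 <= a1).
  { eapply Rle_trans; [apply Rabs_pos|apply (Ha1 vzero)]. rewrite nrm_vzero; lra. }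
  exists (B + a1). split; [lra|]. intros x Hx.
  assert (Rabs (ulap x + a x) <= B).
  { apply (ulim_abs_le _ _ _ (gradterm_lim x)). eapply uf_mono; [|apply (uf_cofin m0)].
    intros m Hm. apply H1; auto. }
  specialize (Ha1 x Hx). replace (ulap x) with ((ulap x + a x) - a x) by ring.
  eapply Rle_trans; [apply Rabs_triang|]. rewrite Rabs_Ropp. lra.
Qed.

Lemma hold_ball rho B f x0 x r : 0 <= B -> hold alpha rho B f -> nrm x0 <= rho -> nrm x <= rho ->
  0 < r -> dist x x0 <= r -> Rabs (f x - f x0) <= B * Rpower r alpha.
Proof.
  intros HB Hf Hx0 Hx Hr Hd. pose proof (Rpower_pos r alpha). destruct (dist_nonneg x x0) as [Hp|E].
  - eapply Rle_trans; [apply Hf; auto|]. apply Rmult_le_compat_l; auto. apply Rle_Rpower_l; lra.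
  - symmetry in E. apply dist_eq0 in E. subst. rewrite Rminus_diag, Rabs_R0. apply Rmult_le_pos; lra.
Qed.

(** B is uniform while the set of admissible m depends on x0 and r: m must be so large that the step
    is at most r, which turns the discretization error into O(r^alpha), and that the gradient term
    at x0 is within r^alpha of its limit. *)
Lemma lap_close rho : 0 < rho -> exists B, 0 <= B /\ forall x0 r, nrm x0 <= rho -> 0 < r <= 1 ->
  ufilter (fun m => forall x, dist x x0 <= r -> Rabs (lap (p m) x - ulap x0) <= B * Rpower r alpha).
Proof.
  intros Hrho.
  destruct (upwind_close (rho + 1) ltac:(lra)) as (m1 & B1 & HB1 & H1).
  destruct (gradterm_hold (rho + 1) ltac:(lra)) as (m2 & B2 & HB2 & H2).
  destruct (Ha (rho + 1) ltac:(lra)) as [Ka [HKa Hah]].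
  destruct (Hcb (rho + 1) ltac:(lra)) as [c1 Hc1].
  assert (C0 : 0 <= c1).
  { eapply Rle_trans; [apply Rabs_pos|apply (Hc1 vzero)]. rewrite nrm_vzero; lra. }
  exists (c1 * B1 + B2 + Ka + 2). split; [nra|]. intros x0 r Hx0 Hr.
  destruct (sstep_small r (proj1 Hr)) as [m3 H3].
  destruct (srad_large (rho + 1)) as [m4 H4].
  pose proof (Rpower_pos r alpha) as Hom.
  eapply uf_mono; [|apply (uf_and _ _ (uf_cofin (Nat.max (Nat.max m1 m2) (Nat.max m3 m4))) (gradterm_lim x0 _ Hom))].
  intros m [Hm Hlim] x Hd.
  assert (Hx : nrm x <= rho + 1) by (pose proof (nrm_dist x x0); lra).
  specialize (H1 m ltac:(lia) x Hx). destruct (H2 m ltac:(lia)) as [G _].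
  specialize (H3 m ltac:(lia)). specialize (H4 m ltac:(lia)).
  pose proof (hold_ball (rho + 1) B2 (gradterm m) x0 x r HB2 G ltac:(lra) Hx (proj1 Hr) Hd) as D1.
  pose proof (hold_ball (rho + 1) Ka a x0 x r HKa Hah ltac:(lra) Hx (proj1 Hr) Hd) as D2.
  pose proof (Hres m x ltac:(lra)) as D3. pose proof (sstep_pos m) as Hh.
  assert (Hoh : Rpower (sstep m) alpha <= Rpower r alpha) by (apply Rle_Rpower_l; lra).
  assert (Hhh : sstep m <= Rpower r alpha) by (pose proof (om_ge alpha Halpha (sstep m) ltac:(lra)); lra).
  set (W := upwind (sstep m) (ext (srad m) (p m)) x) in *.
  assert (D4 : Rabs (c x * W - gradterm m x) <= c1 * (B1 * Rpower r alpha)).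
  { unfold gradterm. rewrite <- Rmult_minus_distr_l, Rabs_mult.
    apply Rmult_le_compat; auto using Rabs_pos.
    eapply Rle_trans; [apply H1|]. apply Rmult_le_compat_l; auto. }
  apply Rabs_le_between in D1, D2, D3, D4. apply Rabs_lt_between in Hlim. apply Rabs_le. lra.
Qed.

Lemma bil_form_bound (H : nat -> nat -> R) C v : 0 <= C ->
  (forall i l, (i < N)%nat -> (l < N)%nat -> Rabs (H i l) <= C) ->
  Rabs (bil_form H v v) <= INR N * (INR N * C) * nrm v ^ 2.
Proof.
  intros HC Hb. replace (INR N * (INR N * C) * nrm v ^ 2) with (INR N * (INR N * (C * nrm v ^ 2))) by ring.
  apply sumN_abs_le. intros i Hi. apply sumN_abs_le. intros l Hl. rewrite !Rabs_mult.
  replace (C * nrm v ^ 2) with (C * nrm v * nrm v) by ring.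
  apply Rmult_le_compat; auto using Rabs_pos, coord_le_nrm.
  - apply Rmult_le_pos; apply Rabs_pos.
  - apply Rmult_le_compat; auto using Rabs_pos, coord_le_nrm.
Qed.

Lemma bil_form_diag (H : nat -> nat -> R) k v :
  bil_form (fun i l => H i l + (if Nat.eqb i l then k else 0)) v v = bil_form H v v + k * nsq v.
Proof.
  unfold bil_form, nsq. rewrite <- sumN_scal, <- sumN_plus. apply sumN_ext. intros i Hi.
  rewrite (sumN_ext _ _ (fun l => H i l * coord v i * coord v l + (k * coord v i * coord v l) * (if Nat.eqb l i then 1 else 0))).
  - rewrite sumN_plus. rewrite (sumN_delta N i (fun l => k * coord v i * coord v l)) by auto. ring.
  - intros l Hl. rewrite (Nat.eqb_sym l i). destruct (Nat.eqb i l); ring.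
Qed.

(** After subtraction of k |v|^2, with 2 N k = [ulap] x0, the limit u is within O(r^(2 + alpha)) of
    harmonic polynomials around x0, so the second-order theory applies to u itself although no
    second-order bound is known for the approximations. *)
Lemma usol_expand2 rho : 0 < rho -> exists C H, 0 <= C /\ expand2 alpha rho C usol ugrad H /\
  forall x, nrm x <= rho -> sumN N (fun i => H i i x) = ulap x.
Proof.
  intros Hrho. assert (HNR : 0 < INR N) by (apply lt_0_INR; auto). pose proof usol_cap_pos as HM0.
  destruct (lap_close rho Hrho) as [B [HB H1]]. destruct (ulap_bounded rho Hrho) as [F1 [HF0 HF1]].
  destruct (usol_bounds (rho + 1) ltac:(lra)) as (delta & K & Hd & _ & Hub & _).
  destruct (usol_expand1 rho Hrho) as [C1 [HC1 [_ HE1]]].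
  set (A := B / (2 * INR N) + 1). assert (HBN : 0 <= B / (2 * INR N)) by (apply Rdiv_le_0_compat; lra).
  assert (HFN : 0 <= F1 / (2 * INR N)) by (apply Rdiv_le_0_compat; lra).
  destruct (second_order_expansion HN0 alpha A (M + F1 / (2 * INR N)) Halpha ltac:(unfold A; lra) ltac:(lra)) as [C [HC HE]].
  assert (G : forall x0, nrm x0 <= rho -> exists H : nat -> nat -> R,
    (forall i l, (i < N)%nat -> (l < N)%nat -> Rabs (H i l) <= C + F1 / INR N) /\
    (forall i l, H i l = H l i) /\ sumN N (fun i => H i i) = ulap x0 /\
    forall v, 0 < nrm v <= / 8 ->
      Rabs (usol (vadd x0 v) - usol x0 - lin_form (fun i => ugrad i x0) v - / 2 * bil_form H v v)
      <= C * (nrm v ^ 2 * Rpower (nrm v) alpha)).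
  { intros x0 Hx0. set (k := ulap x0 / (2 * INR N)).
    assert (Hk : Rabs k <= F1 / (2 * INR N)).
    { unfold k, Rdiv. rewrite Rabs_mult, (Rabs_pos_eq (/ _)) by (left; apply Rinv_0_lt_compat; lra).
      apply Rmult_le_compat_r; [left; apply Rinv_0_lt_compat; lra|auto]. }
    destruct (HE (fun v => usol (vadd x0 v) - k * nsq v)) as (D & H & HD & HHb & Hsym & Htr & Hexp).
    - intros v Hv. pose proof (Hub (vadd x0 v) (nrm_ball x0 v rho Hx0 Hv)) as B1.
      pose proof (nrm_nonneg v) as Hv0. pose proof (nsq_nonneg v) as Hs0.
      assert (Hs1 : nsq v <= 1) by (rewrite <- nrm_sqr, <- (pow1 2); apply pow_incr; lra).
      eapply Rle_trans; [apply Rabs_triang|]. rewrite Rabs_Ropp, Rabs_mult, (Rabs_pos_eq (nsq v)) by auto.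
      rewrite Rabs_pos_eq by lra. apply Rplus_le_compat; [lra|]. pose proof (Rabs_pos k). nra.
    - intros r Hr. pose proof (Rpower_pos r alpha) as Hom.
      assert (Hr2 : 0 < r ^ 2) by (apply pow_lt; lra).
      assert (Her : 0 < r ^ 2 * Rpower r alpha) by (apply Rmult_lt_0_compat; auto).
      (* An m adapted to the scale r: its Laplacian is nearly constant on the ball, and it is within
         r^(2 + alpha) of u. *)
      destruct (uf_ex _ (uf_and _ _ (H1 x0 r Hx0 Hr) (usol_uniform (rho + 1) _ ltac:(lra) Her))) as [m [L1 L2]].
      destruct (harmonic_approx_center HN0 (ptrans x0 (p m)) (ulap x0) (B * Rpower r alpha) r) as [h [Hh1 Hh2]].
      + apply Rmult_le_pos; lra.
      + lra.
      + intros y Hy. rewrite lap_ptrans, vadd_comm. apply L1. rewrite dist_vadd. lra.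
      + exists h. split; auto. intros y Hy. specialize (Hh2 y Hy).
        rewrite peval_ptrans, (vadd_comm y x0) in Hh2. fold k in Hh2.
        specialize (L2 (vadd x0 y) (nrm_ball x0 y rho Hx0 ltac:(lra))).
        replace (usol (vadd x0 y) - k * nsq y - peval h y) with
          ((peval (p m) (vadd x0 y) - k * nsq y - peval h y) - (peval (p m) (vadd x0 y) - usol (vadd x0 y))) by ring.
        eapply Rle_trans; [apply Rabs_triang|]. rewrite Rabs_Ropp. unfold A.
        replace (B * Rpower r alpha * r ^ 2 / (2 * INR N)) with (B / (2 * INR N) * (r ^ 2 * Rpower r alpha)) in Hh2 by (field; lra).
        lra.
    (* Puts the subtracted quadratic back; the traceless part H becomes a matrix of trace [ulap]
       x0. *)
    - set (H' := fun i l => H i l + (if Nat.eqb i l then ulap x0 / INR N else 0)).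
      assert (Hexp' : forall v, 0 < nrm v <= / 8 ->
        Rabs (usol (vadd x0 v) - usol x0 - lin_form D v - / 2 * bil_form H' v v)
          <= C * (nrm v ^ 2 * Rpower (nrm v) alpha)).
      { intros v Hv. specialize (Hexp v Hv). rewrite vadd_vzero, nsq_vzero in Hexp.
        unfold H'. rewrite bil_form_diag.
        replace (usol (vadd x0 v) - usol x0 - lin_form D v - / 2 * (bil_form H v v + ulap x0 / INR N * nsq v))
          with (usol (vadd x0 v) - k * nsq v - (usol x0 - k * 0) - lin_form D v - / 2 * bil_form H v v); [exact Hexp|].
        unfold k. field. lra. }
      assert (HB' : forall i l, (i < N)%nat -> (l < N)%nat -> Rabs (H' i l) <= C + F1 / INR N).
      { intros i l Hi Hl. unfold H'. eapply Rle_trans; [apply Rabs_triang|].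
        apply Rplus_le_compat; [auto|].
        assert (HFN' : 0 <= F1 / INR N) by (apply Rdiv_le_0_compat; lra).
        destruct (Nat.eqb i l); [|rewrite Rabs_R0; auto].
        unfold Rdiv. rewrite Rabs_mult, (Rabs_pos_eq (/ _)) by (left; apply Rinv_0_lt_compat; lra).
        apply Rmult_le_compat_r; [left; apply Rinv_0_lt_compat; lra|auto]. }
      assert (HC2 : 0 <= C + F1 / INR N).
      { assert (0 <= F1 / INR N) by (apply Rdiv_le_0_compat; lra). lra. }
      (* With its quadratic part absorbed in the error, the new expansion is a first-order one, and
         both linear parts are derivatives of u at x0. *)
      assert (HDu : forall i, (i < N)%nat -> D i = ugrad i x0).
      { intros i Hi. set (C3 := C + / 2 * (INR N * (INR N * (C + F1 / INR N)))).
        assert (HC3 : 0 <= C3).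
        { unfold C3. assert (0 <= INR N * (INR N * (C + F1 / INR N))) by (repeat apply Rmult_le_pos; lra). lra. }
        assert (T1 : forall v, 0 < nrm v <= / 8 ->
          Rabs (usol (vadd x0 v) - usol x0 - lin_form D v) <= C3 * (nrm v * Rpower (nrm v) alpha)).
        { intros v Hv. specialize (Hexp' v Hv). pose proof (bil_form_bound H' _ v HC2 HB') as Hq.
          pose proof (om_ge alpha Halpha (nrm v) ltac:(lra)) as Ho. pose proof (om_le_1 (nrm v) ltac:(lra)) as Ho1.
          set (o := Rpower (nrm v) alpha) in *. set (t := nrm v) in *.
          assert (Q1 : t ^ 2 * o <= t * o) by (simpl; nra).
          assert (Q2 : t ^ 2 <= t * o) by (simpl; nra).
          replace (usol (vadd x0 v) - usol x0 - lin_form D v) with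
            ((usol (vadd x0 v) - usol x0 - lin_form D v - / 2 * bil_form H' v v) + / 2 * bil_form H' v v) by ring.
          eapply Rle_trans; [apply Rabs_triang|]. rewrite (Rabs_mult (/ 2)), (Rabs_pos_eq (/ 2)) by lra.
          set (E := INR N * (INR N * (C + F1 / INR N))) in *.
          assert (HE0 : 0 <= E) by (unfold E; repeat apply Rmult_le_pos; lra).
          unfold C3. fold E.
          assert (C * (t ^ 2 * o) <= C * (t * o)) by (apply Rmult_le_compat_l; auto).
          assert (E * t ^ 2 <= E * (t * o)) by (apply Rmult_le_compat_l; auto). lra. }
        pose proof (expansion_deriv alpha Halpha x0 (/ 8) C3 usol D i ltac:(lra) HC3 Hi T1) as D1.
        pose proof (expansion_deriv alpha Halpha x0 (/ 4) C1 usol (fun i => ugrad i x0) i ltac:(lra) HC1 Hi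
          (fun v Hv => HE1 x0 v Hx0 Hv)) as D2.
        apply is_derive_unique in D1. apply is_derive_unique in D2. congruence. }
      exists H'. split; [auto|]. split; [|split].
      + intros i l. unfold H'. rewrite Hsym, Nat.eqb_sym. reflexivity.
      + unfold H'. rewrite sumN_plus, Htr.
        rewrite (sumN_ext _ _ (fun _ => ulap x0 / INR N)) by (intros; rewrite Nat.eqb_refl; auto).
        rewrite sumN_const. field. lra.
      + intros v Hv. specialize (Hexp' v Hv).
        replace (lin_form (fun i => ugrad i x0) v) with (lin_form D v); auto.
        apply sumN_ext. intros i Hi. rewrite HDu; auto. }
  assert (G' : forall x0, exists H : nat -> nat -> R, nrm x0 <= rho ->
    (forall i l, (i < N)%nat -> (l < N)%nat -> Rabs (H i l) <= C + F1 / INR N) /\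
    (forall i l, H i l = H l i) /\ sumN N (fun i => H i i) = ulap x0 /\
    forall v, 0 < nrm v <= / 8 ->
      Rabs (usol (vadd x0 v) - usol x0 - lin_form (fun i => ugrad i x0) v - / 2 * bil_form H v v)
      <= C * (nrm v ^ 2 * Rpower (nrm v) alpha)).
  { intros x0. destruct (Rle_dec (nrm x0) rho) as [Hx|Hx].
    - destruct (G x0 Hx) as [H HH]. exists H. auto.
    - exists (fun _ _ => 0). intros; contradiction. }
  apply choice in G'. destruct G' as [H HH].
  assert (HFN' : 0 <= F1 / INR N) by (apply Rdiv_le_0_compat; lra).
  exists (C + F1 / INR N), (fun i l x => H x i l). split; [lra|]. split; [split; [|split]|].
  - intros i l x Hi Hl Hx. apply HH; auto.
  - intros i l x Hx. apply HH; auto.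
  - intros x v Hx Hv. eapply Rle_trans; [apply HH; auto|]. apply Rmult_le_compat_r; [|lra].
    apply Rmult_le_pos; [apply pow2_ge_0|left; apply Rpower_pos].
  - intros x Hx. apply HH; auto.
Qed.

(** The matrix in [usol_expand2] depends on the chosen radius; a definition by [Derive] gives one
    function on the whole space that agrees with all of them. *)
Definition uhess (i j : nat) x : R := Derive (fun t => ugrad i (vadd x (vscal t (basis j)))) 0.

Lemma expand2_hess_deriv rho C H i j x : 0 <= C -> expand2 alpha (rho + 1) C usol ugrad H ->
  nrm x <= rho -> (i < N)%nat -> (j < N)%nat ->
  is_derive (fun t => ugrad i (vadd x (vscal t (basis j)))) 0 (H i j x).
Proof.
  intros HC HE Hx Hi Hj.
  apply (expansion_deriv alpha Halpha x (/ 16) (9 * C) (ugrad i) (fun l => H i l x) j); auto; try lra.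
  intros v Hv.
  pose proof (expand2_grad alpha Halpha (rho + 1) C usol ugrad H x (vadd x v) i HC Hi HE ltac:(lra)
    (nrm_ball x v rho Hx ltac:(lra))) as K.
  rewrite (dist_sym x), dist_vadd in K. specialize (K Hv).
  replace (vsub (vadd x v) x) with v in K; [exact K|].
  apply RN_ext; intros; rewrite coord_vsub, coord_vadd; ring.
Qed.

Lemma uhess_deriv i j x : (i < N)%nat -> (j < N)%nat ->
  is_derive (fun t => ugrad i (vadd x (vscal t (basis j)))) 0 (uhess i j x).
Proof.
  intros Hi Hj. pose proof (nrm_nonneg x).
  destruct (usol_expand2 (nrm x + 1 + 1) ltac:(lra)) as (C & H' & HC & HE & _).
  pose proof (expand2_hess_deriv (nrm x + 1) C H' i j x HC HE ltac:(lra) Hi Hj) as K.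
  replace (uhess i j x) with (H' i j x); [exact K|]. symmetry. apply is_derive_unique, K.
Qed.

Lemma ugrad_deriv i x : (i < N)%nat -> is_derive (fun t => usol (vadd x (vscal t (basis i)))) 0 (ugrad i x).
Proof.
  intros Hi. pose proof (nrm_nonneg x). destruct (usol_expand1 (nrm x + 1) ltac:(lra)) as [C [HC [_ HE]]].
  apply (expansion_deriv alpha Halpha x (/ 4) C usol (fun i => ugrad i x) i); auto; try lra.
  intros v Hv. apply HE; auto. lra.
Qed.

Lemma uhess_trace x : sumN N (fun i => uhess i i x) = ulap x.
Proof.
  pose proof (nrm_nonneg x).
  destruct (usol_expand2 (nrm x + 1 + 1) ltac:(lra)) as (C & H' & HC & HE & Htr).
  rewrite <- Htr by lra. apply sumN_ext. intros i Hi.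
  apply is_derive_unique. apply (expand2_hess_deriv (nrm x + 1) C H' i i x HC HE); auto; lra.
Qed.

Lemma usol_hold rho : 0 < rho -> exists C, hold alpha rho C usol.
Proof.
  intros Hrho. destruct (usol_bounds rho Hrho) as (delta & K & _ & HK & _ & HL).
  eexists. apply (hold_lip alpha Halpha rho K); auto. lra.
Qed.

Lemma ugrad_hold rho i : 0 < rho -> (i < N)%nat -> exists C, hold alpha rho C (ugrad i).
Proof.
  intros Hrho Hi. destruct (usol_expand1 rho Hrho) as [C [HC HE]].
  eexists. apply (expand1_hold alpha Halpha rho C usol ugrad); auto.
Qed.

Lemma uhess_hold rho i j : 0 < rho -> (i < N)%nat -> (j < N)%nat -> exists C, hold alpha rho C (uhess i j).
Proof.
  intros Hrho Hi Hj. destruct (usol_expand2 (rho + 1) ltac:(lra)) as (C & H' & HC & HE & _).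
  assert (E : forall x, nrm x <= rho -> uhess i j x = H' i j x).
  { intros x Hx. apply is_derive_unique. apply (expand2_hess_deriv rho C H' i j x HC HE); auto. }
  eexists. apply (hold_of_local alpha Halpha rho (/ 16) (108 * C) C); try lra.
  - intros x Hx. rewrite E by auto. apply HE; auto. lra.
  - intros x y Hx Hy Hd. rewrite !E by auto.
    apply (expand2_hess alpha Halpha (rho + 1) C usol ugrad H'); auto; lra.
Qed.
Lemma has_partial_of_is_derive (f : RN N -> R) x i l : (i < N)%nat ->
  is_derive (fun t => f (vadd x (vscal t (basis i)))) 0 l -> has_partial f x i l.
Proof.
  intros Hi H. apply is_derive_Reals. apply (is_derive_ext (fun t => f (vadd x (vscal t (basis i))))); auto.
  intros t. rewrite shift_vadd; auto.
Qed.

Lemma usol_classical : C2alpha_loc_with usol alpha ugrad uhess /\ (forall x, 0 < usol x) /\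
  forall x, - sumN N (fun i => uhess i i x) + c x * / usol x * sumN N (fun i => ugrad i x ^ 2) = a x.
Proof.
  split; [|split].
  - split; [|split; [|split; [|split]]].
    + intros i x Hi. apply has_partial_of_is_derive; auto. apply ugrad_deriv; auto.
    + intros i j x Hi Hj. apply has_partial_of_is_derive; auto. apply uhess_deriv; auto.
    + intros r Hr. apply usol_hold; auto.
    + intros i Hi r Hr. apply ugrad_hold; auto.
    + intros i j Hi Hj r Hr. apply uhess_hold; auto.
  - intros x. pose proof (nrm_nonneg x).
    destruct (usol_bounds (nrm x + 1) ltac:(lra)) as (delta & K & Hd & _ & Hb & _). specialize (Hb x ltac:(lra)). lra.
  - intros x. rewrite uhess_trace. unfold ulap. ring.
Qed.
End Limit.

(** * From the hypotheses on a, c and phi to the solution *)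

Lemma holder_loc_hold {N} (f : RN N -> R) alpha r : 0 < r -> holder_loc f alpha ->
  exists K, 0 <= K /\ hold alpha r K f.
Proof.
  intros Hr Hf. destruct (Hf r Hr) as [C HC]. exists (Rabs C). split; [apply Rabs_pos|].
  intros x y Hx Hy Hd. eapply Rle_trans; [apply HC; auto|].
  apply Rmult_le_compat_r; [left; apply Rpower_pos|apply Rle_abs].
Qed.

Lemma hold_unif_cont {N} (f : RN N -> R) alpha r K : 0 < alpha < 1 -> 0 <= K ->
  hold alpha r K f -> unif_cont_on r f.
Proof.
  intros Ha HK Hf e He. exists (Rpower (e / (K + 1)) (/ alpha)). split; [apply Rpower_pos|].
  intros x y Hx Hy Hd. destruct (dist_nonneg x y) as [Hp|E].
  - eapply Rle_lt_trans; [apply Hf; auto|].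
    assert (Hq : 0 < e / (K + 1)) by (apply Rdiv_lt_0_compat; lra).
    assert (Rpower (dist x y) alpha <= e / (K + 1)).
    { replace (e / (K + 1)) with (Rpower (Rpower (e / (K + 1)) (/ alpha)) alpha).
      - apply Rle_Rpower_l; lra.
      - rewrite Rpower_mult, Rinv_l, Rpower_1; lra. }
    pose proof (Rpower_pos (dist x y) alpha).
    assert ((K + 1) * Rpower (dist x y) alpha <= e).
    { replace e with ((K + 1) * (e / (K + 1))) by (field; lra). apply Rmult_le_compat_l; lra. }
    lra.
  - symmetry in E. apply dist_eq0 in E. subst. rewrite Rminus_diag, Rabs_R0; auto.
Qed.

Lemma unif_cont_bounded {N} (f : RN N -> R) r : 0 < r -> unif_cont_on r f ->
  exists B, forall x, nrm x <= r -> Rabs (f x) <= B.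
Proof.
  intros Hr Hf. destruct (unif_cont_clip r f Hr Hf) as [[B HB] _]. exists B. intros x Hx.
  specialize (HB x). rewrite clip_id in HB; auto.
Qed.

Section SphereMax.
Context {N : nat}.
Hypothesis HN0 : (0 < N)%nat.
Variables (a : RN N -> R) (phi : R -> R).
Hypothesis Ha : forall r, 0 < r -> unif_cont_on r a.
Hypothesis Hphi : forall r, 0 <= r -> is_sphere_max a r (phi r).

Lemma radial_neighbor (x : RN N) s : 0 <= s -> exists y : RN N, nrm y = s /\ dist x y = Rabs (nrm x - s).
Proof.
  intros Hs. pose proof (nrm_nonneg x) as H0. destruct H0 as [Hp|E].
  - exists (vscal (s / nrm x) x). split.
    + rewrite nrm_vscal, Rabs_pos_eq by (apply Rdiv_le_0_compat; auto). field. lra.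
    + rewrite dist_nrm. replace (vsub x (vscal (s / nrm x) x)) with (vscal (1 - s / nrm x) x)
        by (apply RN_ext; intros; rewrite coord_vsub, !coord_vscal; ring).
      rewrite nrm_vscal. rewrite <- (Rabs_pos_eq (nrm x)) at 2 by lra. rewrite <- Rabs_mult. f_equal. field. lra.
  - exists (vscal s (basis 0)).
    assert (Hn : nrm (vscal s (@basis N 0)) = s) by (rewrite nrm_vscal, nrm_basis, Rabs_pos_eq by auto; ring).
    split; auto.
    assert (x = vzero) as -> by (apply dist_eq0; rewrite dist_zero; auto).
    rewrite dist_sym, dist_zero, Hn, nrm_vzero, Rminus_0_l, Rabs_Ropp, Rabs_pos_eq; auto.
Qed.

(** A point of maximum on one sphere is moved radially to the other, over the distance |s - t|; the
    modulus of continuity of a passes to phi. *)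
Lemma sphere_max_close r e : 0 < r -> 0 < e -> exists d, 0 < d /\ forall s t, 0 <= s <= r -> 0 <= t <= r ->
  Rabs (s - t) < d -> Rabs (phi s - phi t) < e.
Proof.
  intros Hr He. destruct (Ha r Hr e He) as [d [Hd H]]. exists d. split; auto.
  assert (One : forall s t, 0 <= s <= r -> 0 <= t <= r -> Rabs (s - t) < d -> phi s - phi t < e).
  { intros s t Hs Ht Hst. destruct (Hphi s (proj1 Hs)) as [_ [x [Hx Ex]]].
    destruct (radial_neighbor x t (proj1 Ht)) as [y [Hy Dy]].
    destruct (Hphi t (proj1 Ht)) as [Hm _]. specialize (Hm y Hy).
    specialize (H x y ltac:(lra) ltac:(lra)). rewrite Dy, Hx in H. specialize (H Hst).
    apply Rabs_lt_between in H. lra. }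
  intros s t Hs Ht Hst. apply Rabs_lt_between. split.
  - pose proof (One t s Ht Hs). rewrite Rabs_minus_sym in Hst. specialize (H0 Hst). lra.
  - apply One; auto.
Qed.

Lemma sphere_max_continuous t : continuous (fun t => phi (Rabs t)) t.
Proof.
  apply continuity_pt_filterlim. intros e He. pose proof (Rabs_pos t).
  destruct (sphere_max_close (Rabs t + 1) e ltac:(lra) He) as [d [Hd Hc]].
  exists (Rmin d 1). split; [apply Rmin_glb_lt; lra|]. intros s [_ Hs]. simpl in Hs. unfold Rdist in Hs.
  simpl. unfold Rdist.
  assert (H1 : Rabs (s - t) < d) by (eapply Rlt_le_trans; [apply Hs|apply Rmin_l]).
  assert (H2 : Rabs (s - t) < 1) by (eapply Rlt_le_trans; [apply Hs|apply Rmin_r]).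
  pose proof (Rabs_triang_inv2 s t). pose proof (Rabs_triang_inv s t). pose proof (Rabs_pos s).
  apply Hc; lra.
Qed.
End SphereMax.

(** Convergence of the integral provides L. That L is also an upper bound for every partial integral
    follows from positivity of phi, which makes the partial integrals increase. *)
Lemma moment_limit (phi : R -> R) :
  (forall t, continuous (fun t => phi (Rabs t)) t) -> (forall t, 0 < phi (Rabs t)) ->
  improper_int_finite (fun r => r * phi r) ->
  exists L, (forall r, 0 <= r -> moment (fun t => phi (Rabs t)) r <= L) /\
    forall eps, 0 < eps -> exists T, forall r, T <= r -> L - eps <= moment (fun t => phi (Rabs t)) r.
Proof.
  intros Hc Hpos [Hint [L HL]]. exists L.
  assert (E : forall b (pr : Riemann_integrable (fun r => r * phi r) 0 b), 0 <= b ->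
    moment (fun t => phi (Rabs t)) b = RiemannInt pr).
  { intros b pr Hb. rewrite <- RInt_Reals. apply RInt_ext. intros t Ht.
    rewrite Rmin_left, Rmax_right in Ht by lra. rewrite (Rabs_pos_eq t) by lra. reflexivity. }
  assert (K : forall eps, 0 < eps -> exists B, forall b, 0 <= b -> B <= b ->
    Rabs (moment (fun t => phi (Rabs t)) b - L) < eps).
  { intros eps He. destruct (HL eps He) as [B HB]. exists B. intros b Hb HBb.
    destruct (Hint b Hb) as [pr]. rewrite (E b pr Hb). apply HB; auto. }
  split.
  - intros r Hr. apply le_epsilon. intros e He. destruct (K e He) as [B HB].
    specialize (HB (Rmax r B) (Rle_trans _ _ _ Hr (Rmax_l _ _)) (Rmax_r _ _)).
    assert (moment (fun t => phi (Rabs t)) r <= moment (fun t => phi (Rabs t)) (Rmax r B)).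
    { apply (moment_incr (fun t => phi (Rabs t)) Hc Hpos). split; [auto|apply Rmax_l]. }
    apply Rabs_lt_between in HB. lra.
  - intros e He. destruct (K e He) as [B HB]. exists (Rmax B 0). intros r Hr.
    pose proof (Rmax_l B 0). pose proof (Rmax_r B 0).
    specialize (HB r ltac:(lra) ltac:(lra)). apply Rabs_lt_between in HB. lra.
Qed.

Theorem theorem1p2 (N : nat) (HN : (2 < N)%nat)
  (a c : RN N -> R) (alpha : R) (Halpha : 0 < alpha < 1)
  (Ha_reg : C0alpha_loc a alpha) (Hc_reg : C0alpha_loc c alpha)
  (Ha_pos : forall x, 0 < a x) (Hc_pos : forall x, 0 < c x)
  (phi : R -> R) (Hphi : forall r, 0 <= r -> is_sphere_max a r (phi r))
  (HA3 : improper_int_finite (fun r => r * phi r)) :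
  exists (u : RN N -> R) (Du : nat -> RN N -> R) (D2u : nat -> nat -> RN N -> R),
    C2alpha_loc_with u alpha Du D2u /\
    (forall x, 0 < u x) /\
    (forall x, - sumN N (fun i => D2u i i x)
               + c x * / u x * sumN N (fun i => (Du i x)^2) = a x) /\
    (forall eps, 0 < eps -> exists R0, forall x : RN N, R0 < nrm x -> Rabs (u x) < eps) /\
    (forall mu, 2 < mu < INR N ->
       (exists l, forall eps, 0 < eps -> exists R0, forall x : RN N,
          R0 < nrm x -> Rabs (Rpower (nrm x) mu * phi (nrm x) - l) < eps) ->
       exists C R0, forall x : RN N, R0 < nrm x -> Rabs (u x) <= C * Rpower (nrm x) (2 - mu)).
Proof.
  assert (En : exists n, N = (n + 3)%nat) by (exists (N - 3)%nat; lia).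
  destruct En as [n ->]. assert (HN0 : (0 < n + 3)%nat) by lia.
  assert (Ha1 : forall r, 0 < r -> exists K, 0 <= K /\ hold alpha r K a) by (intros; apply holder_loc_hold; auto).
  assert (Hc1 : forall r, 0 < r -> exists K, 0 <= K /\ hold alpha r K c) by (intros; apply holder_loc_hold; auto).
  assert (Ha2 : forall r, 0 < r -> unif_cont_on r a).
  { intros r Hr. destruct (Ha1 r Hr) as [K [HK Hh]]. apply (hold_unif_cont a alpha r K); auto. }
  assert (Hc2 : forall r, 0 < r -> unif_cont_on r c).
  { intros r Hr. destruct (Hc1 r Hr) as [K [HK Hh]]. apply (hold_unif_cont c alpha r K); auto. }
  (* Only the values of phi on the half-line are constrained; the even extension is continuous and
     positive on the whole line. *)
  set (g := fun t => phi (Rabs t)).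
  assert (Hg : forall t, continuous g t) by (intros t; apply (sphere_max_continuous HN0 a phi Ha2 Hphi)).
  assert (Hgpos : forall t, 0 < g t).
  { intros t. unfold g. destruct (Hphi (Rabs t) (Rabs_pos t)) as [_ [x [_ E]]]. rewrite <- E. auto. }
  assert (Hag : forall x, a x <= g (nrm x)).
  { intros x. unfold g. pose proof (nrm_nonneg x). rewrite Rabs_pos_eq by auto. apply Hphi; auto. }
  destruct (moment_limit phi Hg Hgpos HA3) as [L [HL1 HL2]]. fold g in HL1, HL2.
  destruct (approx_sequence g n L Hg Hgpos HL1 a c Ha2 Hc2 Ha_pos Hc_pos Hag) as (p & Hp1 & Hp2 & Hp3).
  pose proof (sequence_lipschitz g n L Hg Hgpos a c Ha2 Hc2 Ha_pos Hc_pos p Hp1 Hp2 Hp3) as Hlip.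
  assert (Hab : forall r, 0 < r -> exists B, forall x, nrm x <= r -> Rabs (a x) <= B)
    by (intros; apply unif_cont_bounded; auto).
  assert (Hcb : forall r, 0 < r -> exists B, forall x, nrm x <= r -> Rabs (c x) <= B)
    by (intros; apply unif_cont_bounded; auto).
  destruct (usol_classical HN0 alpha (ucap g n L) a c p Halpha Ha1 Hc1 Hab Hcb Hlip Hp2) as [U1 [U2 U3]].
  assert (Hup : forall x : RN (n + 3), usol p x <= 2 * radU g n L (nrm x)).
  { intros x. apply (ulim_le _ _ _ _ (usol_lim (ucap g n L) p Hlip x) (ulim_const _)).
    destruct (srad_large (nrm x)) as [m0 Hm0]. eapply uf_mono; [|apply (uf_cofin m0)].
    intros m Hm. apply Hp1. auto. }
  exists (usol p), (ugrad p), (uhess p). do 3 (split; auto). split.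
  - intros e He. destruct (radU_tends0 g n L Hg Hgpos HL1 HL2 (e / 2) ltac:(lra)) as [T [_ HT]].
    exists T. intros x Hx. specialize (HT (nrm x) ltac:(lra)). specialize (Hup x). specialize (U2 x).
    rewrite Rabs_pos_eq; lra.
  - intros mu Hmu [l Hl]. destruct (Hl 1 ltac:(lra)) as [R0 HR0].
    set (T := Rmax (R0 + 1) 1).
    assert (HT1 : 1 <= T) by apply Rmax_r. assert (HT2 : R0 + 1 <= T) by apply Rmax_l.
    (* Beyond R0 the product t^mu phi(t) is within 1 of its limit l. The hypothesis speaks of
       points, so a radius t is realized by the point t e_0. *)
    destruct (radU_decay g n L Hg Hgpos HL2 mu (Rabs l + 1) T Hmu) as [C HC]; auto.
    + pose proof (Rabs_pos l). lra.
    + intros t Ht. set (x := vscal t (@basis (n + 3) 0)).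
      assert (Hn : nrm x = t) by (unfold x; rewrite nrm_vscal, nrm_basis, Rabs_pos_eq by (auto; lra); ring).
      specialize (HR0 x). rewrite Hn in HR0. specialize (HR0 ltac:(lra)).
      unfold g. rewrite (Rabs_pos_eq t) by lra. pose proof (Rle_abs l).
      apply Rabs_lt_between in HR0. pose proof (Rpower_pos t mu) as Hp.
      rewrite Rpower_Ropp. apply Rmult_le_reg_l with (Rpower t mu); auto.
      replace (Rpower t mu * ((Rabs l + 1) * / Rpower t mu)) with (Rabs l + 1) by (field; lra). lra.
    + exists (2 * C), T. intros x Hx. specialize (HC (nrm x) ltac:(lra)). specialize (Hup x). specialize (U2 x).
      rewrite Rabs_pos_eq; lra.
Qed.
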